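(* Let $\lambda>0$, let $\sigma:\mathbb R\to\mathbb R$ be Lipschitz continuous, let $\mu:\mathbb R_+\to\mathbb R$ be in $L^1_{loc}(\mathbb R_+)$ and bounded at infinity, let $X_0\in L^2(\mathbb P)$, and let $(X_t)_{t\ge0}$ be a solution of $$X_t = X_0\phi(t)+\int_0^t K(t-s)\big(\mu(s)-\lambda X_s\big)\,ds+\int_0^t K(t-s)\sigma(X_s)\,dW_s,\qquad t\ge0,$$ satisfying $$\forall t\ge0,\quad \mathbb E[X_t]=m_0,\qquad \mathrm{Var}(X_t)=v_0\ge0,\qquad \mathbb E[\sigma^2(X_t)]=\bar\sigma_0^2\ge0 .$$ Then only two situations can occur. (i) $\bar\sigma_0=0$. If either $\mu$ is not a.e. zero, or $\mu=0$ a.e. and $\phi(t)\ne1+\lambda\int_0^tK(s)ds$ for Lebesgue-a.e. $t\ge0$, then $\sigma(m_0)=0$ and $X_t=m_0$ $\mathbb P$-a.s. for all $t\ge 0$. If instead $\mu=0$ a.e. and $\phi(t)=1+\lambda\int_0^tK(s)ds$ for Lebesgue-a.e. $t\ge0$, then $\sigma(X_0)=0$ $\mathbb P$-a.s. and $X_t=X_0$ $\mathbb P$-a.s. for all $t\ge 0$. (ii) $\bar\sigma_0>0$. Put $c:=v_0/\bar\sigma_0^2$ and suppose $c\ge\frac1{\lambda^2}\int_0^\infty f_\lambda^2(s)ds$; set $$h_{\lambda,c}(t):=\sqrt{1-\frac1{c\lambda^2}\int_0^tf_\lambda^2(s)\,ds},\qquad t\ge0.$$ Then $(X_t)_{t\ge0}$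 has a stationary variance if and only if either $\mu=0$ a.e. (hence $m_0=0$) and $$\phi(t)=h_{\lambda,c}(t)+\lambda\int_0^tK(t-s)h_{\lambda,c}(s)\,ds,\qquad t\ge0,$$ or $\mu$ is not a.e. zero and $\mu$ is a solution of the first-kind Volterra equation $$(f_\lambda*\mu)(t)=\lambda m_0\big(1-h_{\lambda,c}(t)\big),\qquad t\ge0. \qquad (\ast)$$ In this last case there exists at most one solution $\mu$ of $(\ast)$; and if the functional resolvent of the first kind $r_\lambda$ of $f_\lambda$ is well defined, then $\mu$ in $(\ast)$ is uniquely determined and given by $$\mu(t)=\lambda m_0\,\frac{d}{dt}\Big(r_\lambda*\big(1-h_{\lambda,c}\big)\Big)(t).$$
   Context: $W$ is a real standard Brownian motion on a filtered probability space $(\Omega,\mathcal F,(\mathcal F_t)_{t\ge0},\mathbb P)$ satisfying the usual conditions; $X_0$ is a real $\mathcal F_0$-measurable random variable independent of $W$. A solution is an $(\mathcal F_t)$-adapted pathwise continuous process. $\phi:\mathbb R_+\to\mathbb R$ is a deterministic continuous (locally Hölder) function with $\phi(0)=1$. $K:\mathbb R_+\to\mathbb R_+$, $K\in L^2_{loc}(\mathbb R_+)$, has a finite Laplace transform on $(0,+\infty)$, and for every $T>0$: (i) there are $\widehat\kappa_T<+\infty$, $\widehat\theta\in(0,1]$ with $\sup_{t\in[0,T]}\big[\int_{(t-\delta)^+}^t K(t-u)^2du\big]^{1/2}\le\widehat\kappa_T\delta^{\widehat\theta}$ for all $\delta\in(0,T]$; (ii) there are $\kappa_T<+\infty$, $\theta>0$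 with $\sup_{t\in[0,T]}\big[\int_0^t|K(s+\delta)-K(s)|^2ds\big]^{1/2}\le\kappa_T\delta^\theta$ for all $\delta\in(0,T]$. The $\lambda$-resolvent $R_\lambda$ of $K$ is the solution of $R_\lambda(t)+\lambda\int_0^tK(t-s)R_\lambda(s)ds=1$, $t\ge0$, and $f_\lambda:=-R_\lambda'$ on $(0,+\infty)$. Standing assumption $(\mathcal R_\lambda)$: $R_\lambda$ is well defined and differentiable on $(0,+\infty)$, $R_\lambda(0)=1$, $\lim_{t\to+\infty}R_\lambda(t)=a\in[0,1)$, $f_\lambda\in L^2(\mathbb R_+)$ and $f_\lambda(t)\ne0$ for Lebesgue-a.e. $t$. Convolution: $(g*h)(t)=\int_0^tg(t-s)h(s)ds$. The functional resolvent of the first kind of $f_\lambda$ is (if it exists) the unique real measure $r_\lambda$ on $\mathbb R_+$ of locally finite variation such that $(f_\lambda*r_\lambda)(t)=(r_\lambda*f_\lambda)(t)=1$ for all $t>0$, where $(r_\lambda*g)(t)=\int_{[0,t]}g(t-s)\,r_\lambda(ds)$. ''Stationary variance'' means that $\mathrm{Var}(X_t)=v_0$ for all $t\ge 0$. Uniqueness of $\mu$ is up to Lebesgue-a.e. equality. *)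

(* Defs.v *)
From HB Require Import structures.
From mathcomp Require Import all_boot all_order all_algebra.
From mathcomp Require Import all_classical all_reals all_analysis.
Set Implicit Arguments.
Unset Strict Implicit.
Unset Printing Implicit Defensive.
Import Order.TTheory GRing.Theory Num.Theory.
Import numFieldNormedType.Exports.

Local Open Scope classical_set_scope.
Local Open Scope ring_scope.

(** Functions on [R_+] are total functions [R -> R] of which only the values on
    R_+ are ever constrained or used. *)

Section HalfLine.
Context {R : realType}.
Implicit Types f g h : R -> R.

Local Notation leb := (@lebesgue_measure R).

Definition ae_halfline (Q : R -> Prop) : Prop :=
  {ae leb, forall t : R, 0 <= t -> Q t}.

Definition ae_zero g : Prop := ae_halfline (fun t => g t = 0).

Definition L1loc g : Prop :=
  forall T : R, 0 < T -> leb.-integrable `[0, T] (EFin \o g).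

Definition square_integrable (D : set R) g : Prop :=
  measurable_fun D g /\ leb.-integrable D (fun t => (g t ^+ 2)%:E).

Definition L2loc g : Prop :=
  forall T : R, 0 < T -> square_integrable `[0, T] g.

(* Boundedness at infinity of a Lebesgue class: an essential bound. *)
Definition bounded_at_infty g : Prop :=
  exists A M, ae_halfline (fun t => A <= t -> `|g t| <= M).

Definition convol_integrable g h (t : R) : Prop :=
  leb.-integrable `[0, t] (fun s => (g (t - s) * h s)%:E).

Definition convol g h (t : R) : R :=
  \int[leb]_(s in `[0, t]) (g (t - s) * h s).

Definition loc_hoelder g : Prop :=
  forall T : R, 0 < T -> exists C gamma : R, 0 < gamma <= 1 /\
    forall s t : R, 0 <= s <= T -> 0 <= t <= T ->
      `|g t - g s| <= C * `|t - s| `^ gamma.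

Record kernel_assumption (K : R -> R) : Prop := {
  kernel_ge0 : forall t : R, 0 <= t -> 0 <= K t;
  kernel_L2loc : L2loc K;
  kernel_laplace : forall p : R, 0 < p ->
    leb.-integrable `[0, +oo[ (fun t => (expR (- (p * t)) * K t)%:E);
  kernel_near_diagonal : forall T : R, 0 < T ->
    exists kappa theta : R, 0 < theta <= 1 /\
      forall delta t : R, 0 < delta <= T -> 0 <= t <= T ->
        Num.sqrt (\int[leb]_(u in `[Num.max (t - delta) 0, t])
                    (K (t - u) ^+ 2))
        <= kappa * delta `^ theta;
  kernel_shift : forall T : R, 0 < T ->
    exists kappa theta : R, 0 < theta /\
      forall delta t : R, 0 < delta <= T -> 0 <= t <= T ->
        Num.sqrt (\int[leb]_(s in `[0, t])
                    (`|K (s + delta) - K s| ^+ 2))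
        <= kappa * delta `^ theta
}.

(** Rl is the lambda-resolvent of K and f is - Rl' on the open half-line;
    the value f 0 is left arbitrary. *)
Record resolvent_assumption (K : R -> R) (lambda : R) (Rl f : R -> R)
    : Prop := {
  resolvent_L1loc : L1loc Rl;
  resolvent_eq : forall t : R, 0 <= t -> Rl t + lambda * convol K Rl t = 1;
  resolvent_at0 : Rl 0 = 1;
  resolvent_derive : forall t : R, 0 < t -> is_derive t 1 Rl (- f t);
  resolvent_lim : exists a : R, 0 <= a < 1 /\ Rl t @[t --> +oo] --> a;
  resolvent_f_L2 : square_integrable `[0, +oo[ f;
  resolvent_f_neq0 : ae_halfline (fun t => f t != 0)
}.

Definition hfun (f : R -> R) (lambda c t : R) : R :=
  Num.sqrt (1 - (c * lambda ^+ 2)^-1 * \int[leb]_(s in `[0, t]) (f s ^+ 2)).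

Definition first_kind_volterra_solution (f g mu : R -> R) : Prop :=
  forall t : R, 0 <= t -> convol_integrable f mu t /\ convol f mu t = g t.

Definition admissible_drift (mu : R -> R) : Prop :=
  L1loc mu /\ bounded_at_infty mu.

(** A real measure of locally finite variation on [R_+] need not be a charge
    (its total variation may be infinite), so it is represented as a difference
    of two nonnegative measures that are finite on every [0, T].  The pair need
    not be mutually singular. *)
Record locfin_signed_measure := LocfinSignedMeasure {
  lsm_pos : {measure set (measurableTypeR R) -> \bar R};
  lsm_neg : {measure set (measurableTypeR R) -> \bar R};
  lsm_pos_fin : forall T : R, (lsm_pos `[0%R, T]%classic < +oo)%E;
  lsm_neg_fin : forall T : R, (lsm_neg `[0%R, T]%classic < +oo)%E
}.

Definition mconv_integrable (r : locfin_signed_measure) g (t : R) : Prop :=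
  (lsm_pos r).-integrable `[0, t] (fun s => (g (t - s))%:E) /\
  (lsm_neg r).-integrable `[0, t] (fun s => (g (t - s))%:E).

Definition mconv (r : locfin_signed_measure) g (t : R) : R :=
  \int[lsm_pos r]_(s in `[0, t]) g (t - s)
  - \int[lsm_neg r]_(s in `[0, t]) g (t - s).

Definition first_kind_resolvent f (r : locfin_signed_measure) : Prop :=
  forall t : R, 0 < t -> mconv_integrable r f t /\ mconv r f t = 1.

End HalfLine.

Section Stochastic.
Context {R : realType} {d : measure_display} {Omega : measurableType d}.
Variable P : probability Omega R.

Local Notation leb := (@lebesgue_measure R).

Definition measurable_wrt (G : set (set Omega)) (X : Omega -> R) : Prop :=
  forall B : set R, measurable B -> G (X @^-1` B).

Record usual_filtration (F : R -> set (set Omega)) : Prop := {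
  filtration_sigma_algebra : forall t : R, 0 <= t -> sigma_algebra setT (F t);
  filtration_measurable : forall t : R, 0 <= t -> F t `<=` measurable;
  filtration_mono : forall s t : R, 0 <= s -> s <= t -> F s `<=` F t;
  filtration_right_continuous : forall t : R, 0 <= t ->
    \bigcap_(s in [set s | t < s]) F s `<=` F t;
  filtration_complete : forall N : set Omega, P.-negligible N -> F 0 N
}.

Definition adapted (F : R -> set (set Omega)) (X : R -> Omega -> R) : Prop :=
  forall t : R, 0 <= t -> measurable_wrt (F t) (X t).

Record brownian_motion (F : R -> set (set Omega)) (W : R -> Omega -> R)
    : Prop := {
  bm_adapted : adapted F W;
  bm_at0 : {ae P, forall w, W 0 w = 0};
  bm_continuous : {ae P, forall w, {within `[0, +oo[, continuous (W ^~ w)}};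
  bm_gaussian : forall s t : R, 0 <= s -> s < t ->
    forall B : set R, measurable B ->
      P ((fun w => W t w - W s w) @^-1` B) = normal_prob 0 (Num.sqrt (t - s)) B;
  bm_independent : forall s t : R, 0 <= s -> s < t ->
    forall (A : set Omega) (B : set R), F s A -> measurable B ->
      P (A `&` (fun w => W t w - W s w) @^-1` B)
      = (P A * P ((fun w => (W t w - W s w)%R) @^-1` B))%E
}.

Definition process_sigma_algebra (W : R -> Omega -> R) : set (set Omega) :=
  <<s [set A | exists t, exists B : set R,
                 [/\ 0 <= t, measurable B & A = W t @^-1` B]] >>.

Definition independent_of_process (xi : Omega -> R) (W : R -> Omega -> R)
    : Prop :=
  forall (B : set R) (A : set Omega),
    measurable B -> process_sigma_algebra W A ->
    P (xi @^-1` B `&` A) = (P (xi @^-1` B) * P A)%E.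

(** Simple predictable processes
    [s, w |-> \sum_i sp_coef i w * 1_(]sp_left i, sp_right i]) s]. *)
Record simple_process (F : R -> set (set Omega)) := SimpleProcess {
  sp_size : nat;
  sp_left : 'I_sp_size -> R;
  sp_right : 'I_sp_size -> R;
  sp_coef : 'I_sp_size -> Omega -> R;
  sp_left_right : forall i, 0 <= sp_left i <= sp_right i;
  sp_coef_measurable : forall i, measurable_wrt (F (sp_left i)) (sp_coef i);
  sp_coef_bounded : forall i, exists M, forall w, `|sp_coef i w| <= M
}.

Definition sp_eval F (H : simple_process F) (s : R) (w : Omega) : R :=
  \sum_(i < sp_size H) sp_coef i w * \1_(`]sp_left i, sp_right i]) s.

Definition sp_integral F (W : R -> Omega -> R) (H : simple_process F)
    (t : R) (w : Omega) : R :=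
  \sum_(i < sp_size H) sp_coef i w *
    (W (Num.min (sp_right i) t) w - W (Num.min (sp_left i) t) w).

(** [Y] is (a version of) the Ito integral of [H] against [W] over [0, t]:
    [H] is the limit of simple processes in L^2(P \x leb_[0, t]) and [Y] is the
    L^2(P) limit of their elementary integrals. *)
Definition is_ito_integral (F : R -> set (set Omega)) (W : R -> Omega -> R)
    (t : R) (H : R -> Omega -> R) (Y : Omega -> R) : Prop :=
  measurable_fun setT Y /\
  exists S : nat -> simple_process F,
    (fun n => \int[P]_w \int[leb]_(s in `[0%R, t])
                ((sp_eval (S n) s w - H s w) ^+ 2)%R%:E)%E @ \oo --> 0%E /\
    (fun n => \int[P]_w ((sp_integral W (S n) t w - Y w) ^+ 2)%R%:E)%E
      @ \oo --> 0%E.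

(** Solutions of
    [X_t = X_0 phi t + \int_0^t K (t - s) (mu s - lambda X_s) ds
           + \int_0^t K (t - s) sigma (X_s) dW_s];
    as [mu] is only L^1_loc, the drift integrals being defined for every [t] is
    part of the notion of solution. *)
Record volterra_sde_solution (F : R -> set (set Omega)) (W : R -> Omega -> R)
    (phi K mu : R -> R) (lambda : R) (sigma : R -> R) (X : R -> Omega -> R)
    : Prop := {
  solution_adapted : adapted F X;
  solution_continuous : forall w, {within `[0, +oo[, continuous (X ^~ w)};
  solution_drift : forall t : R, 0 <= t ->
    {ae P, forall w, convol_integrable K (fun s => mu s - lambda * X s w) t};
  solution_eq : forall t : R, 0 <= t ->
    exists2 Y : Omega -> R,
      is_ito_integral F W t (fun s w => K (t - s) * sigma (X s w)) Y &
      {ae P, forall w, X t w =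
         X 0 w * phi t + convol K (fun s => mu s - lambda * X s w) t + Y w}
}.

Definition stationary_variance (X : R -> Omega -> R) (v0 : R) : Prop :=
  forall t : R, 0 <= t -> variance P (X t) = v0%:E.

End Stochastic.

(* Main.v *)
(** Put psi := phi - f * phi.  Since f = lambda K - lambda f * K a.e., convolving
    the equation with f turns it into
      X_t = X_0 psi(t) + (f * mu)(t) / lambda + Z_t,   Z := Y - f * Y,
    where Y_t is the stochastic integral of K(t - .) sigma(X).  By the Ito isometry
    Y has the Gram kernel E[Y_s Y_r] = sbar0^2 \int K(s - u) K(r - u) du, which is
    also that of the functions u |-> sbar0 K(s - u) in L^2(du); hence
    E[Z_t^2] = (sbar0 / lambda)^2 \int_0^t f^2, and
      f * mu = lambda m0 (1 - psi),
      Var X_t = v0 psi(t)^2 + (sbar0 / lambda)^2 \int_0^t f^2.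
    When sbar0 > 0 the variance is therefore constant iff psi^2 = h^2, that is
    psi = h by continuity, and psi = h means phi = h + lambda K * h.  Laplace
    transforms show that f * nu = 0 forces nu = 0, and r * f = 1 makes r * (f * mu)
    the primitive of mu. *)

Require Import Defs.
From HB Require Import structures.
From mathcomp Require Import all_boot all_order all_algebra.
From mathcomp Require Import all_classical all_reals all_analysis.
From mathcomp Require Import measurable_realfun ring lra.
Set Implicit Arguments.
Unset Strict Implicit.
Unset Printing Implicit Defensive.
Import Order.TTheory GRing.Theory Num.Theory.
Import numFieldNormedType.Exports.

Local Open Scope classical_set_scope.
Local Open Scope ring_scope.

(** Convolving the equation with [f] seems to call for a stochastic Fubini theorem, while the Ito
    integrals are given separately at each time, each up to a null set. Both obstacles vanish when
    the stochastic term is read off the equation: [ito_part] is [X] minus the other terms, jointly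
    measurable because the paths of [X] are continuous, and its convolution with [f] is an ordinary
    pathwise one. After that only inner products in [L^2(P)] enter.

    Three weak assumptions shape the rest. [Rl] has a derivative at each point of the open
    half-line, but one only known to be in [L^2]: its increments are recovered through a lower
    semicontinuous majorant, and the constant of integration at 0 comes from the resolvent equation.
    The drift is only locally integrable, so the convergence of [f * mu] is deduced from that of
    [K * mu]. Finally [f 0] is arbitrary while [r] may have atoms, so that the equation [r * f = 1]
    is used in integrated form. *)

Notation L1 mu f := (mu.-integrable setT (fun x => (f x)%:E)).

(** * Integrals of real-valued functions *)

Section AlmostEverywhere.
Context {R : realType} {d : measure_display} {T : measurableType d}.
Variable mu : {measure set T -> \bar R}.

Lemma aeS (A B : T -> Prop) : (forall x, A x -> B x) ->
  {ae mu, forall x, A x} -> {ae mu, forall x, B x}.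
Proof. by move=> AB; apply: filterS. Qed.

Lemma aeS2 (A B C : T -> Prop) : (forall x, A x -> B x -> C x) ->
  {ae mu, forall x, A x} -> {ae mu, forall x, B x} -> {ae mu, forall x, C x}.
Proof. by move=> ABC; apply: filterS2. Qed.

Lemma aeT (A : T -> Prop) : (forall x, A x) -> {ae mu, forall x, A x}.
Proof. exact: nearW. Qed.

End AlmostEverywhere.

Section RealIntegrals.
Context {R : realType} {d : measure_display} {T : measurableType d}.
Variable mu : {measure set T -> \bar R}.
Implicit Types f g : T -> R.

Lemma L1_measurable f : L1 mu f -> measurable_fun setT f.
Proof. by move=> /(measurable_int mu) /measurable_EFinP. Qed.

Lemma L1_le f g : measurable_fun setT f -> L1 mu g ->
  (forall x, `|f x| <= `|g x|) -> L1 mu f.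
Proof.
move=> mf ig fg; apply: (le_integrable measurableT _ _ ig).
  exact/measurable_EFinP.
by move=> x _ /=; rewrite lee_fin.
Qed.

Lemma L1D f g : L1 mu f -> L1 mu g -> L1 mu (fun x => f x + g x).
Proof. exact: integrableD. Qed.

Lemma L1B f g : L1 mu f -> L1 mu g -> L1 mu (fun x => f x - g x).
Proof. exact: integrableB. Qed.

Lemma L1Zl k f : L1 mu f -> L1 mu (fun x => k * f x).
Proof. exact: integrableZl. Qed.

Lemma L1Zr k f : L1 mu f -> L1 mu (fun x => f x * k).
Proof. by move=> /(L1Zl k); under eq_fun do rewrite mulrC. Qed.

Lemma L1_norm f : L1 mu f -> L1 mu (fun x => `|f x|).
Proof. exact: integrable_norm. Qed.

Lemma L1_ae f g : L1 mu f -> measurable_fun setT g ->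
  {ae mu, forall x, f x = g x} -> L1 mu g.
Proof.
move=> /integrableP[mf fi] mg fg; apply/integrableP; split.
  exact/measurable_EFinP.
rewrite -(@ge0_ae_eq_integral _ _ _ mu setT (fun x => `|(f x)%:E|%E))//.
- exact: measurableT_comp.
- by apply: measurableT_comp => //; exact/measurable_EFinP.
- by apply: aeS fg => x fgx _; rewrite fgx.
Qed.

Lemma L1_abs_lty f : measurable_fun setT f ->
  (\int[mu]_x `|f x|%:E < +oo)%E -> L1 mu f.
Proof. by move=> mf fi; apply/integrableP; split => //; exact/measurable_EFinP. Qed.

Lemma ae_eq_Rintegral f g : measurable_fun setT f -> measurable_fun setT g ->
  {ae mu, forall x, f x = g x} -> \int[mu]_x f x = \int[mu]_x g x.
Proof.
move=> mf mg fg; congr fine; apply: ae_eq_integral => //.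
- exact/measurable_EFinP.
- exact/measurable_EFinP.
- by apply: aeS fg => x fgx _ /=; rewrite fgx.
Qed.

Lemma RintegralTD f g : L1 mu f -> L1 mu g ->
  \int[mu]_x (f x + g x) = \int[mu]_x f x + \int[mu]_x g x.
Proof. exact: RintegralD. Qed.

Lemma RintegralTB f g : L1 mu f -> L1 mu g ->
  \int[mu]_x (f x - g x) = \int[mu]_x f x - \int[mu]_x g x.
Proof. exact: RintegralB. Qed.

Lemma RintegralTZ k f : L1 mu f -> \int[mu]_x (k * f x) = k * \int[mu]_x f x.
Proof. exact: RintegralZl. Qed.

Lemma EFin_Rintegral f : L1 mu f ->
  (\int[mu]_x f x)%:E = (\int[mu]_x (f x)%:E)%E.
Proof. by move=> fi; rewrite /Rintegral fineK//; exact: integrable_fin_num. Qed.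

Lemma Rintegral0_ae f : L1 mu f -> (forall x, 0 <= f x) ->
  \int[mu]_x f x = 0 -> {ae mu, forall x, f x = 0}.
Proof.
move=> fi f0 I0.
have mf := L1_measurable fi.
have h : (\int[mu]_(x in setT) `|(f x)%:E| = 0)%E.
  under eq_integral do rewrite gee0_abs ?lee_fin//.
  by rewrite -EFin_Rintegral// I0.
have := (ae_eq_integral_abs mu measurableT
  (proj2 (measurable_EFinP setT f) mf)).1 h.
by apply: aeS => x /(_ I) [].
Qed.

End RealIntegrals.

(** * Fubini's theorem for real-valued integrals *)

Section RealFubini.
Context {R : realType} {d1 d2 : measure_display}.
Context {T1 : measurableType d1} {T2 : measurableType d2}.
Variable m1 : {sigma_finite_measure set T1 -> \bar R}.
Variable m2 : {sigma_finite_measure set T2 -> \bar R}.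
Variable F : T1 -> T2 -> R.

Hypothesis mF : measurable_fun setT (fun z : T1 * T2 => F z.1 z.2).

Lemma L1_prod12 :
  (\int[m1]_x \int[m2]_y `|F x y|%:E < +oo)%E ->
  L1 (m1 \x m2)%E (fun z => F z.1 z.2).
Proof.
move=> h; apply/(integrable12ltyP m1 m2); last exact: h.
exact/measurable_EFinP.
Qed.

Lemma L1_prod21 :
  (\int[m2]_y \int[m1]_x `|F x y|%:E < +oo)%E ->
  L1 (m1 \x m2)%E (fun z => F z.1 z.2).
Proof.
move=> h; apply/(integrable21ltyP m1 m2); last exact: h.
exact/measurable_EFinP.
Qed.

Lemma measurable_section1 x : measurable_fun setT (F x).
Proof.
exact: (measurableT_comp mF (pair1_measurable x)).
Qed.

Lemma measurable_section2 y : measurable_fun setT (F ^~ y).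
Proof.
exact: (measurableT_comp mF (pair2_measurable y)).
Qed.

(** Tonelli applies to the positive and negative parts separately and [fine] is measurable, so the
    partial integral is measurable even where a section fails to be integrable. *)
Lemma measurable_Rintegral2 : measurable_fun setT (fun x => \int[m2]_y F x y).
Proof.
rewrite /Rintegral.
have -> : (fun x => fine (\int[m2]_y (F x y)%:E)) =
    fine \o ((fun x => \int[m2]_y (fun y => (F x y)%:E)^\+ y) \-
    (fun x => \int[m2]_y (fun y => (F x y)%:E)^\- y))%E.
  by apply/funext => x /=; rewrite integralE.
apply: measurableT_comp; first exact: fine_measurable.
apply: emeasurable_funB.
- rewrite (_ : (fun x => _) = fubini_F m2 (fun z => (F z.1 z.2)%:E)^\+%E).
    apply: measurable_fun_fubini_tonelli_F => //.
    by apply: measurable_funepos; exact/measurable_EFinP.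
  by apply/funext => x; apply: eq_integral => y _; rewrite !funeposE.
- rewrite (_ : (fun x => _) = fubini_F m2 (fun z => (F z.1 z.2)%:E)^\-%E).
    apply: measurable_fun_fubini_tonelli_F => //.
    by apply: measurable_funeneg; exact/measurable_EFinP.
  by apply/funext => x; apply: eq_integral => y _; rewrite !funenegE.
Qed.

Hypothesis iF : L1 (m1 \x m2)%E (fun z => F z.1 z.2).

Lemma ae_L1_section1 : {ae m1, forall x, L1 m2 (F x)}.
Proof. exact: (ae_integrable1 iF). Qed.

(** Where a section is not integrable, [fine] returns a default value. This happens on a null set
    only, so the comparison with the extended-real Fubini integral is made almost everywhere. *)
Lemma L1_Rintegral2 : L1 m1 (fun x => \int[m2]_y F x y).
Proof.
have /integrableP[mI iI] := integrable_fubini_F iF.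
apply: L1_abs_lty; first exact: measurable_Rintegral2.
apply: le_lt_trans iI; apply: ae_ge0_le_integral => //.
- by apply/measurable_EFinP; apply: measurableT_comp => //; exact: measurable_Rintegral2.
- exact: measurableT_comp.
- apply: aeS ae_L1_section1 => x ix _ /=.
  rewrite /fubini_F /=; have /= := EFin_Rintegral ix => <-.
  by rewrite lee_fin.
Qed.

Lemma Rintegral12_prod :
  \int[m1]_x \int[m2]_y F x y = \int[(m1 \x m2)%E]_z F z.1 z.2.
Proof.
rewrite /Rintegral -(integral12_prod_meas1 iF); congr fine.
apply: ae_eq_integral => //.
- exact/measurable_EFinP/measurable_Rintegral2.
- exact: measurable_fubini_F iF.
apply: aeS ae_L1_section1 => x ix _ /=.
exact: (EFin_Rintegral ix).
Qed.

End RealFubini.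

Section RealFubiniSwap.
Context {R : realType} {d1 d2 : measure_display}.
Context {T1 : measurableType d1} {T2 : measurableType d2}.
Variable m1 : {sigma_finite_measure set T1 -> \bar R}.
Variable m2 : {sigma_finite_measure set T2 -> \bar R}.
Variable F : T1 -> T2 -> R.

Hypothesis mF : measurable_fun setT (fun z : T1 * T2 => F z.1 z.2).

Lemma measurable_prod_swap : measurable_fun setT (fun z : T2 * T1 => F z.2 z.1).
Proof.
apply: (measurableT_comp mF (g := fun z : T2 * T1 => (z.2, z.1))).
exact: measurable_fun_pair.
Qed.

Hypothesis iF : L1 (m1 \x m2)%E (fun z => F z.1 z.2).

Lemma L1_prod_swap : L1 (m2 \x m1)%E (fun z => F z.2 z.1).
Proof.
apply: (@L1_prod21 _ _ _ _ _ m2 m1 (fun y x => F x y)).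
  exact: measurable_prod_swap.
have /integrable12ltyP := iF; apply.
exact/measurable_EFinP.
Qed.

Lemma ae_L1_section2 : {ae m2, forall y, L1 m1 (fun x => F x y)}.
Proof.
exact: (@ae_L1_section1 _ _ _ _ _ m2 m1 (fun y x => F x y) L1_prod_swap).
Qed.

Lemma L1_Rintegral1 : L1 m2 (fun y => \int[m1]_x F x y).
Proof.
exact: (@L1_Rintegral2 _ _ _ _ _ m2 m1 (fun y x => F x y)
  measurable_prod_swap L1_prod_swap).
Qed.

Lemma RFubini :
  \int[m1]_x \int[m2]_y F x y = \int[m2]_y \int[m1]_x F x y.
Proof.
rewrite (Rintegral12_prod mF iF).
rewrite /Rintegral -(integral21_prod_meas1 iF); congr fine.
apply: ae_eq_integral => //.
- exact: measurable_fubini_G iF.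
- apply/measurable_EFinP.
  exact: (@measurable_Rintegral2 _ _ _ _ _ m1 (fun y x => F x y) measurable_prod_swap).
apply: aeS ae_L1_section2 => x ix _ /=.
exact/esym/(EFin_Rintegral ix).
Qed.

End RealFubiniSwap.

(** * Image measures and symmetries of Lebesgue measure *)

Section Pushforward.
Context {R : realType} {d1 d2 : measure_display}.
Context {T1 : measurableType d1} {T2 : measurableType d2}.
Variables (mu : {measure set T1 -> \bar R}) (g : T1 -> T2).
Hypothesis mg : measurable_fun setT g.

Definition image_measure : {measure set T2 -> \bar R} :=
  measure_function_pushforward__canonical__measure_function_Measure mu mg.

Lemma ge0_integral_image_measure (f : T2 -> \bar R) : measurable_fun setT f ->
  (forall y, (0 <= f y)%E) ->
  (\int[image_measure]_y f y = \int[mu]_x f (g x))%E.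
Proof. by move=> mf f0; rewrite ge0_integral_pushforward. Qed.

Lemma L1_image_measure (f : T2 -> R) : measurable_fun setT f ->
  L1 image_measure f <-> L1 mu (fun x => f (g x)).
Proof.
move=> mf; have mfg := measurableT_comp mf mg.
have E : (\int[image_measure]_y `|f y|%:E = \int[mu]_x `|f (g x)|%:E)%E.
  rewrite (ge0_integral_image_measure (f := fun y => `|f y|%:E)) //.
  by apply/measurable_EFinP; exact: measurableT_comp.
split=> /integrableP[_ fi]; apply: L1_abs_lty => //; first by rewrite -E.
by rewrite E.
Qed.

Lemma Rintegral_image_measure (f : T2 -> R) : measurable_fun setT f ->
  \int[image_measure]_y f y = \int[mu]_x f (g x).
Proof.
move=> mf; have mfe : measurable_fun setT (EFin \o f) by exact/measurable_EFinP.
congr fine; rewrite integralE [in RHS]integralE; congr (_ - _)%E.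
  rewrite (ge0_integral_image_measure (measurable_funepos mfe)) //.
  by apply: eq_integral => s _; rewrite !funeposE.
rewrite (ge0_integral_image_measure (measurable_funeneg mfe)) //.
by apply: eq_integral => s _; rewrite !funenegE.
Qed.

End Pushforward.

Section LebesgueReflection.
Context {R : realType}.
Local Notation leb := (@lebesgue_measure R).
Implicit Types (f : R -> R) (t : R).

Lemma measurable_reflect t :
  measurable_fun setT (fun s : measurableTypeR R => t - s : measurableTypeR R).
Proof. by apply: measurable_funB. Qed.

Local Notation nu t := (image_measure leb (measurable_reflect t)).

(** The preimage of []a, b]] is [[t - b, t - a[], of the same length, and half-open intervals
    determine Lebesgue measure. *)
Lemma image_measure_reflect t (A : set R) : measurable A -> nu t A = leb A.
Proof.
move=> mA; apply/esym.
apply: (lebesgue_measure_unique (mu := nu t)) => // X.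
move=> [[a b] _ <-] /=.
change (leb `]a, b] = leb ((fun s : R => t - s) @^-1` `]a, b]%classic)).
have -> : (fun s : R => t - s) @^-1` `]a, b]%classic = `[t - b, t - a[%classic.
  by apply/seteqP; split => s /=; rewrite !in_itv/= => /andP[h1 h2];
    apply/andP; split; lra.
rewrite !lebesgue_measure_itv/= !lte_fin.
have -> : (t - b < t - a) = (a < b) by apply/idP/idP; lra.
by case: ifP => // _; rewrite -!EFinD; congr EFin; lra.
Qed.

Lemma ge0_integral_reflect t (f : R -> \bar R) : measurable_fun setT f ->
  (forall s, (0 <= f s)%E) ->
  (\int[leb]_s f (t - s)%R = \int[leb]_s f s)%E.
Proof.
move=> mf f0; rewrite -(ge0_integral_image_measure leb (measurable_reflect t))//.
by apply: eq_measure_integral => A mA _; exact: image_measure_reflect.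
Qed.

Lemma Rintegral_reflect t f : measurable_fun setT f ->
  \int[leb]_s f (t - s) = \int[leb]_s f s.
Proof.
move=> mf; rewrite -(Rintegral_image_measure leb (measurable_reflect t) mf).
congr fine.
by apply: eq_measure_integral => A mA _; exact: image_measure_reflect.
Qed.

Lemma L1_reflect t f : L1 leb f -> L1 leb (fun s => f (t - s)).
Proof.
move=> /[dup] fi /integrableP[_ fy]; have mf := L1_measurable fi.
apply: L1_abs_lty; first exact: (measurableT_comp mf (measurable_reflect t)).
rewrite (ge0_integral_reflect t (f := fun s => `|f s|%:E)) //.
by apply/measurable_EFinP; exact: measurableT_comp.
Qed.

(** A translation is the composite of two reflections. *)
Lemma L1_shift t f : L1 leb f -> L1 leb (fun s => f (s - t)).
Proof.
move=> fi; have := L1_reflect 0 (L1_reflect (- t) fi).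
by congr (integrable _ _ _); apply/funext => s; congr (f _)%:E; lra.
Qed.

Lemma Rintegral_shift t f : measurable_fun setT f ->
  \int[leb]_s f (s - t) = \int[leb]_s f s.
Proof.
move=> mf; rewrite -(Rintegral_reflect (- t) mf).
have mg : measurable_fun setT (fun s : R => f (- t - s)).
  exact: (measurableT_comp mf (measurable_reflect (- t))).
rewrite -(Rintegral_reflect 0 mg).
by apply: eq_Rintegral => s _; congr f; lra.
Qed.

Lemma ge0_integral_shift t (f : R -> \bar R) : measurable_fun setT f ->
  (forall s, (0 <= f s)%E) ->
  (\int[leb]_s f (s - t)%R = \int[leb]_s f s)%E.
Proof.
move=> mf f0; rewrite -(ge0_integral_reflect (- t) mf)//.
have mg : measurable_fun setT (fun s : R => f (- t - s)).
  exact: (measurableT_comp mf (measurable_reflect (- t))).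
rewrite -(ge0_integral_reflect 0 mg)//.
by apply: eq_integral => s _; congr f; lra.
Qed.

Lemma ae_reflect t (A : R -> Prop) :
  {ae leb, forall s, A s} -> {ae leb, forall s, A (t - s)}.
Proof.
move=> [N [mN N0 AN]]; have mr := measurable_reflect t.
exists ((fun s : R => t - s) @^-1` N); split.
- by rewrite -[X in measurable X]setTI; exact: mr.
- by have := image_measure_reflect t mN; rewrite N0.
- by move=> s /= nA; exact: AN.
Qed.

End LebesgueReflection.

(** * Increments of differentiable functions *)

Section RealIntegralsOn.
Context {R : realType} {d : measure_display} {T : measurableType d}.
Variable mu : {measure set T -> \bar R}.

Lemma EFin_Rintegral_in (D : set T) (f : T -> R) : measurable D ->
  mu.-integrable D (EFin \o f) ->
  (\int[mu]_(x in D) f x)%:E = (\int[mu]_(x in D) (f x)%:E)%E.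
Proof. by move=> mD fi; rewrite /Rintegral fineK//; exact: integrable_fin_num. Qed.

Lemma integrable_EFinD (D : set T) (f g : T -> R) : measurable D ->
  mu.-integrable D (EFin \o f) -> mu.-integrable D (EFin \o g) ->
  mu.-integrable D (EFin \o (fun x => f x + g x)).
Proof. by move=> mD fi gi; have := integrableD mD fi gi. Qed.

Lemma integrable_EFinB (D : set T) (f g : T -> R) : measurable D ->
  mu.-integrable D (EFin \o f) -> mu.-integrable D (EFin \o g) ->
  mu.-integrable D (EFin \o (fun x => f x - g x)).
Proof. by move=> mD fi gi; have := integrableB mD fi gi. Qed.

Lemma integrable_EFinZ (D : set T) (k : R) (f : T -> R) : measurable D ->
  mu.-integrable D (EFin \o f) -> mu.-integrable D (EFin \o (fun x => k * f x)).
Proof. by move=> mD fi; have := integrableZl mD k fi. Qed.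

Lemma Rintegral_dominated_cvg (D : set T) (f_ : nat -> T -> R) (f g : T -> R) :
  measurable D -> (forall n, measurable_fun D (f_ n)) -> measurable_fun D f ->
  {ae mu, forall x, D x -> f_ n x @[n --> \oo] --> f x} ->
  mu.-integrable D (EFin \o g) ->
  {ae mu, forall x n, D x -> `|f_ n x| <= g x} ->
  mu.-integrable D (EFin \o f) /\
  \int[mu]_(x in D) f_ n x @[n --> \oo] --> \int[mu]_(x in D) f x.
Proof.
move=> mD mf_ mf cf ig fg.
have [|||||i _ c] := @dominated_convergence _ _ _ mu D mD (fun n => EFin \o f_ n)
  (EFin \o f) (EFin \o g).
- by move=> n; exact/measurable_EFinP.
- exact/measurable_EFinP.
- apply: aeS cf => x cfx Dx; apply: cvg_EFin; first exact: nearW.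
  exact: cfx.
- exact: ig.
- by apply: aeS fg => x fgx n Dx; rewrite /= lee_fin; exact: fgx.
split => //; apply: fine_cvg; rewrite EFin_Rintegral_in//; exact: c.
Qed.

End RealIntegralsOn.

Section DerivativeIntegral.
Context {R : realType}.
Local Notation leb := (@lebesgue_measure R).

(** The sum counts the levels [(k + 1) eps] strictly below [y], which is why it stays below [y]. The
    second bound is what lets the induction pass: a new level is only added when
    [(n + 1) eps < y]. *)
Lemma layer_sum_le (eps y : R) (n : nat) : 0 < eps -> 0 <= y ->
  \sum_(k < n) eps * (k.+1%:R * eps < y)%R%:R <= y /\
  \sum_(k < n) eps * (k.+1%:R * eps < y)%R%:R <= n%:R * eps.
Proof.
move=> e0 y0; elim: n => [|n [IH1 IH2]]; first by rewrite big_ord0 mul0r.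
rewrite big_ord_recr /=; case: ltP => [ny|_]; last first.
  rewrite mulr0 addr0; split => //; apply: (le_trans IH2).
  by rewrite ler_pM2r// ler_nat.
have : n.+1%:R * eps = n%:R * eps + eps by rewrite -natr1 mulrDl mul1r.
by move: ny => /[swap] ->; rewrite mulr1; split; lra.
Qed.

(* Vitali-Caratheodory: g is eps times the sum over k of the indicators of open
   neighbourhoods of the level sets {psi > (k + 1) eps}. *)
Lemma lower_majorant (psi : R -> R) (a b eps : R) : 0 < eps ->
  leb.-integrable `[a, b] (EFin \o psi) ->
  (forall x, `[a, b]%classic x -> 0 <= psi x) ->
  exists g : R -> \bar R, [/\ measurable_fun setT g, (forall x, 0 <= g x)%E,
   (\int[leb]_(x in `[a, b]) g x <=
     \int[leb]_(x in `[a, b]) (psi x)%:E + eps%:E)%E &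
   forall x, `[a, b]%classic x -> exists m : R, [/\ psi x <= m + eps, 0 <= m &
     \forall y \near x, (m%:E <= g y)%E]].
Proof.
move=> e0 ipsi psi0.
have mpsi : measurable_fun `[a, b] psi.
  by apply/measurable_EFinP; exact: measurable_int ipsi.
pose E k := `[a, b]%classic `&` psi @^-1` `]k.+1%:R * eps, +oo[.
have mE k : measurable (E k) by apply: mpsi => //; exact: measurable_itv.
have Ey k : (leb (E k) < +oo)%E.
  apply: (@le_lt_trans _ _ (leb `[a, b])).
    by apply: le_measure; [rewrite inE; exact: mE|rewrite inE; exact: measurable_itv|exact: subIsetl].
  by rewrite lebesgue_measure_itv /=; case: ifP => _; rewrite ?ltry -?EFinD ?ltry.
have p2 k : 0 < (1 / (2 ^ k.+1)%:R) :> R by rewrite divr_gt0// ltr0n expn_gt0.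
(* The excesses [1 / 2^(k+1)] sum to 1, so enlarging every level set [E k] to the open [V k] adds at
   most [eps] to the integral. *)
have /choice[V /all_and3[oV EV VE]] : forall k, exists U : set R,
    [/\ open U, E k `<=` U & (leb (U `\` E k) < (1 / (2 ^ k.+1)%:R)%:E)%E].
  by move=> k; apply: lebesgue_regularity_outer; [exact: mE|exact: Ey|exact: p2].
have mV k : measurable (V k) by exact: open_measurable.
pose g y := (\sum_(k <oo) (eps * \1_(V k) y)%:E)%E.
have u0 k y : (0 <= (eps * \1_(V k) y)%:E)%E.
  by rewrite lee_fin mulr_ge0// ltW.
have mu k : measurable_fun setT (fun y : R => (eps * \1_(V k) y)%:E).
  by apply/measurable_EFinP; apply: measurable_funM => //; exact: measurable_indic.
have uE0 k y : (0 <= (eps * \1_(E k) y)%:E)%E.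
  by rewrite lee_fin mulr_ge0// ltW.
have muE k : measurable_fun setT (fun y : R => (eps * \1_(E k) y)%:E).
  by apply/measurable_EFinP; apply: measurable_funM => //; exact: measurable_indic.
have Iind A : measurable A ->
    (\int[leb]_(x in `[a, b]) (eps * \1_A x)%:E = eps%:E * leb (A `&` `[a, b]))%E.
  move=> mA; under eq_integral do rewrite EFinM.
  rewrite ge0_integralZl//; first by rewrite integral_indic.
  - by apply: measurable_funTS; apply/measurable_EFinP; exact: measurable_indic.
  - by move: e0 => /ltW; rewrite -lee_fin.
have mEI k : measurable (E k `&` `[a, b]).
  by apply: measurableI; [exact: mE|exact: measurable_itv].
have mVE k : measurable (V k `\` E k).
  by apply: measurableD; [exact: mV|exact: mE].
have mVI k : measurable (V k `&` `[a, b]).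
  by apply: measurableI; [exact: mV|exact: measurable_itv].
exists g; split.
- have := @ge0_emeasurable_sum _ _ R setT (fun k y => (eps * \1_(V k) y)%:E) xpredT.
  apply; [by move=> k y _ _; exact: u0|move=> k _; exact: mu].
- by move=> x; apply: nneseries_ge0.
- rewrite /g integral_nneseries; [|by []|move=> k; apply: measurable_funTS; apply: mu|by move=> k x _; exact: u0].
  apply: (@le_trans _ _ (\sum_(k <oo) (\int[leb]_(x in `[a, b]) (eps * \1_(E k) x)%:E
     + (eps / (2 ^ k.+1)%:R)%:E)))%E.
    apply: lee_nneseries => [k _ _|k _]; first by apply: integral_ge0 => x _.
    rewrite (Iind _ (mE k)) (Iind _ (mV k)).
    have -> : (eps / (2 ^ k.+1)%:R)%:E = (eps%:E * (1 / (2 ^ k.+1)%:R)%:E)%E.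
      by rewrite -EFinM mul1r.
    rewrite -muleDr//; last first.
      by rewrite ge0_adde_def// inE ?measure_ge0// lee_fin ltW.
    apply: lee_wpmul2l; first by rewrite lee_fin ltW.
    apply: (@le_trans _ _ (leb ((E k `&` `[a, b]) `|` (V k `\` E k)))).
      apply: le_measure; rewrite ?inE.
      - exact: mVI.
      - by apply: measurableU; [exact: mEI|exact: mVE].
      - by move=> x [Vx abx]; have [Ex|nEx] := pselect (E k x); [left|right].
    apply: (le_trans (measureU2 _ _ _)).
    - exact: mEI.
    - exact: mVE.
    - by rewrite leeD2l// ltW// VE.
  apply: (@le_trans _ _ (\sum_(k <oo)
      (\int[leb]_(x in `[a, b]) (eps * \1_(E k) x)%:E) + eps%:E)%E).
    apply: epsilon_trick; last exact: ltW.
    by move=> k; apply: integral_ge0 => x _; exact: uE0.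
  rewrite leeD2r// -integral_nneseries; [|by []|move=> k; apply: measurable_funTS; apply: muE|by move=> k x _; exact: uE0].
  apply: ge0_le_integral => //.
  - by move=> x _; apply: nneseries_ge0 => k _ _; exact: uE0.
  - apply: measurable_funTS.
    have := @ge0_emeasurable_sum _ _ R setT (fun k y => (eps * \1_(E k) y)%:E) xpredT.
    by apply => //; move=> k _; exact: muE.
  - exact/measurable_EFinP.
  - move=> x abx; apply: lime_le; first by apply: is_cvg_nneseries => k _ _; exact: uE0.
    apply: nearW => n; rewrite sumEFin lee_fin big_mkord.
    have [+ _] := layer_sum_le n e0 (psi0 x abx).
    apply: le_trans; rewrite le_eqVlt; apply/orP; left; apply/eqP.
    apply: eq_bigr => k _; congr (_ * _); rewrite indicE; congr (_%:R).
    congr nat_of_bool; apply/idP/idP => [/set_mem[_]|h].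
      by rewrite /= in_itv/= andbT.
    by rewrite inE; split => //=; rewrite in_itv/= andbT.
- move=> x abx.
  have exn : exists n, psi x <= n.+1%:R * eps.
    have /ltW h := truncnS_gt (psi x / eps).
    by exists (Num.truncn (psi x / eps)); rewrite -ler_pdivrMr.
  (* By minimality [x] lies in [E k] for all [k < m], so the finitely many open sets [V k] with
     [k < m] have a common neighbourhood of [x] on which [g >= m eps]. *)
  set m := ex_minn exn.
  have mP : psi x <= m.+1%:R * eps by rewrite /m; case: ex_minnP.
  have mmin k : (k < m)%N -> k.+1%:R * eps < psi x.
    rewrite /m; case: ex_minnP => j _ jmin kj.
    by rewrite ltNge; apply/negP => /jmin; rewrite leqNgt kj.
  exists (m%:R * eps); split.
  - by rewrite -[X in _ + X]mul1r -mulrDl natr1.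
  - by rewrite mulr_ge0// ltW.
  - have : \forall y \near x, forall i : 'I_m, V i y.
      have := @filter_forall R 'I_m (fun i => V i) (nbhs x) _; apply => i.
      have : V i x by apply: EV; split => //=; rewrite in_itv/= andbT mmin.
      by move=> Vx; apply: open_nbhs_nbhs; split => //; exact: oV.
    apply: filterS => y Vy.
    apply: (@le_trans _ _ (\sum_(0 <= k < m) (eps * \1_(V k) y)%:E)%E); last first.
      exact: nneseries_lim_ge.
    rewrite sumEFin lee_fin big_mkord.
    rewrite (eq_bigr (fun=> eps)); last first.
      by move=> i _; rewrite indicE mem_set ?mulr1//; exact: Vy.
    by rewrite sumr_const card_ord mulr_natl.
Qed.

Lemma derive_increment_le (F : R -> R) (x D e : R) : is_derive x 1 F D -> 0 < e ->
  \forall y \near x, x <= y -> F y - F x <= (D + e) * (y - x).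
Proof.
move=> [dF FD] e0.
have /cvgrPdist_lt/(_ _ e0) : h^-1 *: ((F \o shift x) (h *: 1) - F x) @[h --> 0^'] --> D.
  by rewrite -FD; exact: dF.
move=> [d /= d0 H].
exists d => //= y /= yd; rewrite le_eqVlt => /predU1P[<-|xy].
  by rewrite !subrr mulr0.
have /H : ball_ Num.norm 0 d (y - x) by rewrite /ball_/= sub0r opprB distrC// distrC.
have yx0 : y - x != 0 by rewrite subr_eq0 gt_eqF.
move=> /(_ yx0); rewrite /= /GRing.scale /= mulr1 subrK ltr_norml => /andP[h _].
have {}h : (y - x)^-1 * (F y - F x) <= D + e by lra.
by move: h; rewrite mulrC ler_pdivrMr ?subr_gt0.
Qed.

(** With [g] a majorant of [psi] as above, let [s] be the supremum of the [x] for which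
    [F x - F a - 2 eps (x - a)] is at most the integral of [g] over [[a, x]]. Near [s] one has
    [g >= m] with [D s <= psi s <= m + eps], and the increments of [F] to the right of [s] have
    slope at most [D s + eps]; the inequality therefore continues past [s] unless [s = b]. The two
    losses of [eps] account for the factor 2. *)
Lemma increment_le_integral (F D psi : R -> R) (a b : R) : a <= b ->
  (forall x, a <= x <= b -> is_derive x 1 F (D x)) ->
  leb.-integrable `[a, b] (EFin \o psi) ->
  (forall x, a <= x <= b -> 0 <= psi x) ->
  (forall x, a <= x <= b -> D x <= psi x) ->
  F b - F a <= \int[leb]_(x in `[a, b]) psi x.
Proof.
move=> ab dF ipsi psi0 Dpsi; apply/ler_addgt0Pr => e0 e0_gt0.
(* The total error is [eps] from the majorant plus [2 eps (b - a)] from the slopes. *)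
pose eps := e0 / (1 + 2 * (b - a)).
have den0 : 0 < 1 + 2 * (b - a) by lra.
have eps0 : 0 < eps by rewrite divr_gt0.
have [|g [mg g0 gI gloc]] := lower_majorant eps0 ipsi.
  by move=> x /=; rewrite in_itv/=; exact: psi0.
pose G x := (\int[leb]_(y in `[a, x]) g y)%E.
pose Q x := ((F x - F a - 2 * eps * (x - a))%:E <= G x)%E.
have Gmono x y : x <= y -> (G x <= G y)%E.
  move=> xy; apply: ge0_subset_integral => //=.
  - exact: measurable_funTS.
  - by move=> z /=; rewrite !in_itv/= => /andP[-> /le_trans]; exact.
suff : Q b.
  rewrite /Q => /le_trans/(_ gI); rewrite /G -EFin_Rintegral_in// -EFinD lee_fin.
  have : eps * (1 + 2 * (b - a)) = e0 by rewrite /eps divfK// gt_eqF.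
  lra.
pose S := [set x | a <= x <= b /\ Q x].
have Sa : S a.
  split; first by rewrite lexx.
  by rewrite /Q !subrr mulr0 subr0; apply: integral_ge0.
have ubS : ubound S b by move=> x [/andP[]].
have hS : has_sup S by split; [exists a|exists b].
pose s := sup S.
have as_ : a <= s by apply: ub_le_sup => //; exists b.
have sb : s <= b by apply: ge_sup => //; exists a.
(* The inequality passes to the supremum because its left side is continuous and [G] is
   nondecreasing. *)
have Qs : Q s.
  rewrite /Q leNgt; apply/negP => Gs.
  have Gsfin : G s \is a fin_num.
    rewrite ge0_fin_numE; last by apply: integral_ge0.
    by apply: (lt_trans Gs); exact: ltry.
  move: Gs; rewrite -(fineK Gsfin) lte_fin => Gs.
  have Fs : {for s, continuous F}.
    apply: differentiable_continuous; apply/derivable1_diffP.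
    by have [] := dF s; first by rewrite as_ sb.
  have Hs : {for s, continuous (fun x => F x - F a - 2 * eps * (x - a))}.
    apply: cvgB; last first.
      by apply: cvgM; [exact: cvg_cst|apply: cvgB => //; exact: cvg_cst].
    by apply: cvgB => //; exact: cvg_cst.
  have [d /= d0 Hd] := cvgr_gt _ Hs _ Gs.
  have [x Sx xs] := sup_adherent d0 hS.
  have xs' : x <= s by apply: ub_le_sup => //; exists b.
  have /Hd : ball_ Num.norm s d x by rewrite /ball_ /= ger0_norm; rewrite -/s in xs; lra.
  apply/negP; rewrite -leNgt -lee_fin fineK//.
  by case: Sx => _ /le_trans; apply; exact: Gmono.
have [<-//|sb'] := eqVneq s b.
have {sb'}sb' : s < b by rewrite lt_neqAle sb'.
have ass : `[a, b]%classic s by rewrite /= in_itv/= as_ sb.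
have [m [psim m0 gm]] := gloc s ass.
have ds := dF s (introT andP (conj as_ sb)).
have := derive_increment_le ds eps0.
move: gm => [d1 /= d10 H1] [d2 /= d20 H2].
pose y := s + Num.min (Num.min d1 d2) (b - s) / 2.
have mn0 : 0 < Num.min (Num.min d1 d2) (b - s) by rewrite !lt_min d10 d20 subr_gt0.
have [yd1 yd2 ybs] : [/\ Num.min (Num.min d1 d2) (b - s) <= d1,
   Num.min (Num.min d1 d2) (b - s) <= d2 & Num.min (Num.min d1 d2) (b - s) <= b - s].
  by rewrite !ge_min !lexx ?orbT.
have sy : s < y by rewrite /y; lra.
have yb : y <= b by rewrite /y; lra.
have Sy : S y.
  split; first by apply/andP; split => //; lra.
  rewrite /Q.
  have -> : G y = (G s + \int[leb]_(z in `]s, y]) g z)%E.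
    rewrite /G (@itv_bndbnd_setU _ _ (BLeft a) (BRight s) (BRight y)) ?bnd_simp//; last exact: ltW.
    rewrite ge0_integral_setU//=.
    - exact: measurable_funTS.
    - apply/disj_setPS => z [/=]; rewrite !in_itv/= => /andP[_ zs] /andP[sz _]; lra.
  have -> : (F y - F a - 2 * eps * (y - a)) =
     (F s - F a - 2 * eps * (s - a)) + (F y - F s - 2 * eps * (y - s)) by lra.
  rewrite EFinD; apply: leeD; first exact: Qs.
  apply: (@le_trans _ _ (\int[leb]_(z in `]s, y]) (cst m%:E z)))%E.
    rewrite integral_cst//= lebesgue_measure_itv/= lte_fin sy -EFinD -EFinM lee_fin.
    have /H2 /(_ (ltW sy)) : ball_ Num.norm s d2 y.
      by rewrite /ball_/= distrC ger0_norm; rewrite /y; lra.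
    have Ds := Dpsi s (introT andP (conj as_ sb)).
    move=> /le_trans; have : (D s + eps) * (y - s) <= (m + 2 * eps) * (y - s).
      by rewrite ler_pM2r; lra.
    move=> h1 /(_ _ h1); lra.
  apply: ge0_le_integral => //.
  - exact: measurable_funTS.
  - move=> z /=; rewrite in_itv/= => /andP[sz zy]; apply: H1.
    by rewrite /ball_/= distrC ger0_norm; rewrite /y in zy; lra.
have : y <= s by apply: ub_le_sup => //; exists b.
lra.
Qed.

(** The derivative may be unbounded on both sides. Truncating it below at [-n] and adding [n x] to
    the function gives a nonnegative majorant, to which the previous inequality applies; dominated
    convergence removes the truncation. The opposite inequality is the same statement for [-F]. *)
Lemma increment_integral (F D : R -> R) (a b : R) : a <= b ->
  (forall x, a <= x <= b -> is_derive x 1 F (D x)) ->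
  leb.-integrable `[a, b] (EFin \o D) ->
  F b - F a = \int[leb]_(x in `[a, b]) D x.
Proof.
suff Hle (G H : R -> R) : a <= b ->
    (forall x, a <= x <= b -> is_derive x 1 G (H x)) ->
    leb.-integrable `[a, b] (EFin \o H) ->
    G b - G a <= \int[leb]_(x in `[a, b]) H x.
  move=> ab dF iD; apply/le_anti/andP; split; first exact: Hle.
  have := Hle (fun x => - F x) (fun x => - D x) ab.
  have iN : leb.-integrable `[a, b] (EFin \o (fun x => - D x)).
    rewrite (_ : EFin \o _ = -%E \o (EFin \o D))//.
    by apply: integrableN.
  have -> : \int[leb]_(x in `[a, b]) (- D x) = - \int[leb]_(x in `[a, b]) D x.
    under eq_Rintegral do rewrite -mulN1r.
    by rewrite RintegralZl// mulN1r.
  move=> h; have {}h := h (fun x xab => is_deriveN (dF x xab)) iN; lra.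
move=> ab dG iH.
have mH : measurable_fun `[a, b] H.
  by apply/measurable_EFinP; exact: measurable_int iH.
have ic (k : R) : leb.-integrable `[a, b] (EFin \o cst k).
  apply: continuous_compact_integrable; first exact: segment_compact.
  by apply: continuous_subspaceT => x; exact: cst_continuous.
have le_n n : G b - G a <= \int[leb]_(x in `[a, b]) Num.max (H x) (- n%:R).
  have im : leb.-integrable `[a, b] (fun x => (Num.max (H x) (- n%:R))%:E).
    apply: (@le_integrable _ _ R leb _ _ _ (fun x => (`|H x| + n%:R)%:E)) => //.
    - by apply/measurable_EFinP/measurable_maxr.
    - move=> x _; rewrite lee_fin [leRHS]ger0_norm; last by rewrite addr_ge0.
      have := ler_norm (H x); have := ler_norm (- H x); rewrite normrN.
      have := ler0n R n.
      by rewrite ler_norml maxEle; case: ifP => _ *; apply/andP; split; lra.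
    - by apply: integrable_EFinD; [|exact: integrable_norm|exact: ic].
  have := @increment_le_integral (fun x => G x + n%:R * x) (fun x => H x + n%:R)
    (fun x => Num.max (H x) (- n%:R) + n%:R) a b ab.
  have -> : \int[leb]_(x in `[a, b]) (Num.max (H x) (- n%:R) + n%:R) =
     \int[leb]_(x in `[a, b]) Num.max (H x) (- n%:R) + n%:R * (b - a).
    rewrite RintegralD//; last exact: ic.
    congr (_ + _); rewrite Rintegral_cst//= lebesgue_measure_itv/= lte_fin.
    case: ltP => // ba; have -> : a = b by apply/le_anti; rewrite ab.
    by rewrite subrr.
  move=> h; have {}h : G b + n%:R * b - (G a + n%:R * a) <=
      \int[leb]_(x in `[a, b]) Num.max (H x) (- n%:R) + n%:R * (b - a).
    apply: h.
    - move=> x xab; have := dG x xab => ?; apply: is_derive_eq; by rewrite /GRing.scale/= mulr1.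
    - by apply: integrable_EFinD => //; exact: ic.
    - by move=> x _; rewrite maxEle; case: ifP; lra.
    - by move=> x _; rewrite maxEle; case: ifP; lra.
  lra.
have [||||||_ c] := @Rintegral_dominated_cvg _ _ _ leb `[a, b]
  (fun n x => Num.max (H x) (- n%:R)) H (fun x => `|H x|).
- by [].
- by move=> n; exact: measurable_maxr.
- exact: mH.
- apply: aeT => x _; apply: cvg_near_cst.
  exists (Num.truncn (`|H x|)).+1 => // n /= xn.
  apply/max_idPl; have /ltW h := truncnS_gt `|H x|.
  have : (Num.truncn `|H x|).+1%:R <= n%:R :> R by rewrite ler_nat.
  by have := ler_norm (- H x); rewrite normrN; lra.
- exact: integrable_norm.
- apply: aeT => x n _; have := ler0n R n.
  have := ler_norm (H x); have := ler_norm (- H x); rewrite normrN ler_norml.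
  by rewrite maxEle; case: ifPn; rewrite -?ltNge => *; apply/andP; split; lra.
by apply: (cvgr_to_ge c); apply: nearW => n; exact: le_n.
Qed.

End DerivativeIntegral.

(** * Causal convolution *)

Section Support.
Context {R : realType} {d : measure_display} {T : measurableType d}.
Variable mu : {measure set T -> \bar R}.

Lemma patch_supp (D : set T) (f : T -> \bar R) :
  (forall x, ~ D x -> f x = 0%E) -> f \_ D = f.
Proof.
move=> fD; apply/funext => x; rewrite patchE; case: ifPn => //.
by rewrite notin_setE => /fD.
Qed.

Lemma integral_supp (D : set T) (f : T -> \bar R) :
  (forall x, ~ D x -> f x = 0%E) ->
  (\int[mu]_(x in D) f x = \int[mu]_x f x)%E.
Proof. by move=> fD; rewrite integral_mkcond patch_supp. Qed.

Lemma Rintegral_supp (D : set T) (f : T -> R) : (forall x, ~ D x -> f x = 0) ->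
  \int[mu]_(x in D) f x = \int[mu]_x f x.
Proof. by move=> fD; rewrite /Rintegral integral_supp// => x /fD ->. Qed.

Lemma integrable_supp (D : set T) (f : T -> R) : measurable D ->
  (forall x, ~ D x -> f x = 0) ->
  mu.-integrable D (EFin \o f) <-> L1 mu f.
Proof.
move=> mD fD; rewrite integrable_mkcond// patch_supp// => x nDx /=.
by rewrite fD.
Qed.

(** Sections produced by Fubini are only known to be integrable together with their factor [k]. If
    [k] is nonzero one divides by it; otherwise both sides vanish. *)
Lemma RintegralZ_L1 (k : R) (f : T -> R) : L1 mu (fun x => k * f x) ->
  \int[mu]_x (k * f x) = k * \int[mu]_x f x.
Proof.
have [->|k0] := eqVneq k 0.
  by rewrite mul0r; under eq_Rintegral do rewrite mul0r; rewrite Rintegral_cst// mul0r.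
move=> /(L1Zl k^-1); under eq_fun do rewrite mulKf//.
exact: RintegralTZ.
Qed.

End Support.

Section Convolution.
Context {R : realType}.
Local Notation leb := (@lebesgue_measure R).
Implicit Types (a b c g : R -> R) (s t u v : R).

(** The integral runs over the whole line: for causal functions the integrand vanishes outside
    [[0, t]], and changes of variables or of the order of integration then involve no moving
    bounds. *)
Definition conv a b t := \int[leb]_s (a (t - s) * b s).

Definition causal g := measurable_fun setT g /\ forall t, t < 0 -> g t = 0.

Lemma measurable_conv_integrand a b t : measurable_fun setT a ->
  measurable_fun setT b -> measurable_fun setT (fun s => a (t - s) * b s).
Proof.
move=> ma mb; apply: measurable_funM => //.
exact: (measurableT_comp ma (measurable_reflect t)).
Qed.

Lemma measurable_conv_kernel a b : measurable_fun setT a -> measurable_fun setT b ->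
  measurable_fun setT
    (fun z : measurableTypeR R * measurableTypeR R => a (z.1 - z.2) * b z.2).
Proof.
move=> ma mb; apply: measurable_funM; last exact: (measurableT_comp mb).
by apply: (measurableT_comp ma); exact: measurable_funB.
Qed.

Lemma measurable_conv a b : measurable_fun setT a -> measurable_fun setT b ->
  measurable_fun setT (conv a b).
Proof.
move=> ma mb; exact: (measurable_Rintegral2 leb (F := fun s u => a (s - u) * b u)
  (measurable_conv_kernel ma mb)).
Qed.

Lemma conv_supp a b t s : causal a -> causal b -> ~ `[0, t]%classic s ->
  a (t - s) * b s = 0.
Proof.
move=> [_ a0] [_ b0]; rewrite /= in_itv/= => /negP; rewrite negb_and -!ltNge.
move=> /orP[s0|ts]; first by rewrite b0// mulr0.
by rewrite a0 ?mul0r// subr_lt0.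
Qed.

Lemma conv_lt0 a b t : causal a -> causal b -> t < 0 -> conv a b t = 0.
Proof.
move=> ca cb t0; rewrite /conv -(Rintegral_supp leb (D := `[0, t]%classic)); last first.
  by move=> s; exact: conv_supp.
by rewrite set_itv_ge ?Rintegral_set0// bnd_simp -ltNge.
Qed.

Lemma causal_conv a b : causal a -> causal b -> causal (conv a b).
Proof.
move=> ca cb; split; first by apply: measurable_conv; [case: ca|case: cb].
by move=> t; exact: conv_lt0.
Qed.

Lemma convC a b t : measurable_fun setT a -> measurable_fun setT b ->
  conv a b t = conv b a t.
Proof.
move=> ma mb; rewrite /conv -(Rintegral_reflect t); last first.
  exact: measurable_conv_integrand.
by apply: eq_Rintegral => s _; rewrite subKr mulrC.
Qed.

Lemma L1_convC a b t : L1 leb (fun s => a (t - s) * b s) ->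
  L1 leb (fun s => b (t - s) * a s).
Proof.
move=> /(L1_reflect t); congr (integrable _ _ _).
by apply/funext => s; rewrite subKr mulrC.
Qed.

(** Extended-valued, so that its finiteness expresses the absolute convergence of [conv a b t]. *)
Definition conv_abs a b t := (\int[leb]_s `|a (t - s) * b s|%:E)%E.

Lemma measurable_conv_triple a b c t : measurable_fun setT a ->
  measurable_fun setT b -> measurable_fun setT c ->
  measurable_fun setT (fun z : measurableTypeR R * measurableTypeR R =>
    c (t - z.1) * (a (z.1 - z.2) * b z.2)).
Proof.
move=> ma mb mc; apply: measurable_funM; last exact: measurable_conv_kernel.
by apply: (measurableT_comp mc); exact: measurable_funB.
Qed.

Section Associativity.
Variables (a b c : R -> R) (t C : R).
Hypotheses (ca : causal a) (cb : causal b) (cc : causal c).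
Hypothesis bnd : forall v, v <= t -> (conv_abs c a v <= C%:E)%E.
Hypothesis ib : leb.-integrable `[0, t] (EFin \o b).

Let F s u := c (t - s) * (a (s - u) * b u).

Let mF : measurable_fun setT
  (fun z : measurableTypeR R * measurableTypeR R => F z.1 z.2).
Proof. by apply: measurable_conv_triple; [case: ca|case: cb|case: cc]. Qed.

Let C0 : 0 <= C \/ t < 0.
Proof.
have [t0|] := ltP t 0; [by right|left].
rewrite -lee_fin; apply: le_trans (bnd (lexx t)).
by apply: integral_ge0 => s _; rewrite lee_fin.
Qed.

Let inner u : (\int[leb]_s `|F s u|%:E = conv_abs c a (t - u) * `|b u|%:E)%E.
Proof.
have [ma _] := ca; have [mc _] := cc.
rewrite /conv_abs -(ge0_integral_shift u (f := fun s => `|c (t - u - s) * a s|%:E)) //; last first.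
  apply/measurable_EFinP; apply: measurableT_comp => //.
  exact: measurable_conv_integrand.
rewrite -ge0_integralZr//; last first.
- apply/measurable_EFinP; apply: measurableT_comp => //.
  apply: measurable_funM; last first.
    by apply: (measurableT_comp ma); exact: measurable_funB.
  by apply: (measurableT_comp mc); apply: measurable_funB => //; exact: measurable_funB.
- by apply: eq_integral => s _; rewrite -EFinM -normrM /F mulrA;
    congr (`|c _ * _ * _|%:E); lra.
Qed.

(** Integrating in [s] first leaves [conv_abs c a (t - u) |b u|], which is at most [C |b u|] for [u]
    in [[0, t]] and vanishes elsewhere. *)
Let iF : L1 (leb \x leb)%E (fun z : measurableTypeR R * measurableTypeR R => F z.1 z.2).
Proof.
apply: (L1_prod21 mF).
apply: (@le_lt_trans _ _ (\int[leb]_(u in `[0%R, t]) (C%:E * `|b u|%:E)))%E.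
  under eq_integral do rewrite inner.
  rewrite -(integral_supp leb (D := `[0, t]%classic)); last first.
    move=> u; rewrite /= in_itv/= => /negP; rewrite negb_and -!ltNge => /orP[u0|tu].
      by case: cb => _ ->//; rewrite normr0 mule0.
    rewrite /conv_abs integral0_eq ?mul0e// => s _.
    rewrite conv_supp ?normr0//= in_itv/= => /andP[s0 /(le_trans s0)].
    by rewrite leNgt subr_lt0 tu.
  have mb : measurable_fun `[0, t] (fun u => `|b u|%:E).
    by apply/measurable_EFinP/measurableT_comp => //; apply: measurable_funTS; case: cb.
  apply: ge0_le_integral => //.
  - by move=> u _; apply: mule_ge0 => //; apply: integral_ge0 => s _; rewrite lee_fin.
  - apply: emeasurable_funM => //; apply: measurable_funTS.
    apply: (measurableT_comp (f := conv_abs c a)); last exact: measurable_reflect.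
    apply: (@measurable_fun_fubini_tonelli_F _ _ _ _ _ leb
      (fun z : measurableTypeR R * measurableTypeR R => `|c (z.1 - z.2) * a z.2|%:E)).
      apply/measurable_EFinP; apply: measurableT_comp => //.
      by apply: measurable_conv_kernel; [case: cc|case: ca].
    by move=> z; rewrite lee_fin.
  - exact: emeasurable_funM.
  - move=> u; rewrite /= in_itv/= => /andP[u0 ut]; apply: lee_wpmul2r => //.
    by apply: bnd; lra.
have [C_ge0|t0] := C0; last first.
  by rewrite set_itv_ge ?integral_set0// bnd_simp -ltNge.
case/integrableP : ib => _ ib'.
rewrite ge0_integralZl//.
- by rewrite lte_mul_pinfty// ?lee_fin.
- by apply/measurable_EFinP/measurableT_comp => //; apply: measurable_funTS; case: cb.
Qed.

Lemma L1_conv_assocl : L1 leb (fun s => c (t - s) * conv a b s).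
Proof.
have mc := measurable_conv (proj1 ca) (proj1 cb).
apply: L1_ae (L1_Rintegral2 mF iF) _ _.
  exact: measurable_conv_integrand (proj1 cc) mc.
by apply: aeS (ae_L1_section1 iF) => s /RintegralZ_L1.
Qed.

Let shift_eq :
  {ae leb, forall u, \int[leb]_s F s u = conv c a (t - u) * b u}.
Proof.
have [ma _] := ca; have [mc _] := cc.
apply: aeS (ae_L1_section2 mF iF) => u iu.
have mca := measurable_conv_integrand (t - u) mc ma.
have FE s : F s u = b u * (c (t - u - (s - u)) * a (s - u)).
  by rewrite /F mulrA mulrC; congr (_ * (c _ * _)); lra.
under eq_Rintegral do rewrite FE.
rewrite RintegralZ_L1; last first.
  by apply: eq_integrable iu => // s _ /=; rewrite FE.
by rewrite mulrC /conv -(Rintegral_shift u mca).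
Qed.

Lemma L1_conv_assocr : L1 leb (fun u => conv c a (t - u) * b u).
Proof.
have mca := measurable_conv (proj1 cc) (proj1 ca).
apply: L1_ae (L1_Rintegral1 mF iF) _ shift_eq.
exact: measurable_conv_integrand mca (proj1 cb).
Qed.

Lemma conv_assoc : conv c (conv a b) t = conv (conv c a) b t.
Proof.
have mca := measurable_conv (proj1 cc) (proj1 ca).
transitivity (\int[leb]_s \int[leb]_u F s u).
  apply/esym/ae_eq_Rintegral.
  - exact: L1_measurable (L1_Rintegral2 mF iF).
  - exact: L1_measurable L1_conv_assocl.
  - by apply: aeS (ae_L1_section1 iF) => s /RintegralZ_L1.
rewrite (RFubini mF iF); apply: ae_eq_Rintegral.
- exact: L1_measurable (L1_Rintegral1 mF iF).
- exact: L1_measurable L1_conv_assocr.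
- exact: shift_eq.
Qed.

End Associativity.

End Convolution.

(** * Extension by zero and sufficient conditions for convolving *)

Section HalfLineExtension.
Context {R : realType}.
Local Notation leb := (@lebesgue_measure R).
Implicit Types (a b g h : R -> R) (s t T : R).

Definition ext g t : R := if 0 <= t then g t else 0.

Lemma extE g t : 0 <= t -> ext g t = g t.
Proof. by rewrite /ext => ->. Qed.

Lemma ext_lt0 g t : t < 0 -> ext g t = 0.
Proof. by rewrite /ext leNgt => ->. Qed.

Lemma ext_patch g : ext g = g \_ `[0, +oo[.
Proof.
apply/funext => t; rewrite /ext patchE; case: ifPn => t0.
  by rewrite mem_set//= in_itv/= t0.
by rewrite memNset//= in_itv/= andbT; exact/negP.
Qed.

Lemma halfline_bigcup : (`[0, +oo[%classic : set R) = \bigcup_n `[0, n.+1%:R]%classic.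
Proof.
apply/seteqP; split => [t|t [n _]] /=; rewrite !in_itv/= ?andbT.
  by move=> t0; exists (Num.truncn t) => //=; rewrite in_itv/= t0 ltW// truncnS_gt.
by move=> /andP[].
Qed.

Lemma measurable_fun_halfline g : (forall T, 0 < T -> measurable_fun `[0, T] g) ->
  measurable_fun (`[0, +oo[%classic : set R) g.
Proof.
move=> mg; rewrite halfline_bigcup; apply/measurable_fun_bigcup => n.
  exact: measurable_itv.
by apply: mg; rewrite ltr0n.
Qed.

Lemma causal_ext g : (forall T, 0 < T -> measurable_fun `[0, T] g) -> causal (ext g).
Proof.
move=> mg; split; last by move=> t; exact: ext_lt0.
rewrite ext_patch; apply/(measurable_restrictT _ _).1 => //.
exact: measurable_fun_halfline.
Qed.

Lemma integrable_ext T g : leb.-integrable `[0, T] (EFin \o g) <->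
  leb.-integrable `[0, T] (EFin \o ext g).
Proof.
by split; apply: eq_integrable => // t; rewrite inE/= in_itv/= => /andP[t0 _];
  rewrite /= extE.
Qed.

Lemma L1loc_ext g : L1loc g -> L1loc (ext g).
Proof. by move=> ig T T0; apply: (integrable_ext T g).1; exact: ig. Qed.

Lemma L1loc_measurable g T : L1loc g -> 0 < T -> measurable_fun `[0, T] g.
Proof. by move=> /[apply] ig; apply/measurable_EFinP; exact: measurable_int ig. Qed.

Lemma L1loc_causal g : L1loc g -> causal (ext g).
Proof. by move=> ig; apply: causal_ext => T; exact: L1loc_measurable. Qed.

Lemma L1loc_itv g T : L1loc g -> leb.-integrable `[0, T] (EFin \o g).
Proof.
move=> ig; have m0 : 0 < Num.max T 1 by rewrite lt_max ltr01 orbT.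
apply: integrableS (ig _ m0) => // t /=; rewrite !in_itv/= => /andP[-> tT].
by rewrite le_max tT.
Qed.

Lemma convolE g h t : convol g h t = conv (ext g) (ext h) t.
Proof.
rewrite /conv -(Rintegral_supp leb (D := `[0, t]%classic)).
  apply: eq_Rintegral => s; rewrite inE/= in_itv/= => /andP[s0 st].
  by rewrite !extE// subr_ge0.
move=> s; rewrite /= in_itv/= => /negP; rewrite negb_and -!ltNge.
move=> /orP[s0|ts]; first by rewrite (ext_lt0 _ s0) mulr0.
by rewrite ext_lt0 ?mul0r// subr_lt0.
Qed.

Lemma convol_integrableE g h t :
  convol_integrable g h t <-> L1 leb (fun s => ext g (t - s) * ext h s).
Proof.
rewrite -(integrable_supp leb (D := `[0, t]%classic))//; last first.
  move=> s; rewrite /= in_itv/= => /negP; rewrite negb_and -!ltNge.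
  move=> /orP[s0|ts]; first by rewrite (ext_lt0 _ s0) mulr0.
  by rewrite ext_lt0 ?mul0r// subr_lt0.
by split; apply: eq_integrable => // s; rewrite inE/= in_itv/= => /andP[s0 st];
  rewrite /= !extE// subr_ge0.
Qed.

(** The bound is on all of []-oo, T]]; for a causal function this amounts to a bound on [[0, T]]. *)
Definition locally_bounded g := forall T, exists C, forall t, t <= T -> `|g t| <= C.

Lemma L1_patch g T : leb.-integrable `[0, T] (EFin \o g) -> L1 leb (g \_ `[0, T]).
Proof.
by move=> ig; move: ig; rewrite integrable_mkcond// restrict_EFin.
Qed.

Lemma L1_conv_bounded a b t : causal a -> causal b -> L1loc a ->
  locally_bounded b -> L1 leb (fun s => a (t - s) * b s).
Proof.
move=> ca cb ia bb; have [C bC] := bb t.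
have ia' := L1Zl C (L1_reflect t (L1_patch (L1loc_itv t ia))).
apply: (L1_le _ ia'); first by apply: measurable_conv_integrand; [case: ca|case: cb].
move=> s; have [st|/(conv_supp ca cb) ->] := pselect (`[0, t]%classic s); last first.
  by rewrite normr0.
move: st; rewrite /= in_itv/= => /andP[s0 st].
rewrite patchE mem_set; last by rewrite /= in_itv/=; apply/andP; split; lra.
by rewrite !normrM mulrC ler_wpM2r// (le_trans (bC s st))// ler_norm.
Qed.

(** The condition under which associativity was proved, for all times at once. It is symmetric, and
    holds for two locally square-integrable functions or for a locally bounded one and a locally
    integrable one. *)
Definition convolution_bounded a b :=
  forall T, exists C, forall v, v <= T -> (conv_abs a b v <= C%:E)%E.

Lemma convolution_boundedC a b : causal a -> causal b ->
  convolution_bounded a b -> convolution_bounded b a.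
Proof.
move=> [ma _] [mb _] ab T; have [C HC] := ab T; exists C => v /HC.
apply: le_trans; rewrite /conv_abs.
rewrite -(ge0_integral_reflect v (f := fun s => `|a (v - s) * b s|%:E))//.
  by under [leRHS]eq_integral do rewrite subKr mulrC.
apply/measurable_EFinP; apply: measurableT_comp => //.
exact: measurable_conv_integrand.
Qed.

Lemma convolution_bounded_sqr a b : causal a -> causal b ->
  L1loc (fun t => a t ^+ 2) -> L1loc (fun t => b t ^+ 2) -> convolution_bounded a b.
Proof.
move=> ca cb ia ib T.
have iaT := L1_patch (L1loc_itv T ia); have ibT := L1_patch (L1loc_itv T ib).
set aT := patch _ _ _ in iaT; set bT := patch _ _ _ in ibT.
exists (\int[leb]_s aT s + \int[leb]_s bT s) => v vT.
rewrite -(Rintegral_reflect v (L1_measurable iaT)).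
have iaT' := L1_reflect v iaT.
rewrite -RintegralTD// EFin_Rintegral; last exact: L1D.
apply: ge0_le_integral => //.
- apply/measurable_EFinP; apply: measurableT_comp => //.
  by apply: measurable_conv_integrand; [case: ca|case: cb].
- by apply/measurable_EFinP; exact: (L1_measurable (L1D iaT' ibT)).
- move=> s _; rewrite lee_fin.
  have [st|/(conv_supp ca cb) ->] := pselect (`[0, v]%classic s); last first.
    by rewrite normr0 /aT /bT !patchE; apply: addr_ge0; case: ifP => // _; exact: sqr_ge0.
  move: st; rewrite /= in_itv/= => /andP[s0 sv].
  rewrite /aT /bT !patchE !mem_set/=; [|rewrite in_itv/=; apply/andP; split; lra..].
  have := sqr_ge0 (`|a (v - s)| - `|b s|).
  have := sqr_ge0 (a (v - s)); have := sqr_ge0 (b s).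
  by rewrite sqrrB !real_normK ?num_real// normrM; lra.
Qed.

Lemma convolution_bounded_bounded a b : causal a -> causal b ->
  locally_bounded a -> L1loc b -> convolution_bounded a b.
Proof.
move=> ca cb ba ib T; have [C aC] := ba T.
have ibT := L1Zl C (L1_norm (L1_patch (L1loc_itv T ib))).
set bT := patch _ _ _ in ibT.
exists (\int[leb]_s (C * `|bT s|)) => v vT.
rewrite EFin_Rintegral//; apply: ge0_le_integral => //.
- apply/measurable_EFinP; apply: measurableT_comp => //.
  by apply: measurable_conv_integrand; [case: ca|case: cb].
- by apply/measurable_EFinP; exact: L1_measurable ibT.
- move=> s _; rewrite lee_fin.
  have [st|/(conv_supp ca cb) ->] := pselect (`[0, v]%classic s); last first.
    by rewrite normr0 mulr_ge0// (le_trans _ (aC _ (lexx _))).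
  move: st; rewrite /= in_itv/= => /andP[s0 sv].
  rewrite /bT !patchE !mem_set/=; last by rewrite in_itv/=; apply/andP; split; lra.
  by rewrite normrM ler_wpM2r// aC//; lra.
Qed.

Lemma L1loc_bounded g : causal g -> locally_bounded g -> L1loc g.
Proof.
move=> cg bg T T0; have [C gC] := bg T.
apply: measurable_bounded_integrable => //.
- by rewrite /= lebesgue_measure_itv/= lte_fin T0 -EFinD ltry.
- by apply: measurable_funTS; case: cg.
- exists C; split; first exact: num_real.
  move=> x Cx t /=; rewrite in_itv/= => /andP[_ /gC tC].
  exact: (le_trans tC (ltW Cx)).
Qed.

End HalfLineExtension.

(** * Consequences of the identity [f = lambda K - lambda f * K] *)

Section ResolventAlgebra.
Context {R : realType}.
Local Notation leb := (@lebesgue_measure R).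
Variables (K f : R -> R) (lambda : R).
Hypotheses (cK : causal K) (cf : causal f) (iK : L1loc K).
Hypothesis fK : convolution_bounded f K.
Hypothesis resolvent_ae :
  {ae leb, forall t, f t = lambda * K t - lambda * conv f K t}.
Implicit Types (g h phi : R -> R) (t : R).

(** The a.e. identity is convolved with [g]; associativity gives the first formula and commutativity
    the second. Convergence is assumed for [K * g] only: that of [(f * K) * g] follows from the
    Fubini bound, and that of [f * g] is then read off the identity. This suits [g = mu], for which
    nothing but the drift integrals is known to converge. *)
Lemma resolvent_conv g t : causal g -> L1loc g ->
  L1 leb (fun s => K (t - s) * g s) ->
  [/\ L1 leb (fun s => f (t - s) * g s),
      L1 leb (fun s => f (t - s) * conv K g s),
      L1 leb (fun s => K (t - s) * conv f g s),
      conv f g t = lambda * conv K g t - lambda * conv f (conv K g) t &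
      conv f g t = lambda * conv K g t - lambda * conv K (conv f g) t].
Proof.
move=> cg ig iKg; have [C fKC] := fK t.
have [C' KfC] := convolution_boundedC cf cK fK t.
have igt := L1loc_itv t ig.
have i1 := L1_conv_assocl cK cg cf fKC igt.
have i2 := L1_conv_assocr cK cg cf fKC igt.
have i3 := L1_conv_assocl cf cg cK KfC igt.
have e1 := conv_assoc cK cg cf fKC igt.
have e2 := conv_assoc cf cg cK KfC igt.
have mfK := measurable_conv (proj1 cf) (proj1 cK).
have ae' : {ae leb, forall s, lambda * (K (t - s) * g s) -
    lambda * (conv f K (t - s) * g s) = f (t - s) * g s}.
  apply: aeS (ae_reflect t resolvent_ae) => s ->.
  by rewrite mulrBl !mulrA.
have mfg := measurable_conv_integrand t (proj1 cf) (proj1 cg).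
have il := L1B (L1Zl lambda iKg) (L1Zl lambda i2).
have ifg := L1_ae il mfg ae'.
have E : conv f g t = lambda * conv K g t - lambda * conv (conv f K) g t.
  rewrite {1}/conv -(ae_eq_Rintegral (L1_measurable il) mfg ae').
  by rewrite RintegralTB ?RintegralTZ//; exact: L1Zl.
split => //; first by rewrite e1.
rewrite e2 E; congr (_ - _ * _).
apply: eq_Rintegral => s _; congr (_ * _).
by rewrite convC//; [case: cf|case: cK].
Qed.

(** In the convolution algebra [delta - f] and [delta + lambda K] are inverse to each other, [delta]
    being the unit mass at 0. Each direction uses one of the two formulas of [resolvent_conv]. *)
Lemma resolvent_inverse phi h : causal phi -> causal h ->
  locally_bounded phi -> locally_bounded h ->
  (forall t, phi t - conv f phi t = h t) <->
  (forall t, phi t = h t + lambda * conv K h t).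
Proof.
move=> cp ch bp bh; split => H t.
- have [i1 i2 i3 e1 e2] := resolvent_conv cp (L1loc_bounded cp bp) (L1_conv_bounded t cK cp iK bp).
  have -> : conv K h t =
      \int[leb]_s (K (t - s) * phi s - K (t - s) * conv f phi s).
    by apply: eq_Rintegral => s _; rewrite -mulrBr -H.
  rewrite (RintegralTB (L1_conv_bounded t cK cp iK bp) i3).
  rewrite -/(conv K phi t) -/(conv K (conv f phi) t).
  rewrite -H e2; move: (conv K (conv f phi) t) (conv K phi t) => x y; ring.
- have [i1 i2 i3 e1 e2] := resolvent_conv ch (L1loc_bounded ch bh) (L1_conv_bounded t cK ch iK bh).
  have -> : conv f phi t =
      \int[leb]_s (f (t - s) * h s + lambda * (f (t - s) * conv K h s)).
    by apply: eq_Rintegral => s _; rewrite H mulrDr mulrCA.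
  rewrite (RintegralTD i1 (L1Zl lambda i2)) (RintegralTZ lambda i2).
  rewrite -/(conv f h t) -/(conv f (conv K h) t).
  rewrite H e1; move: (conv f (conv K h) t) (conv K h t) => x y; ring.
Qed.

End ResolventAlgebra.

(** * The resolvent *)

Section LebesguePoints.
Context {R : realType}.
Local Notation leb := (@lebesgue_measure R).
Implicit Types (g : R -> R) (t T : R).

Lemma causal_integrable_Ny g T : causal g -> L1loc g ->
  leb.-integrable `]-oo, T] (EFin \o g).
Proof.
move=> [mg g0] ig.
have := L1_patch (L1loc_itv T ig).
have -> : g \_ `[0, T] = g \_ `]-oo, T].
  apply/funext => s; rewrite !patchE.
  have [s0|s0] := ltP s 0; first by rewrite g0//; case: ifP; case: ifP.
  congr (if _ then _ else _); apply/idP/idP; rewrite !inE/= !in_itv/= ?s0//.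
move=> h; rewrite integrable_mkcond// restrict_EFin; exact: h.
Qed.

Lemma ae_derivable_integral g : causal g -> L1loc g ->
  let G := fun t => \int[leb]_(s in `[0, t]) g s in
  {ae leb, forall t, 0 < t -> derivable G t 1 /\ derive1 G t = g t}.
Proof.
move=> cg ig G.
have ily : forall y : R, leb.-integrable [set` Interval (BLeft 0) (BRight y)] (EFin \o g).
  by move=> y; exact: L1loc_itv.
have loc : locally_integrable setT g.
  split; [by case: cg|exact: openT|].
  move=> A _ cA; have /(@compact_bounded _ R^o) [M [_ AM]] := cA.
  have iM := causal_integrable_Ny (M + 1) cg ig.
  have mA : measurable A by exact: compact_measurable.
  have AS : A `<=` `]-oo, M + 1].
    move=> x Ax; rewrite /= in_itv/=; apply: le_trans (ler_norm _) _.
    by apply: AM => //; rewrite ltrDl.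
  have : leb.-integrable A (EFin \o g) by apply: integrableS iM.
  by move=> /integrableP[].
have := FTC1 ily loc.
by apply: aeS => t Ht t0; apply: Ht; rewrite lte_fin.
Qed.

Lemma ae_not_in_set1 (t0 : R) : {ae leb, forall t, t != t0}.
Proof.
exists [set t0]; split; first exact: measurable_set1.
  exact: lebesgue_measure_set1.
by move=> t /= /negP; rewrite negbK => /eqP.
Qed.

Lemma integrals_eq0_ae g : causal g -> L1loc g ->
  (forall t, 0 < t -> \int[leb]_(s in `[0, t]) g s = 0) ->
  {ae leb, forall t, g t = 0}.
Proof.
move=> cg ig g0; apply: aeS2 (ae_derivable_integral cg ig) (ae_not_in_set1 0).
move=> t Ht tn0; have [t0|t0] := ltP t 0; first by case: cg => _; apply.
have {t0 tn0}t0 : 0 < t by rewrite lt_neqAle eq_sym tn0.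
have [_ <-] := Ht t0; rewrite derive1E.
set G := (X in 'D_1 X t).
have : \forall s \near t, G s = cst 0 s.
  near=> s; apply: g0; near: s; exact: lt_nbhsr.
by move=> /near_eq_derive ->; rewrite derive_cst.
Unshelve. all: by end_near. Qed.

End LebesguePoints.

Section SquareIntegrable.
Context {R : realType}.
Local Notation leb := (@lebesgue_measure R).
Implicit Types (g : R -> R) (t T : R).

Lemma square_integrable_L1 T g : square_integrable `[0, T] g ->
  leb.-integrable `[0, T] (EFin \o g).
Proof.
move=> [mg ig]; apply: (@le_integrable _ _ R leb _ _ _ (fun s => (1 + g s ^+ 2)%:E)) => //.
- exact/measurable_EFinP.
- move=> s _; rewrite lee_fin [leRHS]ger0_norm; last by rewrite addr_ge0// sqr_ge0.
  have := sqr_ge0 (`|g s| - 1); rewrite sqrrB real_normK ?num_real// expr1n mulr1.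
  have := sqr_ge0 (g s); have := normr_ge0 (g s); lra.
- apply: integrable_EFinD => //.
  apply: continuous_compact_integrable; first exact: segment_compact.
  by apply: continuous_subspaceT => x; exact: cst_continuous.
Qed.

Lemma L2loc_L1loc g : L2loc g -> L1loc g.
Proof. by move=> ig T T0; apply: square_integrable_L1; exact: ig. Qed.

Lemma square_integrable_L2loc g : square_integrable `[0, +oo[ g -> L2loc g.
Proof.
move=> [mg ig] T T0.
have TS : `[0, T]%classic `<=` (`[0, +oo[%classic : set R).
  by move=> s /=; rewrite !in_itv/= andbT => /andP[].
split; first exact: measurable_funS mg.
exact: integrableS ig.
Qed.

Lemma L2loc_ext g : L2loc g -> L1loc (fun t => ext g t ^+ 2).
Proof.
move=> ig T T0; have [_] := ig T T0.
by apply: eq_integrable => // s; rewrite inE/= in_itv/= => /andP[s0 _]; rewrite /= extE.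
Qed.

End SquareIntegrable.

Section ConvolutionBound.
Context {R : realType}.
Local Notation leb := (@lebesgue_measure R).

Lemma conv_le (a b : R -> R) (t M : R) : causal a -> causal b -> L1loc a -> 0 <= M ->
  (forall s, 0 <= s <= t -> `|b s| <= M) ->
  `|conv a b t| <= M * \int[leb]_(s in `[0, t]) `|a s|.
Proof.
move=> ca cb ia M0 bM.
pose A s := `|(a \_ `[0, t]) s|.
have iA : L1 leb A := L1_norm (L1_patch (L1loc_itv t ia)).
have iA' := L1Zl M (L1_reflect t iA).
have mab := measurable_conv_integrand t (proj1 ca) (proj1 cb).
have le s : `|a (t - s) * b s| <= M * A (t - s).
  have [st|/(conv_supp ca cb) ->] := pselect (`[0, t]%classic s); last first.
    by rewrite normr0 mulr_ge0// /A.
  move: (st); rewrite /= in_itv/= => /andP[s0 s_t].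
  rewrite /A patchE mem_set; last by rewrite /= in_itv/=; apply/andP; split; lra.
  by rewrite normrM mulrC ler_wpM2r// bM// s0.
have iab : L1 leb (fun s => a (t - s) * b s).
  apply: (L1_le _ iA'); first exact: mab.
  move=> s.
  by rewrite (le_trans (le s))// ler_norm.
apply: (le_trans (le_normr_Rintegral measurableT iab)).
apply: (@le_trans _ _ (\int[leb]_s (M * A (t - s)))).
  apply: le_Rintegral => //; first exact: L1_norm.
rewrite (RintegralTZ M (L1_reflect t iA)) (Rintegral_reflect t (L1_measurable iA)).
rewrite [in leRHS]Rintegral_mkcond le_eqVlt; apply/orP; left; apply/eqP; congr (_ * _).
apply: eq_Rintegral => s _; rewrite /A !patchE; case: ifP => //.
by rewrite normr0.
Qed.

End ConvolutionBound.

(** * The resolvent identity derived from the equation for [Rl] *)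

Section ResolventFacts.
Context {R : realType}.
Local Notation leb := (@lebesgue_measure R).
Variables (K : R -> R) (lambda : R) (Rl f : R -> R).
Hypotheses (hK : L2loc K) (lambda0 : 0 < lambda).
Hypothesis hR : resolvent_assumption K lambda Rl f.

Let f2 : L2loc f := square_integrable_L2loc (resolvent_f_L2 hR).
Let if_ : L1loc f := L2loc_L1loc f2.
Let iK : L1loc K := L2loc_L1loc hK.

Lemma resolvent_increment s t : 0 < s -> s <= t ->
  Rl t - Rl s = - \int[leb]_(u in `[s, t]) f u.
Proof.
move=> s0 st.
have ift : leb.-integrable `[s, t] (EFin \o f).
  by apply: integrableS (L1loc_itv t if_) => // u /=; rewrite !in_itv/= => /andP[su ->];
    rewrite (le_trans (ltW s0)).
have iNf : leb.-integrable `[s, t] (EFin \o (fun u => - f u)).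
  by rewrite (_ : EFin \o _ = -%E \o (EFin \o f))//; apply: integrableN.
have dR u : s <= u <= t -> is_derive u 1 Rl (- f u).
  by move=> /andP[su _]; apply: (resolvent_derive hR); exact: lt_le_trans su.
rewrite (increment_integral st dR iNf).
under eq_Rintegral do rewrite -mulN1r.
by rewrite RintegralZl ?mulN1r.
Qed.

Let F t := \int[leb]_(u in `[0, t]) f u.

Lemma resolvent_const s t : 0 < s -> s <= t -> Rl t + F t = Rl s + F s.
Proof.
move=> s0 st; have := resolvent_increment s0 st.
have : F t - F s = \int[leb]_(u in `[s, t]) f u.
  rewrite /F Rintegral_itvB ?bnd_simp//.
  - rewrite Rintegral_itv_obnd_cbnd//.
    apply: integrableS (L1loc_itv t if_) => // u /=; rewrite !in_itv/= => /andP[su ->].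
    by rewrite ltW// (lt_trans s0).
  - exact: L1loc_itv.
  - exact: ltW.
lra.
Qed.

(** On the open half-line [Rl + F] is a constant [rho]. To identify it with 1, the resolvent
    equation is examined near 0: [Rl] is bounded on [[0, 1]], so [K * Rl] tends to 0, and so does
    [F]. *)
Lemma resolvent_integral t : 0 <= t -> Rl t = 1 - F t.
Proof.
pose rho := Rl 1 + F 1.
have rhoE s : 0 < s -> s <= 1 -> Rl s = rho - F s.
  by move=> s0 s1; have := resolvent_const s0 s1; rewrite /rho; lra.
pose C := \int[leb]_(u in `[0, 1]) `|f u|.
have if1 : leb.-integrable `[0, 1] (EFin \o f) by exact: L1loc_itv.
have iK1 : leb.-integrable `[0, 1] (EFin \o K) by exact: L1loc_itv.
have sub s : 0 <= s -> s <= 1 -> `[0, s]%classic `<=` (`[0, 1]%classic : set R).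
  by move=> s0 s1 u /=; rewrite !in_itv/= => /andP[-> /le_trans]; exact.
have FC s : 0 <= s -> s <= 1 -> `|F s| <= C.
  move=> s0 s1.
  have ifs : leb.-integrable `[0, s] (EFin \o f) by apply: integrableS if1 => //; exact: sub.
  rewrite /F; apply: (@le_trans _ _ (\int[leb]_(u in `[0, s]) `|f u|)).
    exact: le_normr_Rintegral.
  rewrite -lee_fin !EFin_Rintegral_in//; last 2 first.
  - exact: integrable_norm.
  - exact: integrable_norm ifs.
  apply: ge0_subset_integral => //; last exact: sub.
  exact: measurable_int (integrable_norm if1).
have C0 : 0 <= C by exact: Rintegral_ge0.
pose M := 1 + `|rho| + C.
have M0 : 0 < M by rewrite /M; have := normr_ge0 rho; lra.
have RM s : 0 <= s -> s <= 1 -> `|Rl s| <= M.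
  rewrite le_eqVlt => /predU1P[<- _|s0 s1].
    by rewrite (resolvent_at0 hR) normr1 /M; have := normr_ge0 rho; lra.
  rewrite rhoE// /M; apply: (le_trans (ler_normB _ _)).
  by have := FC s (ltW s0) s1; lra.
have convM s : 0 < s -> s <= 1 -> `|convol K Rl s| <= M * `|\int[leb]_(u in `[0, s]) `|K u| |.
  move=> s0 s1; rewrite convolE.
  have cR : causal (ext Rl) by apply: L1loc_causal; exact: (resolvent_L1loc hR).
  rewrite [X in _ * X]ger0_norm; last exact: Rintegral_ge0.
  have -> : \int[leb]_(u in `[0, s]) `|K u| = \int[leb]_(u in `[0, s]) `|ext K u|.
    by apply: eq_Rintegral => u; rewrite inE/= in_itv/= => /andP[u0 _]; rewrite extE.
  apply: conv_le => //; [exact: L1loc_causal|exact: L1loc_ext|exact: ltW|].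
  by move=> u /andP[u0 us]; rewrite extE// RM//; lra.
(* Otherwise some [s] in []0, 1]] makes [|F s|] and [lambda |K * Rl (s)|] both smaller than
   [|rho - 1| / 2], whereas the equation at [s] reads [rho - 1 = F s - lambda K * Rl (s)]. *)
have rho1 : rho = 1.
  apply/eqP; rewrite -subr_eq0; apply/negPn/negP => r0.
  have e0 : 0 < `|rho - 1| / 2 by rewrite divr_gt0// normr_gt0.
  have d0 : 0 < `|rho - 1| / 2 / (lambda * M) by rewrite divr_gt0// mulr_gt0.
  have [d1 /= d10 H1] := parameterized_integral_near_left ltr01 e0 if1.
  have [d2 /= d20 H2] := parameterized_integral_near_left ltr01 d0 (integrable_norm iK1).
  pose s := Num.min (Num.min d1 d2) 1 / 2.
  have mn0 : 0 < Num.min (Num.min d1 d2) 1 by rewrite !lt_min d10 d20 ltr01.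
  have [sd1 sd2 s1] : [/\ Num.min (Num.min d1 d2) 1 <= d1,
     Num.min (Num.min d1 d2) 1 <= d2 & Num.min (Num.min d1 d2) 1 <= 1].
    by rewrite !ge_min !lexx ?orbT.
  have s0 : 0 < s by rewrite /s; lra.
  have {}s1 : s <= 1 by rewrite /s; lra.
  have /H1/(_ (ltW s0)) : ball_ Num.norm 0 d1 s.
    by rewrite /ball_/= sub0r normrN ger0_norm /s; lra.
  have /H2/(_ (ltW s0)) : ball_ Num.norm 0 d2 s.
    by rewrite /ball_/= sub0r normrN ger0_norm /s; lra.
  rewrite /parameterized_integral -/(F s) ltr_pdivlMr; last by rewrite mulr_gt0.
  move=> h2 h1.
  have := convM s s0 s1; have := resolvent_eq hR (ltW s0); rewrite rhoE//.
  move: (convol K Rl s) (F s) h1 h2 => c Fs h1 h2 E cM.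
  have Er : rho - 1 = Fs - lambda * c by lra.
  have h3 : `|rho - 1| <= `|Fs| + lambda * `|c|.
    by rewrite Er (le_trans (ler_normB _ _))// normrM (ger0_norm (ltW lambda0)).
  move: cM h2; set k := `| \int[_]_(_ in _) _ | => cM h2.
  have h4 : lambda * `|c| <= k * (lambda * M).
    by rewrite mulrCA ler_pM2l// mulrC.
  lra.
rewrite le_eqVlt => /predU1P[<-|t0].
  by rewrite (resolvent_at0 hR) /F set_itv1 Rintegral_set1 subr0.
have [t1|/ltW t1] := leP t 1; first by rewrite rhoE// rho1.
have := resolvent_const ltr01 t1; rewrite -/rho rho1; lra.
Qed.

Let Kx := ext K.
Let fx := ext f.
Let one : R -> R := ext (cst 1).

Lemma causal_K : causal Kx. Proof. exact: L1loc_causal. Qed.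
Lemma causal_f : causal fx. Proof. exact: L1loc_causal. Qed.

Lemma convolution_bounded_fK : convolution_bounded fx Kx.
Proof.
apply: convolution_bounded_sqr.
- exact: causal_f.
- exact: causal_K.
- exact: L2loc_ext.
- exact: L2loc_ext.
Qed.

Lemma causal_one : causal one.
Proof. by apply: causal_ext => T _; exact: measurable_cst. Qed.

Lemma bounded_one : locally_bounded one.
Proof.
by move=> T; exists 1 => t _; rewrite /one /ext; case: ifP; rewrite ?normr1 ?normr0.
Qed.

Lemma conv_one g t : causal g -> conv one g t = \int[leb]_(s in `[0, t]) g s.
Proof.
move=> cg; rewrite /conv -(Rintegral_supp leb (D := `[0, t]%classic)).
  apply: eq_Rintegral => s; rewrite inE/= in_itv/= => /andP[s0 st].
  by rewrite /one extE ?subr_ge0// mul1r.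
by move=> s; apply: conv_supp => //; exact: causal_one.
Qed.

Let Rx := ext Rl.

Let RxE t : Rx t = one t - conv one fx t.
Proof.
have [t0|t0] := ltP t 0.
  rewrite /Rx /one !ext_lt0// conv_lt0 ?subr0//; [exact: causal_one|exact: causal_f].
rewrite /Rx /one !extE// resolvent_integral// (conv_one _ causal_f); congr (_ - _).
by apply: eq_Rintegral => s; rewrite inE/= in_itv/= => /andP[s0 _]; rewrite /fx extE.
Qed.

(** Inserting [Rl = 1 - 1 * f] into the resolvent equation and rearranging the convolutions shows
    that [D = lambda K - f - lambda K * f] has zero integral over every [[0, t]]; it therefore
    vanishes almost everywhere. *)
Lemma resolvent_ae : {ae leb, forall t, fx t = lambda * Kx t - lambda * conv fx Kx t}.
Proof.
have co := causal_one; have cK := causal_K; have cf := causal_f.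
have iKx : L1loc Kx := L1loc_ext iK.
have ifx : L1loc fx := L1loc_ext if_.
have b1 : convolution_bounded one Kx.
  exact: convolution_bounded_bounded co cK bounded_one iKx.
have b2 := convolution_boundedC co cK b1.
pose D t := lambda * Kx t - fx t - lambda * conv Kx fx t.
have cD : causal D.
  have [[mK K0] [mf f0]] := (cK, cf); split.
    apply: measurable_funB; last by apply: measurable_funM => //; exact: measurable_conv.
    by apply: measurable_funB => //; exact: measurable_funM.
  by move=> t t0; rewrite /D K0// f0// conv_lt0// !mulr0 !subr0.
have iKf t : leb.-integrable `[0, t] (EFin \o conv Kx fx).
  have [C HC] := b1 t.
  have h := L1_conv_assocl cK cf co HC (L1loc_itv t ifx).
  have {}h : leb.-integrable `[0, t]
      (EFin \o (fun s => one (t - s) * conv Kx fx s)).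
    apply/(integrable_supp leb _ _).2 => // s; apply: conv_supp => //.
    exact: causal_conv.
  apply: eq_integrable h => // s; rewrite inE/= in_itv/= => /andP[s0 st].
  by rewrite /one extE ?subr_ge0// mul1r.
have iKxt t : leb.-integrable `[0, t] (EFin \o Kx) by exact: L1loc_itv.
have ifxt t : leb.-integrable `[0, t] (EFin \o fx) by exact: L1loc_itv.
have ZL (k : R) (g : R -> R) t : leb.-integrable `[0, t] (EFin \o g) ->
    leb.-integrable `[0, t] (EFin \o (fun s => k * g s)).
  by move=> ig; exact: integrable_EFinZ.
have BL (g h : R -> R) t : leb.-integrable `[0, t] (EFin \o g) ->
    leb.-integrable `[0, t] (EFin \o h) ->
    leb.-integrable `[0, t] (EFin \o (fun s => g s - h s)).
  by move=> ig ih; exact: integrable_EFinB.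
have iD : L1loc D by move=> T T0; apply: (BL _ _ _ (BL _ _ _ _ _) _); try exact: ZL.
have D0 t : 0 < t -> \int[leb]_(s in `[0, t]) D s = 0.
  move=> t0; rewrite /D RintegralB//; [|by apply: (BL _ _ _ _ _) => //; exact: ZL|exact: ZL].
  rewrite RintegralB//; last exact: ZL.
  rewrite !RintegralZl// -!conv_one//; last exact: causal_conv.
  have [C1 H1] := b1 t; have [C2 H2] := b2 t.
  have := resolvent_eq hR (ltW t0).
  rewrite convolE -/Kx -/Rx -(extE Rl (ltW t0)) -/Rx RxE /one extE ?ltW// -/one.
  have -> : conv Kx Rx t =
      \int[leb]_s (Kx (t - s) * one s - Kx (t - s) * conv one fx s).
    by apply: eq_Rintegral => s _; rewrite RxE mulrBr.
  rewrite (RintegralTB (L1_conv_bounded t cK co iKx bounded_one)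
    (L1_conv_assocl co cf cK H2 (ifxt t))).
  rewrite -/(conv Kx one t) -/(conv Kx (conv one fx) t).
  rewrite (conv_assoc co cf cK H2 (ifxt t)) (conv_assoc cK cf co H1 (ifxt t)).
  have -> : conv (conv Kx one) fx t = conv (conv one Kx) fx t.
    apply: eq_Rintegral => s _; congr (_ * _).
    by rewrite convC//; [case: cK|case: co].
  rewrite (convC _ (proj1 cK) (proj1 co)).
  move: (conv (conv one Kx) fx t) (conv one Kx t) (conv one fx t) => x y z /=; lra.
apply: aeS (integrals_eq0_ae cD iD D0) => t.
rewrite /D (convC _ (proj1 cf) (proj1 cK)).
move: (conv Kx fx t) => x; lra.
Qed.

End ResolventFacts.

(** * Gram kernels *)

Section SquareIntegrableMeasure.
Context {R : realType} {d : measure_display} {T : measurableType d}.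
Variable mu : {measure set T -> \bar R}.
Implicit Types f g : T -> R.

Definition L2 f := measurable_fun setT f /\ L1 mu (fun x => f x ^+ 2).

Lemma normrM_le_sqr (x y : R) : `|x * y| <= x ^+ 2 + y ^+ 2.
Proof.
have := sqr_ge0 (`|x| - `|y|); have := sqr_ge0 x; have := sqr_ge0 y.
rewrite sqrrB !real_normK ?num_real// normrM; lra.
Qed.

Lemma L1_L2M f g : L2 f -> L2 g -> L1 mu (fun x => f x * g x).
Proof.
move=> [mf f2] [mg g2]; apply: (L1_le _ (L1D f2 g2)); first exact: measurable_funM.
by move=> x; rewrite (le_trans (normrM_le_sqr _ _))// ler_norm.
Qed.

Lemma L2D f g : L2 f -> L2 g -> L2 (fun x => f x + g x).
Proof.
move=> hf hg; split; first by apply: measurable_funD; [case: hf|case: hg].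
have h := L1D (L1D (proj2 hf) (proj2 hg)) (L1Zl 2 (L1_L2M hf hg)).
by move: h; congr (integrable _ _ _); apply/funext => x; congr (_%:E); ring.
Qed.

Lemma L2Z k f : L2 f -> L2 (fun x => k * f x).
Proof.
move=> [mf f2]; split; first exact: measurable_funM.
have := L1Zl (k ^+ 2) f2; congr (integrable _ _ _).
by apply/funext => x; rewrite exprMn.
Qed.

Lemma L2B f g : L2 f -> L2 g -> L2 (fun x => f x - g x).
Proof.
move=> hf /(L2Z (-1)) hg; have := L2D hf hg.
by under eq_fun do rewrite mulN1r.
Qed.

Lemma Rintegral_sqrB f g : L2 f -> L2 g ->
  \int[mu]_x (f x - g x) ^+ 2 =
  \int[mu]_x (f x ^+ 2) - 2 * (\int[mu]_x (g x * f x)) + \int[mu]_x (g x ^+ 2).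
Proof.
move=> hf hg; have [f2 g2 gf] := And3 (proj2 hf) (proj2 hg) (L1_L2M hg hf).
rewrite -(RintegralTZ 2 gf) -(RintegralTB f2 (L1Zl 2 gf)).
rewrite -(RintegralTD (L1B f2 (L1Zl 2 gf)) g2).
by apply: eq_Rintegral => x _; ring.
Qed.

Lemma discriminant_le (a b c : R) : 0 <= a ->
  (forall r, 0 <= a * r ^+ 2 - 2 * b * r + c) -> b ^+ 2 <= a * c.
Proof.
rewrite le_eqVlt => /predU1P[<- H|a0 H].
  rewrite mul0r; have [->|b0] := eqVneq b 0; first by rewrite expr0n.
  (* At this point the affine function [c - 2 b r] takes the value -1. *)
  have := H ((c + 1) / (2 * b)).
  rewrite mul0r add0r.
  have -> : 2 * b * ((c + 1) / (2 * b)) = c + 1.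
    by rewrite mulrC divfK// mulf_neq0// pnatr_eq0.
  by move=> ?; exfalso; lra.
have := H (b / a).
have -> : a * (b / a) ^+ 2 - 2 * b * (b / a) + c = c - b ^+ 2 / a.
  by field; rewrite gt_eqF.
by rewrite subr_ge0 ler_pdivrMr// mulrC.
Qed.

Lemma Cauchy_Schwarz f g : L2 f -> L2 g ->
  (\int[mu]_x (f x * g x)) ^+ 2 <= (\int[mu]_x (f x ^+ 2)) * (\int[mu]_x (g x ^+ 2)).
Proof.
move=> hf hg; apply: discriminant_le => [|r]; first by apply: Rintegral_ge0 => x _; exact: sqr_ge0.
have : 0 <= \int[mu]_x (r * f x - g x) ^+ 2.
  by apply: Rintegral_ge0 => x _; exact: sqr_ge0.
rewrite (Rintegral_sqrB (L2Z r hf) hg).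
have -> : \int[mu]_x (r * f x) ^+ 2 = r ^+ 2 * \int[mu]_x (f x ^+ 2).
  rewrite -(RintegralTZ _ (proj2 hf)).
  by apply: eq_Rintegral => x _; rewrite exprMn.
have -> : \int[mu]_x (g x * (r * f x)) = r * \int[mu]_x (f x * g x).
  rewrite -(RintegralTZ _ (L1_L2M hf hg)).
  by apply: eq_Rintegral => x _; ring.
by move: (\int[mu]_x (f x ^+ 2)) (\int[mu]_x (f x * g x)) => x y; lra.
Qed.

End SquareIntegrableMeasure.

(** * Weighted integrals of a square-integrable family *)

Section Gram.
Context {R : realType} {d : measure_display} {T : measurableType d}.
Local Notation leb := (@lebesgue_measure R).
Variable mu : {sigma_finite_measure set T -> \bar R}.
Variables (Y : R -> T -> R) (k : R -> R) (B : R).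
Hypothesis mY : measurable_fun setT (fun z : measurableTypeR R * T => Y z.1 z.2).
Hypothesis ik : L1 leb k.
Hypothesis Y2 : forall s, L1 mu (fun w => Y s w ^+ 2).
Hypothesis YB : forall s, \int[mu]_w (Y s w ^+ 2) <= B.

Let U w := \int[leb]_s (k s * Y s w).

Let mYs s : measurable_fun setT (Y s).
Proof. exact: (measurable_section1 mY). Qed.

Let L2Y s : L2 mu (Y s). Proof. by split. Qed.

Section Pairing.
Variable V : T -> R.
Hypothesis V2 : L2 mu V.

Let F s w := V w * (k s * Y s w).

Let mF : measurable_fun setT (fun z : measurableTypeR R * T => F z.1 z.2).
Proof.
have mk := L1_measurable ik; have [mV _] := V2.
apply: measurable_funM; first exact: (measurableT_comp mV).
by apply: measurable_funM => //; exact: (measurableT_comp mk).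
Qed.

(** Since [|V Y_s| <= V^2 + Y_s^2], the inner integral is bounded by a constant independent of [s],
    and the integrability of [k] does the rest. *)
Let iF : L1 (leb \x mu)%E (fun z : measurableTypeR R * T => F z.1 z.2).
Proof.
apply: (L1_prod12 mF).
pose C := B + \int[mu]_w (V w ^+ 2).
have iC := L1Zl C (L1_norm ik).
apply: (@le_lt_trans _ _ (\int[leb]_s (C * `|k s|)%:E))%E; last first.
  by rewrite -(EFin_Rintegral iC) ltry.
have mabsF : measurable_fun setT
    (fun z : measurableTypeR R * T => `|F z.1 z.2|%:E).
  by apply/measurable_EFinP; exact: measurableT_comp.
have mVY s : measurable_fun setT (fun w => `|V w * Y s w|%:E).
  apply/measurable_EFinP; apply: measurableT_comp => //.
  by apply: measurable_funM => //; case: V2.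
apply: ge0_le_integral => //.
- by move=> s _; apply: integral_ge0 => w _; rewrite lee_fin.
- exact: (measurable_fun_fubini_tonelli_F _ mabsF).
- by apply/measurable_EFinP; exact: L1_measurable iC.
- move=> s _; rewrite mulrC EFinM.
  have -> : (\int[mu]_w `|F s w|%:E = `|k s|%:E * \int[mu]_w `|V w * Y s w|%:E)%E.
    rewrite -ge0_integralZl//; apply: eq_integral => w _.
    by rewrite -EFinM -normrM /F mulrCA.
  apply: lee_wpmul2l => //.
  have iVY := L1D (proj2 V2) (Y2 s).
  apply: (@le_trans _ _ (\int[mu]_w (V w ^+ 2 + Y s w ^+ 2)%:E)%E).
    apply: ge0_le_integral => //.
    + by apply/measurable_EFinP; exact: L1_measurable iVY.
    + by move=> w _; rewrite lee_fin normrM_le_sqr.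
  rewrite -(EFin_Rintegral iVY) lee_fin (RintegralTD (proj2 V2) (Y2 s)) /C addrC.
  by rewrite lerD2r YB.
Qed.

Let FE : {ae mu, forall w, \int[leb]_s F s w = U w * V w}.
Proof.
by apply: aeS (ae_L1_section2 mF iF) => w /RintegralZ_L1 ->; rewrite mulrC.
Qed.

Lemma measurable_gram : measurable_fun setT U.
Proof.
have mk := L1_measurable ik.
apply: (@measurable_Rintegral2 _ _ _ _ _ leb (fun w s => k s * Y s w)).
apply: (@measurable_prod_swap _ _ _ _ _ (fun s w => k s * Y s w)).
by apply: measurable_funM => //; exact: (measurableT_comp mk).
Qed.

Lemma gram_L1M : L1 mu (fun w => U w * V w).
Proof.
apply: (L1_ae (L1_Rintegral1 mF iF) _ FE).
by apply: measurable_funM; [exact: measurable_gram|case: V2].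
Qed.

Lemma gram_pairing :
  \int[mu]_w (U w * V w) = \int[leb]_s (k s * \int[mu]_w (Y s w * V w)).
Proof.
rewrite -(ae_eq_Rintegral (L1_measurable (L1_Rintegral1 mF iF)) _ FE); last first.
  exact: L1_measurable gram_L1M.
rewrite -(RFubini mF iF); apply: eq_Rintegral => s _.
rewrite -RintegralTZ; last by apply: L1_L2M.
by apply: eq_Rintegral => w _; rewrite /F; ring.
Qed.

End Pairing.

(** Cauchy-Schwarz for the weight [|k|]: the polynomial in [r] given by the integral of
    [|k s| (r - |Y s w|)^2] is nonnegative, so its discriminant bounds [U^2] by the product of the
    integrals of [|k|] and [|k| Y^2]; the latter is integrable in [w] by Fubini. *)
Lemma gram_L2 : L2 mu U.
Proof.
have mU := measurable_gram.
split => //.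
have mk := L1_measurable ik.
pose Q s w := `|k s| * Y s w ^+ 2.
have mQ : measurable_fun setT (fun z : measurableTypeR R * T => Q z.1 z.2).
  apply: measurable_funM; last exact: measurable_funX.
  by apply: measurableT_comp => //; exact: (measurableT_comp mk).
have iB := L1Zl B (L1_norm ik).
have iQ : L1 (leb \x mu)%E (fun z : measurableTypeR R * T => Q z.1 z.2).
  apply: (L1_prod12 mQ).
  apply: (@le_lt_trans _ _ (\int[leb]_s (B * `|k s|)%:E))%E; last first.
    by rewrite -(EFin_Rintegral iB) ltry.
  have mabsQ : measurable_fun setT
      (fun z : measurableTypeR R * T => `|Q z.1 z.2|%:E).
    by apply/measurable_EFinP; exact: measurableT_comp.
  apply: ge0_le_integral => //.
  - by move=> s _; apply: integral_ge0 => w _; rewrite lee_fin.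
  - by apply: (measurable_fun_fubini_tonelli_F _ mabsQ) => z; rewrite lee_fin.
  - by apply/measurable_EFinP; exact: L1_measurable iB.
  - move=> s _; rewrite /Q.
    have i1 := L1Zl `|k s| (Y2 s).
    have -> : (\int[mu]_w `| `|k s| * Y s w ^+ 2|%:E =
        \int[mu]_w (`|k s| * Y s w ^+ 2)%:E)%E.
      by apply: eq_integral => w _; rewrite ger0_norm// mulr_ge0// sqr_ge0.
    by rewrite -(EFin_Rintegral i1) lee_fin (RintegralTZ _ (Y2 s)) mulrC ler_wpM2r// YB.
pose A := \int[leb]_s `|k s|.
have iG := L1Zl A (L1_Rintegral1 mQ iQ).
apply: L1_abs_lty; first exact: measurable_funX.
apply: (@le_lt_trans _ _ (\int[mu]_w (A * \int[leb]_s Q s w)%:E))%E; last first.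
  by rewrite -(EFin_Rintegral iG) ltry.
apply: ae_ge0_le_integral => //.
- apply/measurable_EFinP; apply: measurableT_comp => //.
  exact: measurable_funX.
- move=> w _; rewrite lee_fin mulr_ge0//; first exact: Rintegral_ge0.
  by apply: Rintegral_ge0 => s _; rewrite mulr_ge0// sqr_ge0.
- by apply/measurable_EFinP; exact: L1_measurable iG.
apply: aeS (ae_L1_section2 mQ iQ) => w iQw _; rewrite lee_fin ger0_norm ?sqr_ge0//.
have mkY : measurable_fun setT (fun s : measurableTypeR R => k s * Y s w).
  by apply: measurable_funM => //; exact: (measurable_section2 mY).
have ikY : L1 leb (fun s => k s * Y s w).
  apply: (L1_le _ (L1D (L1_norm ik) iQw)); first exact: mkY.
  move=> s; rewrite [leRHS]ger0_norm; last by rewrite addr_ge0// mulr_ge0// sqr_ge0.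
  rewrite normrM /Q -[X in X + _]mulr1 -mulrDr ler_wpM2l//.
  have := sqr_ge0 (`|Y s w| - 1); rewrite sqrrB real_normK ?num_real// expr1n mulr1.
  have := sqr_ge0 (Y s w); have := normr_ge0 (Y s w); lra.
have iaY := L1_norm ikY.
apply: (@le_trans _ _ ((\int[leb]_s `|k s * Y s w|) ^+ 2)).
  rewrite -(real_normK (num_real (U w))) ler_sqr ?nnegrE//.
    exact: le_normr_Rintegral.
  by apply: Rintegral_ge0.
apply: discriminant_le; first exact: Rintegral_ge0.
move=> r.
have -> : A * r ^+ 2 - 2 * (\int[leb]_s `|k s * Y s w|) * r + \int[leb]_s Q s w =
    \int[leb]_s (r ^+ 2 * `|k s| - (2 * r) * `|k s * Y s w| + Q s w).
  have h1 := L1Zl (r ^+ 2) (L1_norm ik); have h2 := L1Zl (2 * r) iaY.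
  rewrite (RintegralTD (L1B h1 h2) iQw) (RintegralTB h1 h2).
  rewrite (RintegralTZ _ (L1_norm ik)) (RintegralTZ _ iaY) -/A.
  by move: (\int[leb]_s Q s w) (\int[leb]_s `|k s * Y s w|) => y z; ring.
apply: Rintegral_ge0 => s _.
have -> : r ^+ 2 * `|k s| - 2 * r * `|k s * Y s w| + Q s w =
    `|k s| * (r - `|Y s w|) ^+ 2.
  by rewrite /Q normrM sqrrB real_normK ?num_real//; ring.
by rewrite mulr_ge0// sqr_ge0.
Qed.

Let C s r := \int[mu]_w (Y s w * Y r w).

(** The square is expanded and [gram_pairing] applied to [U] against [Y t], then to [U] against
    itself, until only the inner products [C] are left. *)
Lemma gram_norm t : \int[mu]_w ((Y t w - U w) ^+ 2) =
  C t t - 2 * (\int[leb]_s (k s * C s t)) +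
  \int[leb]_s (k s * \int[leb]_r (k r * C r s)).
Proof.
rewrite (Rintegral_sqrB (L2Y t) gram_L2) (gram_pairing (L2Y t)).
have -> : \int[mu]_w (Y t w ^+ 2) = C t t.
  by apply: eq_Rintegral => w _; rewrite expr2.
congr (_ + _).
have -> : \int[mu]_w (U w ^+ 2) = \int[mu]_w (U w * U w).
  by apply: eq_Rintegral => w _; rewrite expr2.
rewrite (gram_pairing gram_L2); apply: eq_Rintegral => s _; congr (_ * _).
rewrite -(gram_pairing (L2Y s)).
by apply: eq_Rintegral => w _; rewrite mulrC.
Qed.

End Gram.

(** * Moments of Brownian increments *)

Section GaussianMoments.
Context {R : realType}.
Local Notation leb := (@lebesgue_measure R).
Variable sigma : R.
Hypothesis sigma0 : 0 < sigma.
Let p : R -> R := normal_pdf 0 sigma.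
Let sn0 : sigma != 0. Proof. by rewrite gt_eqF. Qed.

Let pE x : p x = normal_peak sigma * expR (- x ^+ 2 / (sigma ^+ 2 *+ 2)).
Proof. by rewrite /p normal_pdfE// /normal_fun subr0. Qed.

(** The Radon-Nikodym derivative of the normal law agrees a.e. with the density, since both have the
    same integral over every measurable set. *)
Lemma integral_normal_prob (g : R -> \bar R) : measurable_fun setT g ->
  (forall x, (0 <= g x)%E) ->
  (\int[normal_prob 0 sigma]_x g x = \int[leb]_x (g x * (p x)%:E))%E.
Proof.
move=> mg g0.
have dom := normal_prob_dominates (0 : R) sigma.
have ip := integrable_normal_pdf (0 : R) sigma.
have mp : measurable_fun setT (fun x => (p x)%:E).
  by apply/measurable_EFinP; exact: measurable_normal_pdf.
rewrite -(@Radon_Nikodym_SigmaFinite.change_of_variables _ _ R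
  (normal_prob 0 sigma) leb dom)//.
have mf := measurable_int _ (Radon_Nikodym_SigmaFinite.f_integrable dom).
apply: ae_eq_integral => //.
- exact: emeasurable_funM.
- exact: emeasurable_funM.
have : ae_eq leb setT
    (Radon_Nikodym_SigmaFinite.f (normal_prob 0 sigma) leb) (fun x => (p x)%:E).
  apply: integral_ae_eq => //.
  - exact: Radon_Nikodym_SigmaFinite.f_integrable.
  - move=> E _ mE.
    by rewrite -(Radon_Nikodym_SigmaFinite.f_integral dom mE).
by apply: aeS => x h xT; rewrite h.
Qed.

Let pcont : continuous p. Proof. exact: continuous_normal_pdf. Qed.
Let pge0 x : 0 <= p x. Proof. exact: normal_pdf_ge0. Qed.
Let peven x : p (- x) = p x. Proof. by rewrite !pE sqrrN. Qed.

Let halfline0 : [set x : R | 0 <= x] = `[0, +oo[%classic.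
Proof. by apply/seteqP; split => x /=; rewrite in_itv/= andbT. Qed.

Let half_mass : (\int[leb]_(x in `[0%R, +oo[) (p x)%:E = (2^-1)%:E)%E.
Proof.
have := @ge0_symfun_integralT R p pge0 pcont (fun x => esym (peven x)).
rewrite (@integral_normal_pdf R 0 sigma) halfline0.
set I := (X in (_ * X)%E) => H; rewrite -/I.
have I0 : (0 <= I)%E by apply: integral_ge0 => x _; rewrite lee_fin.
have Ifin : I \is a fin_num.
  rewrite ge0_fin_numE// ltey; apply/eqP => Iy.
  by move: H; rewrite Iy gt0_muley.
move: H; rewrite -(fineK Ifin) -EFinM => -[] H; congr EFin.
by apply: (mulfI (_ : (2 : R) != 0)); rewrite ?pnatr_eq0// -H divff ?pnatr_eq0.
Qed.

(** Integration by parts in differential form: [p' = - x p / sigma^2], so [- sigma^2 x p] is a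
    primitive of [(x^2 - sigma^2) p]. *)
Let derive_xp (x : R) : is_derive x 1 (fun y => - sigma ^+ 2 * (y * p y))
  (x ^+ 2 * p x - sigma ^+ 2 * p x).
Proof.
have -> : (fun y => - sigma ^+ 2 * (y * p y)) = (fun y => - sigma ^+ 2 * (y *
    (normal_peak sigma * expR (- y ^+ 2 / (sigma ^+ 2 *+ 2))))).
  by apply/funext => y; rewrite pE.
rewrite !pE; set k := normal_peak sigma; set s2 := sigma ^+ 2 *+ 2.
have s2E : s2^-1 * sigma ^+ 2 = 2^-1.
  by rewrite /s2 -mulr_natr invfM mulrAC mulVf ?mul1r// sqrf_eq0.
apply: is_derive_eq; rewrite /GRing.scale /= !mulr1.
set e := expR _.
have -> : x ^+ 2 * (k * e) = 2 * (s2^-1 * sigma ^+ 2) * (x ^+ 2 * (k * e)).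
  by rewrite s2E divff ?mul1r// pnatr_eq0.
ring.
Qed.

Let p_decay (x : R) : 0 < x -> x * p x <= normal_peak sigma * (sigma ^+ 2 *+ 2) / x.
Proof.
move=> x0; rewrite pE mulNr expRN.
have s2 : 0 < sigma ^+ 2 *+ 2 by rewrite mulrn_wgt0// exprn_gt0.
set u := x ^+ 2 / (sigma ^+ 2 *+ 2).
have u0 : 0 < u by rewrite divr_gt0// exprn_gt0.
have hu : (expR u)^-1 <= u^-1.
  rewrite lef_pV2 ?posrE ?expR_gt0//.
  by have := expR_ge1Dx u; lra.
rewrite mulrCA -mulrA ler_wpM2l ?normal_peak_ge0//.
apply: (le_trans (ler_wpM2l (ltW x0) hu)).
have -> : x * u^-1 = sigma ^+ 2 *+ 2 / x; last by [].
by rewrite /u; field; rewrite sn0 gt_eqF.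
Qed.

(** On [[0, n]] the primitive above turns the second moment into [sigma^2] times the mass, up to the
    boundary term [sigma^2 n p(n)], which [p_decay] sends to 0. The half-line carries mass 1/2, and
    evenness doubles the result. *)
Lemma integral_sqr_normal_pdf :
  (\int[leb]_x (x ^+ 2 * p x)%:E = (sigma ^+ 2)%:E)%E.
Proof.
have cq : continuous (fun x : R => x ^+ 2 * p x).
  by move=> x; apply: cvgM; [exact: exprn_continuous|exact: pcont].
rewrite ge0_symfun_integralT//; last 2 first.
- by move=> x; rewrite mulr_ge0 ?sqr_ge0.
- by move=> x /=; rewrite sqrrN peven.
rewrite halfline0.
have mq : measurable_fun setT (fun x : R => (x ^+ 2 * p x)%:E).
  by apply/measurable_EFinP; exact: continuous_measurable_fun.
have mp : measurable_fun setT (fun x : R => (p x)%:E).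
  by apply/measurable_EFinP; exact: continuous_measurable_fun.
pose I n := `[0, n%:R]%classic : set R.
have IU : \bigcup_n I n = `[0, +oo[%classic.
  apply/seteqP; split => [x [n _]|x] /=; rewrite !in_itv/= ?andbT.
    by move=> /andP[].
  move=> x0; exists (Num.truncn x).+1 => //=.
  by rewrite /I/= in_itv/= x0 ltW// truncnS_gt.
have nI : nondecreasing_seq I.
  move=> m n mn; apply/subsetPset => x; rewrite /I /= !in_itv/= => /andP[-> /le_trans]; apply.
  by rewrite ler_nat.
have c1 := @ge0_nondecreasing_set_cvg_integral _ (measurableTypeR R) R I
  (fun x => (x ^+ 2 * p x)%:E) leb nI (fun i => measurable_itv _)
  (fun i => measurable_funTS mq) (fun i x _ => mulr_ge0 (sqr_ge0 x) (pge0 x)).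
have c2 := @ge0_nondecreasing_set_cvg_integral _ (measurableTypeR R) R I
  (fun x => (p x)%:E) leb nI (fun i => measurable_itv _)
  (fun i => measurable_funTS mp) (fun i x _ => pge0 x).
rewrite IU half_mass in c2; rewrite IU in c1.
have cint (q : R -> R) n : continuous q -> leb.-integrable (I n) (EFin \o q).
  move=> cq'; apply: continuous_compact_integrable; first exact: segment_compact.
  exact: continuous_subspaceT.
have mI n : measurable (I n : set (measurableTypeR R)) by exact: measurable_itv.
have En n : (\int[leb]_(x in I n) (x ^+ 2 * p x)%:E)%E =
   (sigma ^+ 2 * \int[leb]_(x in I n) p x - sigma ^+ 2 * (n%:R * p n%:R))%:E.
  have n0 : (0 : R) <= n%:R by exact: ler0n.
  have i1 := cint _ n cq; have i2 := cint _ n pcont.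
  have i3 : leb.-integrable (I n) (EFin \o (fun x => x ^+ 2 * p x - sigma ^+ 2 * p x)).
    exact: (integrable_EFinB (mI n) i1 (integrable_EFinZ _ (mI n) i2)).
  have := increment_integral n0 (fun x _ => derive_xp x) i3.
  rewrite -/(I n) (RintegralB (mI n) i1 (integrable_EFinZ _ (mI n) i2)).
  rewrite RintegralZl; [|exact: mI|exact: i2].
  rewrite mul0r mulr0 subr0 -(EFin_Rintegral_in (mI n) i1) => H.
  by congr EFin; lra.
have c3 : (fun n => \int[leb]_(x in I n) p x) @ \oo --> (2^-1 : R).
  by apply: fine_cvg; exact: c2.
have c4 : (fun n : nat => n%:R * p n%:R) @ \oo --> (0 : R).
  have c5 : (fun n : nat => normal_peak sigma * (sigma ^+ 2 *+ 2) * n.+1%:R^-1) @ \oo --> (0 : R).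
    by rewrite -[X in _ --> X](mulr0 (normal_peak sigma * (sigma ^+ 2 *+ 2)));
      apply: cvgM; [exact: cvg_cst|exact: cvg_harmonic].
  rewrite -(cvg_shiftS (fun n : nat => n%:R * p n%:R)).
  apply: (squeeze_cvgr _ _ c5); last exact: cvg_cst.
  by apply: nearW => n; rewrite /= mulr_ge0//= p_decay// ltr0n.
have c6 : (fun n => (\int[leb]_(x in I n) (x ^+ 2 * p x)%:E)%E) @ \oo -->
    (sigma ^+ 2 * 2^-1 - sigma ^+ 2 * 0)%:E.
  under eq_fun do rewrite En.
  apply: cvg_EFin; first exact: nearW.
  by apply: cvgB; apply: cvgM => //; exact: cvg_cst.
rewrite (cvg_unique _ c1 c6)// -EFinM mulr0 subr0.
by congr EFin; field.
Qed.

End GaussianMoments.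

(** * Measurability for a sub-sigma-algebra and independent products *)

Section MeasurableWrt.
Context {R : realType} {d : measure_display} {Omega : measurableType d}.
Variable G : set (set Omega).
Hypothesis sG : sigma_algebra setT G.
Implicit Types X Y : Omega -> R.

Lemma measurable_wrtP X :
  measurable_wrt G X <-> measurable_fun (T := g_sigma_algebraType G) setT X.
Proof.
split => [mX _ B mB|mX B mB].
  by rewrite setTI; apply: sub_sigma_algebra; exact: mX.
have := mX measurableT B mB; rewrite setTI.
by rewrite /measurable/= (sigma_algebra_id sG).
Qed.

Lemma measurable_wrtM X Y : measurable_wrt G X -> measurable_wrt G Y ->
  measurable_wrt G (fun w => X w * Y w).
Proof.
move=> /measurable_wrtP mX /measurable_wrtP mY; apply/measurable_wrtP.
exact: measurable_funM.
Qed.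

Lemma measurable_wrtB X Y : measurable_wrt G X -> measurable_wrt G Y ->
  measurable_wrt G (fun w => X w - Y w).
Proof.
move=> /measurable_wrtP mX /measurable_wrtP mY; apply/measurable_wrtP.
exact: measurable_funB.
Qed.

Lemma measurable_wrt_cst (k : R) : measurable_wrt G (fun=> k).
Proof. by apply/measurable_wrtP; exact: measurable_cst. Qed.

End MeasurableWrt.

Section IndependentProduct.
Context {R : realType} {d : measure_display} {Omega : measurableType d}.
Variable P : probability Omega R.
Variables (V D : Omega -> R).
Hypotheses (mV : measurable_fun setT V) (mD : measurable_fun setT D).
Hypothesis ind : forall A B : set R, measurable A -> measurable B ->
  P (V @^-1` A `&` D @^-1` B) = (P (V @^-1` A) * P (D @^-1` B))%E.

Let V' : {mfun Omega >-> measurableTypeR R} :=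
  HB.pack V (isMeasurableFun.Build _ _ _ (measurableTypeR R) V mV).
Let D' : {mfun Omega >-> measurableTypeR R} :=
  HB.pack D (isMeasurableFun.Build _ _ _ (measurableTypeR R) D mD).
Let nuV := distribution P V'.
Let nuD := distribution P D'.

Let pair (w : Omega) : measurableTypeR R * measurableTypeR R := (V w, D w).

Let mpair : measurable_fun setT pair.
Proof. exact: measurable_fun_pair. Qed.

(** Independence says that the joint law is the product of the marginals on rectangles, hence
    everywhere; the expectation of [V g(D)] then factorizes by Fubini. *)
Let joint A : measurable A -> (nuV \x nuD)%E A = image_measure P mpair A.
Proof. by apply: product_measure_unique => // A' B' mA mB; exact: ind. Qed.

Variable g : R -> R.
Hypothesis mg : measurable_fun setT g.
Hypothesis iV : L1 P V.
Hypothesis iD : L1 P (fun w => g (D w)).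

Let F (x y : measurableTypeR R) : R := x * g y.

Let mF : measurable_fun setT
  (fun z : measurableTypeR R * measurableTypeR R => F z.1 z.2).
Proof.
apply: measurable_funM; first exact: measurable_fst.
exact: (measurableT_comp mg (@measurable_snd _ _ (measurableTypeR R) (measurableTypeR R))).
Qed.

Let mid : measurable_fun setT (fun x : measurableTypeR R => x : R).
Proof. exact: measurable_id. Qed.

Let iV' : L1 nuV (fun x : measurableTypeR R => x : R).
Proof. by have := (L1_image_measure P (mV : measurable_fun (U := measurableTypeR R) setT V) mid).2 iV. Qed.

Let iD' : L1 nuD g.
Proof. by have := (L1_image_measure P (mD : measurable_fun (U := measurableTypeR R) setT D) mg).2 iD. Qed.

Let iF : L1 (nuV \x nuD)%E (fun z : measurableTypeR R * measurableTypeR R => F z.1 z.2).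
Proof.
apply: (L1_prod12 mF).
have h := L1Zr (\int[nuD]_y `|g y|) (L1_norm iV').
apply: (@le_lt_trans _ _ (\int[nuV]_x (`|x : R| * \int[nuD]_y `|g y|)%:E)%E).
  rewrite le_eqVlt; apply/orP; left; apply/eqP; apply: eq_integral => x _.
  rewrite EFinM (EFin_Rintegral (L1_norm iD')) -ge0_integralZl//.
    by apply: eq_integral => y _; rewrite -EFinM -normrM.
  by apply/measurable_EFinP; exact: measurableT_comp.
by rewrite -(EFin_Rintegral h) ltry.
Qed.

Lemma L1_indepM : L1 P (fun w => V w * g (D w)).
Proof.
apply/(L1_image_measure P mpair mF).
have /integrableP[_ h] := iF; apply: L1_abs_lty => //.
apply: le_lt_trans h; rewrite le_eqVlt; apply/orP; left; apply/eqP.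
by apply: eq_measure_integral => A mA _; exact/esym/joint.
Qed.

Lemma Rintegral_indepM :
  \int[P]_w (V w * g (D w)) = (\int[P]_w V w) * (\int[P]_w g (D w)).
Proof.
rewrite -(Rintegral_image_measure P mpair mF).
pose mV' : measurable_fun (U := measurableTypeR R) setT V := mV.
pose mD' : measurable_fun (U := measurableTypeR R) setT D := mD.
rewrite -(Rintegral_image_measure P mV' mid) -(Rintegral_image_measure P mD' mg).
transitivity (\int[(nuV \x nuD)%E]_z F z.1 z.2).
  by congr fine; apply: eq_measure_integral => A mA _; exact/esym/joint.
rewrite -(Rintegral12_prod mF iF).
have -> : \int[nuV]_x \int[nuD]_y F x y = \int[nuV]_x ((x : R) * \int[nuD]_y g y).
  by apply: eq_Rintegral => x _; rewrite -(RintegralTZ x iD').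
by rewrite RintegralZr; [|exact: measurableT|exact: iV'].
Qed.

End IndependentProduct.

(** * Increments of the Brownian motion against the past *)

Section BrownianIncrements.
Context {R : realType} {d : measure_display} {Omega : measurableType d}.
Variable P : probability Omega R.
Variable F : R -> set (set Omega).
Hypothesis hF : usual_filtration P F.
Variable W : R -> Omega -> R.
Hypothesis hW : brownian_motion P F W.
Implicit Types (s t : R) (V : Omega -> R).

Lemma adapted_measurable s V : 0 <= s -> measurable_wrt (F s) V ->
  measurable_fun setT V.
Proof.
move=> s0 mV _ B mB; rewrite setTI.
exact: (filtration_measurable hF s0 (mV B mB)).
Qed.

Lemma measurable_wrt_mono s t V : 0 <= s -> s <= t -> measurable_wrt (F s) V ->
  measurable_wrt (F t) V.
Proof. by move=> s0 st mV B mB; exact: (filtration_mono hF s0 st (mV B mB)). Qed.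

Lemma measurable_brownian t : 0 <= t -> measurable_fun setT (W t).
Proof. by move=> t0; apply: (adapted_measurable t0); exact: bm_adapted hW t t0. Qed.

Lemma measurable_increment s t : 0 <= s -> 0 <= t ->
  measurable_fun setT (fun w => W t w - W s w).
Proof. by move=> s0 t0; apply: measurable_funB; exact: measurable_brownian. Qed.

Section Increment.
Variables (s t : R).
Hypotheses (s0 : 0 <= s) (st : s < t).
Let t0 : 0 <= t. Proof. exact: le_trans (ltW st). Qed.
Let D w := W t w - W s w.
Let mD : measurable_fun setT D. Proof. exact: measurable_increment. Qed.
Let sg0 : 0 < Num.sqrt (t - s). Proof. by rewrite sqrtr_gt0 subr_gt0. Qed.

Let ge0_law (g : R -> \bar R) : measurable_fun setT g -> (forall x, (0 <= g x)%E) ->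
  (\int[P]_w g (D w) =
   \int[lebesgue_measure]_x (g x * (normal_pdf 0 (Num.sqrt (t - s)) x)%:E))%E.
Proof.
move=> mg g0; rewrite -(integral_normal_prob _ mg g0).
pose mD' : measurable_fun (U := measurableTypeR R) setT D := mD.
rewrite -(ge0_integral_image_measure P mD' mg g0).
by apply: eq_measure_integral => A mA _; exact: (bm_gaussian hW s0 st).
Qed.

Lemma L2_increment : L2 P D.
Proof.
split => //; apply: L1_abs_lty; first exact: measurable_funX.
rewrite (ge0_law (g := fun x => `|x ^+ 2|%:E))//.
  under eq_integral do rewrite ger0_norm ?sqr_ge0// -EFinM.
  by rewrite (integral_sqr_normal_pdf sg0) ltry.
by apply/measurable_EFinP; apply: measurableT_comp => //; exact: exprn_measurable.
Qed.

Lemma increment_variance : \int[P]_w (D w ^+ 2) = t - s.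
Proof.
rewrite /Rintegral (ge0_law (g := fun x => (x ^+ 2)%:E)).
- under eq_integral do rewrite -EFinM.
  by rewrite (integral_sqr_normal_pdf sg0)/= sqr_sqrtr// subr_ge0 ltW.
- by apply/measurable_EFinP; exact: exprn_measurable.
- by move=> x; rewrite lee_fin sqr_ge0.
Qed.

Lemma L1_increment : L1 P D.
Proof.
have [_ h] := L2_increment.
have i1 : L1 P (cst (1 : R)) by exact: finite_measure_integrable_cst.
apply: (L1_le mD (L1D i1 h)) => w; rewrite [leRHS]ger0_norm; last first.
  by rewrite addr_ge0// sqr_ge0.
have := sqr_ge0 (`|D w| - 1); rewrite sqrrB real_normK ?num_real// expr1n mulr1 /=.
have := sqr_ge0 (D w); have := normr_ge0 (D w); lra.
Qed.

(** The density is even, so the positive and negative parts of the increment have equal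
    integrals. *)
Lemma increment_mean : \int[P]_w (D w) = 0.
Proof.
have iD := L1_increment.
suff : (\int[P]_w (EFin \o D)^\+ w = \int[P]_w (EFin \o D)^\- w)%E.
  move=> E; rewrite /Rintegral integralE E subee//.
  have /integrableP[_] := integrable_funeneg measurableT iD.
  under eq_integral do rewrite gee0_abs//.
  by move=> h; rewrite ge0_fin_numE// integral_ge0.
pose gp (x : R) := (maxe x%:E 0)%E.
pose gm (x : R) := (maxe (- x%:E) 0)%E.
have mEx : measurable_fun setT (fun x : R => x%:E).
  by apply/measurable_EFinP; exact: measurable_id.
have mgp : measurable_fun setT gp by exact: measurable_maxe.
have mgm : measurable_fun setT gm.
  by apply: measurable_maxe => //; exact: measurableT_comp.
have -> : (\int[P]_w (EFin \o D)^\+ w = \int[P]_w gp (D w))%E.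
  by apply: eq_integral => w _; rewrite funeposE.
have -> : (\int[P]_w (EFin \o D)^\- w = \int[P]_w gm (D w))%E.
  by apply: eq_integral => w _; rewrite funenegE.
have gp0 x : (0 <= gp x)%E by rewrite le_max lexx orbT.
have gm0 x : (0 <= gm x)%E by rewrite le_max lexx orbT.
rewrite (ge0_law mgp gp0) (ge0_law mgm gm0).
set p := normal_pdf _ _.
have mp : measurable_fun setT (fun x => (p x)%:E).
  by apply/measurable_EFinP; exact: measurable_normal_pdf.
rewrite -[RHS](ge0_integral_reflect 0).
- apply: eq_integral => x _; rewrite sub0r /gm EFinN oppeK; congr (_ * _%:E)%E.
  by rewrite /p !normal_pdfE ?gt_eqF// /normal_fun !subr0 sqrrN.
- exact: emeasurable_funM.
- by move=> x; rewrite mule_ge0 ?gm0 ?lee_fin ?normal_pdf_ge0.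
Qed.

Variable V : Omega -> R.
Hypotheses (mV : measurable_wrt (F s) V) (iV : L1 P V).

Let ind (A B : set R) : measurable A -> measurable B ->
  P (V @^-1` A `&` D @^-1` B) = (P (V @^-1` A) * P (D @^-1` B))%E.
Proof. by move=> mA mB; apply: (bm_independent hW s0 st) => //; exact: mV. Qed.

Let mV' := adapted_measurable s0 mV.

Lemma L1_mul_increment : L1 P (fun w => V w * D w).
Proof.
exact: (L1_indepM mV' mD ind (@measurable_id _ _ setT) iV L1_increment).
Qed.

Lemma mean_mul_increment : \int[P]_w (V w * D w) = 0.
Proof.
have := Rintegral_indepM mV' mD ind (@measurable_id _ _ setT) iV L1_increment.
by rewrite increment_mean mulr0.
Qed.

Lemma L1_mul_sqr_increment : L1 P (fun w => V w * D w ^+ 2).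
Proof.
exact: (L1_indepM mV' mD ind (@exprn_measurable _ setT 2) iV (proj2 L2_increment)).
Qed.

Lemma mean_mul_sqr_increment :
  \int[P]_w (V w * D w ^+ 2) = (\int[P]_w V w) * (t - s).
Proof.
have := Rintegral_indepM mV' mD ind (@exprn_measurable _ setT 2) iV (proj2 L2_increment).
by rewrite increment_variance.
Qed.

End Increment.

End BrownianIncrements.

(** * The Ito isometry *)

Section BoundedMultiplier.
Context {R : realType} {d : measure_display} {T : measurableType d}.
Variable mu : {measure set T -> \bar R}.

Definition bounded_by_some (c : T -> R) := exists M : R, forall w, `|c w| <= M.

Lemma L1_boundedM (c f : T -> R) : measurable_fun setT c -> bounded_by_some c ->
  L1 mu f -> L1 mu (fun x => c x * f x).
Proof.
move=> mc [M cM] iF; have M' := L1Zl M iF.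
apply: (L1_le _ M'); first by apply: measurable_funM => //; exact: L1_measurable iF.
by move=> x; rewrite !normrM ler_wpM2r// (le_trans (cM x))// ler_norm.
Qed.

Lemma L2_boundedM (c f : T -> R) : measurable_fun setT c -> bounded_by_some c ->
  L2 mu f -> L2 mu (fun x => c x * f x).
Proof.
move=> mc bc [mf f2]; split; first exact: measurable_funM.
have h := L1_boundedM mc bc (L1_boundedM mc bc f2).
by move: h; congr (integrable _ _ _); apply/funext => x; congr (_%:E); ring.
Qed.

Lemma bounded_by_someM (c c' : T -> R) : bounded_by_some c -> bounded_by_some c' ->
  bounded_by_some (fun x => c x * c' x).
Proof.
move=> [M cM] [M' cM']; exists (M * M') => x.
by rewrite normrM ler_pM.
Qed.

Lemma L1_sum n (f : 'I_n -> T -> R) : (forall i, L1 mu (f i)) ->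
  L1 mu (fun x => \sum_(i < n) f i x).
Proof.
move=> fi; have := @integrable_sum _ _ R mu setT measurableT _ (index_enum 'I_n) xpredT
  (fun i x => (f i x)%:E) (fun i _ => fi i).
by congr (integrable _ _ _); apply/funext => x; rewrite sumEFin.
Qed.

Lemma L2_sum n (f : 'I_n -> T -> R) : (forall i, L2 mu (f i)) ->
  L2 mu (fun x => \sum_(i < n) f i x).
Proof.
elim: n f => [f _|n IH f fi].
  under eq_fun do rewrite big_ord0; split; first exact: measurable_cst.
  by under eq_fun do rewrite expr0n; exact: integrable0.
under eq_fun do rewrite big_ord_recr.
by apply: L2D => //; exact: IH.
Qed.

Lemma Rintegral_sum n (f : 'I_n -> T -> R) : (forall i, L1 mu (f i)) ->
  \int[mu]_x (\sum_(i < n) f i x) = \sum_(i < n) \int[mu]_x f i x.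
Proof.
elim: n f => [f _|n IH f fi].
  by under eq_Rintegral do rewrite big_ord0; rewrite big_ord0 Rintegral_cst// mul0r.
under eq_Rintegral do rewrite big_ord_recr/=.
rewrite RintegralTD//; last by apply: L1_sum.
by rewrite big_ord_recr/= IH.
Qed.

End BoundedMultiplier.

(** * The isometry for single increments *)

Section ElementaryIsometry.
Context {R : realType} {d : measure_display} {Omega : measurableType d}.
Variable P : probability Omega R.
Variable F : R -> set (set Omega).
Hypothesis hF : usual_filtration P F.
Variable W : R -> Omega -> R.
Hypothesis hW : brownian_motion P F W.
Local Notation bounded := bounded_by_some.

Let sF s (s0 : 0 <= s) : sigma_algebra setT (F s) := filtration_sigma_algebra hF s0.

(** The case [s = t] is included here and below because stopping and splitting intervals can produce
    empty ones. *)
Lemma L2_increment_le s t : 0 <= s -> s <= t -> L2 P (fun w => W t w - W s w).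
Proof.
move=> s0; rewrite le_eqVlt => /predU1P[->|st]; last exact: (L2_increment hF hW s0 st).
under eq_fun do rewrite subrr; split; first exact: measurable_cst.
by under eq_fun do rewrite expr0n; exact: integrable0.
Qed.

Lemma mean_mul_increment_le s t V : 0 <= s -> s <= t -> measurable_wrt (F s) V ->
  L1 P V -> L1 P (fun w => V w * (W t w - W s w)) /\
  \int[P]_w (V w * (W t w - W s w)) = 0.
Proof.
move=> s0; rewrite le_eqVlt => /predU1P[<-|st] mV iV; last first.
  by split; [exact: (L1_mul_increment hF hW s0 st mV iV)|
    exact: (mean_mul_increment hF hW s0 st mV iV)].
have E w : V w * (W s w - W s w) = 0 by rewrite subrr mulr0.
split; first by under eq_fun do rewrite E; exact: integrable0.
by under eq_Rintegral do rewrite E; rewrite Rintegral_cst// mul0r.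
Qed.

Lemma mean_mul_sqr_increment_le s t V : 0 <= s -> s <= t -> measurable_wrt (F s) V ->
  L1 P V -> L1 P (fun w => V w * (W t w - W s w) ^+ 2) /\
  \int[P]_w (V w * (W t w - W s w) ^+ 2) = (\int[P]_w V w) * (t - s).
Proof.
move=> s0; rewrite le_eqVlt => /predU1P[<-|st] mV iV; last first.
  by split; [exact: (L1_mul_sqr_increment hF hW s0 st mV iV)|
    exact: (mean_mul_sqr_increment hF hW s0 st mV iV)].
have E w : V w * (W s w - W s w) ^+ 2 = 0 by rewrite subrr expr0n mulr0.
split; first by under eq_fun do rewrite E; exact: integrable0.
by under eq_Rintegral do rewrite E; rewrite Rintegral_cst// mul0r subrr mulr0.
Qed.

Let L1_one : L1 P (cst (1 : R)).
Proof. exact: finite_measure_integrable_cst. Qed.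

Let L2_one : L2 P (cst (1 : R)).
Proof.
split; first exact: measurable_cst.
by under eq_fun do rewrite expr1n; exact: L1_one.
Qed.

Lemma L2_L1 f : L2 P f -> L1 P f.
Proof. by move=> /(L1_L2M L2_one); under eq_fun do rewrite mul1r. Qed.

Let L1b c s : 0 <= s -> measurable_wrt (F s) c -> bounded c -> L1 P c.
Proof.
move=> s0 mc bc; have mc' := adapted_measurable hF s0 mc.
have := L1_boundedM mc' bc L1_one.
by under eq_fun do rewrite mulr1.
Qed.

Lemma measurable_wrt_W s t : 0 <= s -> s <= t -> measurable_wrt (F t) (W s).
Proof.
by move=> s0 st; apply: (measurable_wrt_mono hF s0 st); exact: (bm_adapted hW s0).
Qed.

(** The first increment is cut at [a']. Its part [A] before [a'] is known at time [a'], so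
    multiplied by the second increment it has mean zero. The part after [a'] and the second
    increment share [E], and one of them extends it by an increment [G] independent of the past at
    [m]: the term in [E^2] gives the length of the overlap and the term in [E G] has mean zero. *)
Lemma elementary_pairing_ordered a b a' b' c c' :
  0 <= a -> a <= b -> a' <= b' -> a <= a' ->
  measurable_wrt (F a) c -> measurable_wrt (F a') c' -> bounded c -> bounded c' ->
  \int[P]_w (c w * (W b w - W a w) * (c' w * (W b' w - W a' w))) =
  (\int[P]_w (c w * c' w)) * (Num.min (Num.max b a') b' - a').
Proof.
move=> a0 ab ab' aa' mc mc' bc bc'.
have a'0 : 0 <= a' := le_trans a0 aa'.
pose k w := c w * c' w.
have mk : measurable_wrt (F a') k.
  apply: (measurable_wrtM (sF a'0)) => //.
  exact: (measurable_wrt_mono hF a0 aa').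
have bk : bounded k := bounded_by_someM bc bc'.
have mk' := adapted_measurable hF a'0 mk.
pose A w := W (Num.min b a') w - W a w.
have aba : a <= Num.min b a' by rewrite le_min ab aa'.
have aba' : Num.min b a' <= a' by rewrite ge_min lexx orbT.
have LA : L2 P A := L2_increment_le a0 aba.
have mA : measurable_wrt (F a') A.
  apply: (measurable_wrtB (sF a'0)); apply: measurable_wrt_W => //.
  exact: le_trans a0 aba.
have LkA := L2_boundedM mk' bk LA.
have L1kA := L2_L1 LkA.
have [iAD eAD] := mean_mul_increment_le a'0 ab' (measurable_wrtM (sF a'0) mk mA) L1kA.
(* The overlap of the two intervals is []a', m]], and []m, q]] is what remains of the one that ends
   later. *)
pose m := Num.min (Num.max b a') b'.
pose q := Num.max (Num.max b a') b'.
have am : a' <= m by rewrite /m le_min le_max lexx orbT.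
have mq : m <= q by rewrite /m /q le_max ge_min lexx.
have m0 : 0 <= m := le_trans a'0 am.
pose E w := W m w - W a' w.
pose G w := W q w - W m w.
have [iE2 eE2] := mean_mul_sqr_increment_le a'0 am mk (L1b a'0 mk bk).
have LE : L2 P E := L2_increment_le a'0 am.
have mkm : measurable_wrt (F m) k := measurable_wrt_mono hF a'0 am mk.
have mE : measurable_wrt (F m) E.
  by apply: (measurable_wrtB (sF m0)); apply: measurable_wrt_W.
have L1kE := L2_L1 (L2_boundedM mk' bk LE).
have [iEG eEG] := mean_mul_increment_le m0 mq (measurable_wrtM (sF m0) mkm mE) L1kE.
have BD w : (W (Num.max b a') w - W a' w) * (W b' w - W a' w) = E w ^+ 2 + E w * G w.
  rewrite /E /G /m /q; case: (leP (Num.max b a') b') => _; ring.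
have split_inc w : W b w - W a w = A w + (W (Num.max b a') w - W a' w).
  rewrite /A; case: (leP b a') => _; ring.
have D w : c w * (W b w - W a w) * (c' w * (W b' w - W a' w)) =
    k w * A w * (W b' w - W a' w) + (k w * E w ^+ 2 + k w * E w * G w).
  rewrite split_inc.
  have -> : c w * (A w + (W (Num.max b a') w - W a' w)) *
    (c' w * (W b' w - W a' w)) = k w * A w * (W b' w - W a' w) +
    k w * ((W (Num.max b a') w - W a' w) * (W b' w - W a' w)).
    by rewrite /k; move: (A w) (W (Num.max b a') w) => x y; ring.
  by rewrite BD; ring.
under eq_Rintegral do rewrite D.
rewrite (RintegralTD iAD (L1D iE2 iEG)) (RintegralTD iE2 iEG).
by rewrite eAD eE2 eEG add0r addr0.
Qed.

Lemma integral_indicM_itv (a b a' b' : R) : a' <= b' -> a <= a' ->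
  \int[lebesgue_measure]_u (\1_(`]a, b]) u * \1_(`]a', b']) u) =
  Num.min (Num.max b a') b' - a' :> R.
Proof.
move=> ab' aa'.
have E (u : R) : \1_(`]a, b]) u * \1_(`]a', b']) u = \1_(`]a', Num.min (Num.max b a') b']) u :> R.
  rewrite !indicE -natrM mulnb; congr (_%:R); congr nat_of_bool.
  apply/andP/idP; rewrite !inE/= !in_itv/=.
    by move=> [/andP[_ ub] /andP[a'u ub']]; rewrite a'u/= le_min le_max ub ub'.
  move=> /andP[a'u]; rewrite le_min le_max => /andP[/orP[ub|ua'] ub'].
    by rewrite (le_lt_trans aa' a'u) ub a'u ub'.
  by move: a'u; rewrite ltNge ua'.
under eq_Rintegral do rewrite E.
rewrite /Rintegral integral_indic//= setIT lebesgue_measure_itv/= lte_fin.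
case: ltP => [//|h] /=.
have : a' <= Num.min (Num.max b a') b' by rewrite le_min le_max lexx orbT.
lra.
Qed.

Lemma elementary_pairing a b a' b' c c' :
  0 <= a -> a <= b -> 0 <= a' -> a' <= b' ->
  measurable_wrt (F a) c -> measurable_wrt (F a') c' -> bounded c -> bounded c' ->
  \int[P]_w (c w * (W b w - W a w) * (c' w * (W b' w - W a' w))) =
  (\int[P]_w (c w * c' w)) *
  \int[lebesgue_measure]_u (\1_(`]a, b]) u * \1_(`]a', b']) u).
Proof.
move=> a0 ab a'0 ab' mc mc' bc bc'; have [aa'|/ltW a'a] := leP a a'.
  by rewrite integral_indicM_itv//; exact: elementary_pairing_ordered.
under [X in _ = _ * X]eq_Rintegral do rewrite mulrC.
under [X in _ = X * _]eq_Rintegral do rewrite mulrC.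
rewrite (integral_indicM_itv _ ab a'a).
rewrite -(elementary_pairing_ordered a'0 ab' ab a'a mc' mc bc' bc).
by apply: eq_Rintegral => w _; rewrite mulrC.
Qed.

End ElementaryIsometry.

Section ProductOfFunctions.
Context {R : realType} {d1 d2 : measure_display}.
Context {T1 : measurableType d1} {T2 : measurableType d2}.
Variable m1 : {sigma_finite_measure set T1 -> \bar R}.
Variable m2 : {sigma_finite_measure set T2 -> \bar R}.
Variables (a : T1 -> R) (b : T2 -> R).
Hypotheses (ia : L1 m1 a) (ib : L1 m2 b).

Let mF : measurable_fun setT (fun z : T1 * T2 => a z.1 * b z.2).
Proof.
apply: measurable_funM.
  exact: (measurableT_comp (L1_measurable ia)).
exact: (measurableT_comp (L1_measurable ib)).
Qed.

Lemma L1_prodM : L1 (m1 \x m2)%E (fun z => a z.1 * b z.2).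
Proof.
apply: (L1_prod12 (F := fun x y => a x * b y) mF).
have h := L1Zr (\int[m2]_y `|b y|) (L1_norm ia).
apply: (@le_lt_trans _ _ (\int[m1]_x (`|a x| * \int[m2]_y `|b y|)%:E)%E).
  rewrite le_eqVlt; apply/orP; left; apply/eqP; apply: eq_integral => x _.
  rewrite EFinM (EFin_Rintegral (L1_norm ib)) -ge0_integralZl//.
    by apply: eq_integral => y _; rewrite -EFinM -normrM.
  by apply/measurable_EFinP; apply: measurableT_comp => //; exact: L1_measurable ib.
by rewrite -(EFin_Rintegral h) ltry.
Qed.

Lemma Rintegral_prodM :
  \int[(m1 \x m2)%E]_z (a z.1 * b z.2) = (\int[m1]_x a x) * (\int[m2]_y b y).
Proof.
rewrite -(Rintegral12_prod (F := fun x y => a x * b y) mF L1_prodM).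
under eq_Rintegral do rewrite (RintegralTZ _ ib).
by rewrite RintegralZr; [|exact: measurableT|exact: ia].
Qed.

End ProductOfFunctions.

(** * From simple processes to the Ito isometry *)

Section InnerProductLimit.
Context {R : realType} {d : measure_display} {T : measurableType d}.
Variable mu : {measure set T -> \bar R}.
Implicit Types a b : nat -> T -> R.

Lemma pairing_cvg0 a b : (forall n, L2 mu (a n)) -> (forall n, L2 mu (b n)) ->
  (fun n => (\int[mu]_x (a n x ^+ 2)) * (\int[mu]_x (b n x ^+ 2))) @ \oo --> (0 : R) ->
  (fun n => \int[mu]_x (a n x * b n x)) @ \oo --> (0 : R).
Proof.
move=> La Lb c0; apply/cvgrPdist_lt => e e0.
have e2 : 0 < e ^+ 2 by rewrite exprn_gt0.
move/cvgrPdist_lt : c0 => /(_ _ e2); apply: filterS => n.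
rewrite !sub0r !normrN => h.
rewrite -(ltr_pXn2r (n := 2))// ?nnegrE ?normr_ge0 ?(ltW e0)//.
rewrite real_normK ?num_real//; apply: le_lt_trans h.
by rewrite (le_trans (Cauchy_Schwarz (La n) (Lb n)))// ler_norm.
Qed.

(** The product [a b] is split as [(a - f)(b - g) + (a - f) g + f (b - g) + f g]; Cauchy-Schwarz
    makes the first three terms vanish in the limit. *)
Lemma pairing_cvg a b (f g : T -> R) : (forall n, L2 mu (a n)) -> (forall n, L2 mu (b n)) ->
  L2 mu f -> L2 mu g ->
  (fun n => \int[mu]_x ((a n x - f x) ^+ 2)) @ \oo --> (0 : R) ->
  (fun n => \int[mu]_x ((b n x - g x) ^+ 2)) @ \oo --> (0 : R) ->
  (fun n => \int[mu]_x (a n x * b n x)) @ \oo --> \int[mu]_x (f x * g x).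
Proof.
move=> La Lb Lf Lg ca cb.
have Laf n := L2B (La n) Lf; have Lbg n := L2B (Lb n) Lg.
have E n : \int[mu]_x (a n x * b n x) = \int[mu]_x ((a n x - f x) * (b n x - g x)) +
   (\int[mu]_x ((a n x - f x) * g x) + \int[mu]_x (f x * (b n x - g x))) +
   \int[mu]_x (f x * g x).
  have i1 := L1_L2M (Laf n) (Lbg n); have i2 := L1_L2M (Laf n) Lg.
  have i3 := L1_L2M Lf (Lbg n); have i4 := L1_L2M Lf Lg.
  rewrite -(RintegralTD i2 i3) -(RintegralTD i1 (L1D i2 i3)).
  rewrite -(RintegralTD (L1D i1 (L1D i2 i3)) i4).
  by apply: eq_Rintegral => x _; ring.
have c1 : (fun n => \int[mu]_x ((a n x - f x) * (b n x - g x))) @ \oo --> (0 : R).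
  apply: pairing_cvg0 => //; have := cvgM ca cb; rewrite mulr0; exact.
have c2 : (fun n => \int[mu]_x ((a n x - f x) * g x)) @ \oo --> (0 : R).
  apply: (@pairing_cvg0 (fun n x => a n x - f x) (fun=> g)) => //.
  by have := cvgM ca (cvg_cst (\int[mu]_x (g x ^+ 2))); rewrite mul0r; exact.
have c3 : (fun n => \int[mu]_x (f x * (b n x - g x))) @ \oo --> (0 : R).
  apply: (@pairing_cvg0 (fun=> f) (fun n x => b n x - g x)) => //.
  by have := cvgM (cvg_cst (\int[mu]_x (f x ^+ 2))) cb; rewrite mulr0; exact.
have := cvgD (cvgD c1 (cvgD c2 c3)) (cvg_cst (\int[mu]_x (f x * g x))).
rewrite !add0r => h.
rewrite (funext E); exact: h.
Qed.

End InnerProductLimit.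

Section ItoIsometry.
Context {R : realType} {d : measure_display} {Omega : measurableType d}.
Variable P : probability Omega R.
Variable F : R -> set (set Omega).
Hypothesis hF : usual_filtration P F.
Variable W : R -> Omega -> R.
Hypothesis hW : brownian_motion P F W.
Local Notation leb := (@lebesgue_measure R).
Local Notation M := (P \x leb)%E.
Local Notation ZT := (Omega * measurableTypeR R)%type.

Section Elementary.
Variables (S : simple_process F) (t : R).
Hypothesis t0 : 0 <= t.
Implicit Types i : 'I_(sp_size S).

Definition stopped_left i := Num.min (sp_left i) t.
Definition stopped_right i := Num.min (sp_right i) t.
(** A piece that starts after [t] is clipped to the empty interval at [t], at which time its
    coefficient need not be known; the value 0 keeps the coefficient measurable at the clipped left
    end without changing the integral. *)
Definition stopped_coef i w : R := if sp_left i <= t then sp_coef i w else 0.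
Local Notation a := stopped_left.
Local Notation b := stopped_right.
Local Notation c := stopped_coef.

Lemma stopped_left_ge0 i : 0 <= a i.
Proof. by unfold stopped_left; rewrite le_min t0 andbT; have /andP[] := sp_left_right i. Qed.

Lemma stopped_left_right i : a i <= b i.
Proof.
have /andP[_ h] := sp_left_right i.
by unfold stopped_left, stopped_right; rewrite le_min !ge_min h lexx orbT.
Qed.

Lemma stopped_coef_measurable i : measurable_wrt (F (a i)) (c i).
Proof.
unfold stopped_left, stopped_coef; case: (leP (sp_left i) t) => h.
  exact: sp_coef_measurable.
exact: (measurable_wrt_cst (filtration_sigma_algebra hF t0)).
Qed.

Lemma stopped_coef_bounded i : bounded_by_some (c i).
Proof.
unfold stopped_coef; case: (leP (sp_left i) t) => _; first exact: sp_coef_bounded.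
by exists 0 => w; rewrite normr0.
Qed.

Lemma sp_integral_stopped w :
  sp_integral W S t w = \sum_i c i w * (W (b i) w - W (a i) w).
Proof.
apply: eq_bigr => i _; unfold stopped_coef, stopped_left, stopped_right; case: leP => // tl.
have /andP[_ h] := sp_left_right i.
rewrite (min_idPr _); last by rewrite (le_trans (ltW tl)).
by rewrite subrr !mulr0.
Qed.

Lemma sp_eval_stopped u w : sp_eval S u w * \1_(`[0, t]) u =
  \sum_i c i w * \1_(`]a i, b i]) u.
Proof.
rewrite mulr_suml; apply: eq_bigr => i _; rewrite -mulrA; unfold stopped_coef, stopped_left, stopped_right.
have /andP[l0 lr] := sp_left_right i.
rewrite !indicE -natrM mulnb.
have -> : (u \in `]Num.min (sp_left i) t, Num.min (sp_right i) t]%classic) =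
   (u \in `]sp_left i, sp_right i]%classic) && (u \in `[0, t]%classic).
  apply/idP/andP; rewrite !inE/= !in_itv/=.
    case: (leP (sp_left i) t) => [lt|tl] /andP[h1]; rewrite le_min => /andP[h2 h3].
      by rewrite h1 h2 h3 (le_trans l0 (ltW h1)).
    by move: h1; rewrite ltNge h3.
  move=> [/andP[h1 h2] /andP[h3 h4]].
  by rewrite gt_min h1 le_min h2 h4.
case: leP => // tl; rewrite mul0r.
have -> : (u \in `]sp_left i, sp_right i]%classic) && (u \in `[0, t]%classic) = false.
  apply/negP => /andP[]; rewrite !inE/= !in_itv/= => /andP[h1 _] /andP[_ h2].
  by have := lt_le_trans h1 h2; rewrite ltNge (ltW tl).
by rewrite mulr0.
Qed.

Let term_L2 i : L2 P (fun w => c i w * (W (b i) w - W (a i) w)).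
Proof.
have ai := stopped_left_ge0 i.
apply: L2_boundedM; first exact: (adapted_measurable hF ai (stopped_coef_measurable i)).
  exact: stopped_coef_bounded.
exact: (L2_increment_le hF hW ai (stopped_left_right i)).
Qed.

Lemma sp_integral_L2 : L2 P (sp_integral W S t).
Proof.
have -> : sp_integral W S t = fun w => \sum_i c i w * (W (b i) w - W (a i) w).
  by apply/funext => w; exact: sp_integral_stopped.
exact: L2_sum.
Qed.

Lemma sp_integral_orthogonal V : measurable_wrt (F 0) V -> L2 P V ->
  \int[P]_w (V w * sp_integral W S t w) = 0.
Proof.
move=> mV LV.
under eq_Rintegral do rewrite sp_integral_stopped mulr_sumr.
rewrite Rintegral_sum; last by move=> i; exact: L1_L2M.
rewrite big1// => i _.
have ai := stopped_left_ge0 i.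
have mc := stopped_coef_measurable i.
have mcV := measurable_wrtM (filtration_sigma_algebra hF ai)
  (measurable_wrt_mono hF (lexx 0) ai mV) mc.
have iVc : L1 P (fun w => V w * c i w).
  have mc' := adapted_measurable hF ai mc.
  have := L2_boundedM mc' (stopped_coef_bounded i) LV.
  by move=> /L2_L1; under eq_fun do rewrite mulrC.
have [_ <-] := mean_mul_increment_le hF hW ai (stopped_left_right i) mcV iVc.
by apply: eq_Rintegral => w _; rewrite mulrA.
Qed.

Definition stopped_eval (z : ZT) := sp_eval S z.2 z.1 * \1_(`[0, t]) z.2.

Lemma stopped_evalE z : stopped_eval z = \sum_i c i z.1 * \1_(`]a i, b i]) z.2.
Proof. exact: sp_eval_stopped. Qed.

Lemma indic_itv_L1 (x y : R) : L1 leb (\1_(`]x, y]) : R -> R).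
Proof. exact: integrable_indic_itv. Qed.

Lemma indic_itvM_L1 (x y x' y' : R) :
  L1 leb (fun u => \1_(`]x, y]) u * \1_(`]x', y']) u : R).
Proof.
apply: (L1_boundedM _ _ (indic_itv_L1 x' y')); first exact: measurable_indic.
by exists 1 => u; rewrite indicE; case: (_ \in _); rewrite ?normr1 ?normr0.
Qed.

Lemma stopped_coef_L1 i : L1 P (c i).
Proof.
have ai := stopped_left_ge0 i.
have mc := adapted_measurable hF ai (stopped_coef_measurable i).
have i1 : L1 P (cst (1 : R)) by exact: finite_measure_integrable_cst.
have := L1_boundedM mc (stopped_coef_bounded i) i1.
by under eq_fun do rewrite mulr1.
Qed.

Lemma stopped_eval_L2 : L2 M stopped_eval.
Proof.
have -> : stopped_eval = fun z => \sum_i c i z.1 * \1_(`]a i, b i]) z.2.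
  by apply/funext => z; exact: stopped_evalE.
apply: (@L2_sum _ _ _ M _ (fun i z => c i z.1 * \1_(`]a i, b i]) z.2)) => i.
have ai := stopped_left_ge0 i.
have mc := adapted_measurable hF ai (stopped_coef_measurable i).
split.
  exact: L1_measurable (L1_prodM (stopped_coef_L1 i) (indic_itv_L1 (a i) (b i))).
have ic2 : L1 P (fun w => c i w ^+ 2).
  have := L1_boundedM mc (stopped_coef_bounded i) (stopped_coef_L1 i).
  by under eq_fun do rewrite -expr2.
have := L1_prodM ic2 (indic_itvM_L1 (a i) (b i) (a i) (b i)).
by congr (integrable _ _ _); apply/funext => z; congr (_%:E); rewrite -expr2 exprMn.
Qed.

End Elementary.

(** The isometry is polarized and allows two processes and two horizons: the integrand of a
    stochastic convolution changes with time, and its whole Gram kernel is wanted. *)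
Lemma sp_pairing (S S' : simple_process F) (s r : R) : 0 <= s -> 0 <= r ->
  \int[P]_w (sp_integral W S s w * sp_integral W S' r w) =
  \int[M]_z (stopped_eval S s z * stopped_eval S' r z).
Proof.
move=> s0 r0.
pose X (i : 'I_(sp_size S)) w := stopped_coef s i w * (W (stopped_right s i) w - W (stopped_left s i) w) :> R.
pose X' (j : 'I_(sp_size S')) w := stopped_coef r j w * (W (stopped_right r j) w - W (stopped_left r j) w) :> R.
have LX (T : simple_process F) q : 0 <= q -> forall i : 'I_(sp_size T), L2 P (fun w =>
    stopped_coef q i w * (W (stopped_right q i) w - W (stopped_left q i) w)).
  move=> q0 i; have ai := stopped_left_ge0 q0 i.
  apply: L2_boundedM.
  - exact: (adapted_measurable hF ai (stopped_coef_measurable q0 i)).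
  - exact: stopped_coef_bounded.
  - exact: (L2_increment_le hF hW ai (stopped_left_right q i)).
transitivity (\sum_(i < sp_size S) \sum_(j < sp_size S') \int[P]_w (X i w * X' j w)).
  transitivity (\int[P]_w (\sum_(i < sp_size S) \sum_(j < sp_size S') (X i w * X' j w))).
    apply: eq_Rintegral => w _; rewrite !sp_integral_stopped// mulr_suml.
    by apply: eq_bigr => i _; rewrite mulr_sumr.
  rewrite Rintegral_sum; last first.
    by move=> i; apply: L1_sum => j; apply: L1_L2M; exact: LX.
  apply: eq_bigr => i _; rewrite Rintegral_sum// => j.
  by apply: L1_L2M; exact: LX.
have iCC (i : 'I_(sp_size S)) (j : 'I_(sp_size S')) :
    L1 P (fun w => stopped_coef s i w * stopped_coef r j w).
  apply: L1_boundedM; last exact: stopped_coef_L1.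
    exact: (adapted_measurable hF (stopped_left_ge0 s0 i) (stopped_coef_measurable s0 i)).
  exact: stopped_coef_bounded.
pose Z (i : 'I_(sp_size S)) (j : 'I_(sp_size S')) (z : ZT) : R := stopped_coef s i z.1 * stopped_coef r j z.1 *
  (\1_(`]stopped_left s i, stopped_right s i]) z.2 *
   \1_(`]stopped_left r j, stopped_right r j]) z.2).
have iZ i j : L1 M (Z i j).
  exact: (L1_prodM (iCC i j) (indic_itvM_L1 (stopped_left s i) (stopped_right s i)
    (stopped_left r j) (stopped_right r j))).
transitivity (\int[M]_z (\sum_(i < sp_size S) \sum_(j < sp_size S') Z i j z)); last first.
  apply: eq_Rintegral => z _; rewrite !stopped_evalE// mulr_suml.
  apply: eq_bigr => i _; rewrite mulr_sumr; apply: eq_bigr => j _.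
  by rewrite /Z; ring.
rewrite Rintegral_sum; last by move=> i; apply: L1_sum.
apply: eq_bigr => i _; rewrite Rintegral_sum//; apply: eq_bigr => j _.
rewrite (Rintegral_prodM (iCC i j) (indic_itvM_L1 (stopped_left s i) (stopped_right s i)
    (stopped_left r j) (stopped_right r j))).
apply: (elementary_pairing hF hW).
- exact: stopped_left_ge0.
- exact: stopped_left_right.
- exact: stopped_left_ge0.
- exact: stopped_left_right.
- exact: stopped_coef_measurable.
- exact: stopped_coef_measurable.
- exact: stopped_coef_bounded.
- exact: stopped_coef_bounded.
Qed.

Definition stopped_integrand (t : R) (H : R -> Omega -> R) (z : ZT) :=
  H z.2 z.1 * \1_(`[0, t]) z.2.

Lemma ito_approximation (t : R) H Y : 0 <= t -> is_ito_integral P F W t H Y ->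
  L2 M (stopped_integrand t H) ->
  exists S : nat -> simple_process F,
  [/\ L2 P Y,
     (fun n => \int[P]_w ((sp_integral W (S n) t w - Y w) ^+ 2)) @ \oo --> (0 : R) &
     (fun n => \int[M]_z ((stopped_eval (S n) t z - stopped_integrand t H z) ^+ 2))
       @ \oo --> (0 : R)].
Proof.
move=> t0 [mY [S [cS cI]]] LH; exists S.
have LY : L2 P Y.
  (* One approximation at squared distance less than 1 is enough: [Y] is then a difference of two
     square-integrable variables. *)
  have [N _ HN] : \forall n \near \oo,
      (\int[P]_w ((sp_integral W (S n) t w - Y w) ^+ 2)%R%:E < 1%:E)%E.
    have l01 : (0 < 1%:E :> \bar R)%E by rewrite lte_fin.
    exact: (cI _ (open_ereal_lt' l01)).
  have h := HN N (leqnn N); have LI := sp_integral_L2 (S N) t0.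
  have LD : L2 P (fun w => sp_integral W (S N) t w - Y w).
    have mD : measurable_fun setT (fun w => sp_integral W (S N) t w - Y w).
      by apply: measurable_funB => //; case: LI.
    split => //; apply: L1_abs_lty; first exact: measurable_funX.
    under eq_integral do rewrite ger0_norm ?sqr_ge0//.
    by apply: lt_trans h _; exact: ltry.
  by have := L2B LI LD; under eq_fun do rewrite subKr.
split => //.
  exact: fine_cvg cI.
have LD n : L2 M (fun z => stopped_eval (S n) t z - stopped_integrand t H z).
  by apply: L2B => //; exact: stopped_eval_L2.
apply: (@fine_cvg _ _ _ _ (fun n =>
  (\int[M]_z ((stopped_eval (S n) t z - stopped_integrand t H z) ^+ 2)%:E)%E)).
apply: cvg_trans cS; apply: near_eq_cvg; apply: nearW => n.
have [mD _] := LD n.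
rewrite fubini_tonelli1; last 2 first.
- by apply/measurable_EFinP; exact: measurable_funX.
- by move=> z; rewrite lee_fin sqr_ge0.
apply: eq_integral => w _; rewrite /fubini_F/=.
rewrite integral_mkcond; apply: eq_integral => u _.
rewrite patchE /stopped_eval /stopped_integrand /= -mulrBl indicE.
by case: ifP => _; rewrite ?mulr1 ?mulr0// expr0n.
Qed.

Lemma ito_pairing (s r : R) H H' Y Y' : 0 <= s -> 0 <= r ->
  is_ito_integral P F W s H Y -> is_ito_integral P F W r H' Y' ->
  L2 M (stopped_integrand s H) -> L2 M (stopped_integrand r H') ->
  [/\ L2 P Y, L2 P Y' &
  \int[P]_w (Y w * Y' w) =
  \int[M]_z (stopped_integrand s H z * stopped_integrand r H' z)].
Proof.
move=> s0 r0 hY hY' LH LH'.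
have [S [LY cY cS]] := ito_approximation s0 hY LH.
have [S' [LY' cY' cS']] := ito_approximation r0 hY' LH'.
split => //.
have c1 := pairing_cvg (fun n => sp_integral_L2 (S n) s0)
  (fun n => sp_integral_L2 (S' n) r0) LY LY' cY cY'.
have c2 := pairing_cvg (fun n => stopped_eval_L2 (S n) s0)
  (fun n => stopped_eval_L2 (S' n) r0) LH LH' cS cS'.
apply: (cvg_unique _ c1); rewrite //=.
by under eq_fun do rewrite sp_pairing//.
Qed.

Lemma ito_orthogonal (t : R) H Y V : 0 <= t -> is_ito_integral P F W t H Y ->
  L2 M (stopped_integrand t H) -> measurable_wrt (F 0) V -> L2 P V ->
  \int[P]_w (V w * Y w) = 0.
Proof.
move=> t0 hY LH mV LV.
have [S [LY cY cS]] := ito_approximation t0 hY LH.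
have cV : (fun n : nat => \int[P]_w ((V w - V w) ^+ 2)) @ \oo --> (0 : R).
  under eq_fun do under eq_Rintegral do rewrite subrr expr0n.
  by rewrite Rintegral_cst// mul0r; exact: cvg_cst.
have c1 := pairing_cvg (fun n => LV) (fun n => sp_integral_L2 (S n) t0) LV LY cV cY.
apply: (cvg_unique _ c1); rewrite //=.
by under eq_fun do rewrite sp_integral_orthogonal//; exact: cvg_cst.
Qed.

End ItoIsometry.

(** * Solutions of the equation *)

Section ProcessMeasurability.
Context {R : realType} {d : measure_display} {Omega : measurableType d}.
Variable X : R -> Omega -> R.
Hypothesis mX : forall t, 0 <= t -> measurable_fun setT (X t).
Hypothesis cX : forall w, {within `[0, +oo[, continuous (X ^~ w)}.

Local Notation grid_floor n t := ((Num.truncn (t * n.+1%:R))%:R / n.+1%:R).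

Lemma grid_floor_bounds (n : nat) (t : R) : 0 <= t ->
  grid_floor n t <= t < grid_floor n t + n.+1%:R^-1.
Proof.
move=> t0; have n0 : 0 < n.+1%:R :> R by rewrite ltr0n.
have tn0 : 0 <= t * n.+1%:R by rewrite mulr_ge0.
rewrite -[X in _ + X]mul1r -mulrDl ler_pdivrMr// ltr_pdivlMr//.
by rewrite natr1; exact: truncn_itv.
Qed.

Lemma grid_floor_cvg (t : R) : 0 <= t -> (fun n => grid_floor n t) @ \oo --> t.
Proof.
move=> t0; apply: (@squeeze_cvgr _ \oo _ _ (fun n => t - n.+1%:R^-1) (fun=> t)).
- apply: nearW => n; have /andP[h1 h2] := grid_floor_bounds n t0.
  by rewrite h1 andbT lerBlDr; exact: ltW.
- have c1 : (fun=> t : R) @ \oo --> t by exact: cvg_cst.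
  by have := cvgB c1 (@cvg_harmonic R); rewrite subr0; exact.
- exact: cvg_cst.
Qed.

Lemma path_cvg (t : R) w (u : nat -> R) : 0 <= t -> (forall n, 0 <= u n) ->
  u @ \oo --> t -> (fun n => X (u n) w) @ \oo --> X t w.
Proof.
move=> t0 u0 ut; have /subspace_continuousP/(_ t) := @cX w.
rewrite /= in_itv/= andbT => /(_ t0) h.
have {}h : X s w @[s --> within `[0, +oo[%classic (nbhs t)] --> X t w by exact: h.
apply: cvg_comp h => B; rewrite /within/= => /ut[N _ HN].
exists N => // n /HN /=; apply.
by rewrite in_itv/= andbT.
Qed.

(** Continuity makes [X] the pointwise limit of the processes frozen at the left ends of a grid of
    step [1 / (n + 1)]. On each time strip such a process depends on the outcome only, through a
    single [X t]. *)
Lemma measurable_process :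
  measurable_fun setT (fun z : measurableTypeR R * Omega => ext (X ^~ z.2) z.1).
Proof.
pose D := [set z : measurableTypeR R * Omega | 0 <= z.1].
have mI (i : interval R) : measurable [set z : measurableTypeR R * Omega | z.1 \in i].
  have := @measurable_fst _ _ (measurableTypeR R) Omega measurableT _ (measurable_itv i).
  by rewrite setTI.
have DE : D = [set z | z.1 \in `[0, +oo[].
  by apply/seteqP; split=> z; rewrite /D/= in_itv/= andbT.
have mD : measurable D by rewrite DE.
have -> : (fun z : measurableTypeR R * Omega => ext (X ^~ z.2) z.1) =
    (fun z => X z.1 z.2) \_ D.
  apply/funext => z; rewrite patchE /ext.
  by case: ifPn => z0; [rewrite mem_set|rewrite memNset//=; exact/negP].
suff mXD : @measurable_fun _ default_measure_display _ R D (fun z => X z.1 z.2).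
  exact: (measurable_restrictT _ mD).1 mXD.
refine (measurable_fun_cvg (h := fun n (z : measurableTypeR R * Omega) => X (grid_floor n z.1) z.2) _ _); last first.
  move=> z z0; apply: (@path_cvg z.1 z.2 (fun n => grid_floor n z.1)) => //.
  exact: grid_floor_cvg.
move=> n; have n0 : 0 < n.+1%:R :> R by rewrite ltr0n.
pose E k := [set z : measurableTypeR R * Omega | z.1 \in `[k%:R / n.+1%:R, k.+1%:R / n.+1%:R[].
have E_floor k z : E k z -> Num.truncn (z.1 * n.+1%:R) = k.
  rewrite /E/= in_itv/= ler_pdivrMr// ltr_pdivlMr// => kz; apply/eqP.
  by rewrite truncn_eq// (le_trans _ (andP kz).1).
have -> : D = \bigcup_k E k.
  apply/seteqP; split => [z z0|z [k _]].
    exists (Num.truncn (z.1 * n.+1%:R)) => //; rewrite /E/= in_itv/=.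
    rewrite ler_pdivrMr// ltr_pdivlMr//; apply: truncn_itv.
    by rewrite mulr_ge0// ltW.
  rewrite /E/= in_itv/= => /andP[h _]; rewrite /D/=; apply: le_trans h.
  by rewrite divr_ge0.
apply/measurable_fun_bigcup => k; first exact: mI.
apply: (@eq_measurable_fun _ _ _ _ _ (fun z => X (k%:R / n.+1%:R) z.2)).
  by move=> z; rewrite inE => /E_floor ->.
apply: measurable_funTS; apply: (measurableT_comp (mX _)).
  by rewrite divr_ge0.
exact: measurable_snd.
Qed.

End ProcessMeasurability.

Section ContinuousHalfLine.
Context {R : realType}.
Implicit Types (g : R -> R) (t : R).

Lemma continuous_halflineP g : {within `[0, +oo[, continuous g} <->
  forall t, 0 <= t -> g s @[s --> within `[0, +oo[%classic (nbhs t)] --> g t.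
Proof.
split => [/subspace_continuousP cg t t0|cg].
  by apply: cg; rewrite /= in_itv/= t0.
by apply/subspace_continuousP => t; rewrite /= in_itv/= andbT; exact: cg.
Qed.

Lemma causal_continuous g : {within `[0, +oo[, continuous g} -> causal (ext g).
Proof.
move=> cg; split; last by move=> t; exact: ext_lt0.
rewrite ext_patch; apply/(measurable_restrictT _ _).1 => //.
exact: subspace_continuous_measurable_fun.
Qed.

Lemma locally_bounded_continuous g : {within `[0, +oo[, continuous g} ->
  locally_bounded (ext g).
Proof.
move=> cg T; have [T0|T0] := ltP T 0.
  by exists 0 => t tT; rewrite ext_lt0 ?normr0//; lra.
have cg' : {within `[0, T], continuous (fun t => `|g t|)}.
  move=> t; apply: continuous_comp; last exact: norm_continuous.
  apply: (continuous_subspaceW _ cg) => s /=; rewrite !in_itv/= andbT.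
  by case/andP.
have [c cT gc] := EVT_max T0 cg'; exists `|g c| => t tT.
have [t0|t0] := ltP t 0; first by rewrite ext_lt0// normr0.
by rewrite extE// gc// in_itv/= t0.
Qed.

End ContinuousHalfLine.

(** * Variation of constants along a path *)

Section VariationOfConstants.
Context {R : realType}.
Local Notation leb := (@lebesgue_measure R).
Variables (K f : R -> R) (lambda : R).
Hypotheses (lambda0 : lambda != 0) (cK : causal K) (cf : causal f).
Hypotheses (iK : L1loc K) (if_ : L1loc f).
Hypothesis fK : convolution_bounded f K.
Hypothesis resolvent_ae :
  {ae leb, forall t, f t = lambda * K t - lambda * conv f K t}.
Variables (x p m : R -> R) (x0 : R).
Hypotheses (cx : causal x) (bx : locally_bounded x).
Hypotheses (cp : causal p) (bp : locally_bounded p).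
Hypotheses (cm : causal m) (im : L1loc m).
Hypothesis iKm : forall t, L1 leb (fun s => K (t - s) * m s).

Let y t := x t - x0 * p t - conv K m t + lambda * conv K x t.

(** Here [y] is whatever the equation leaves over, and [delta - f] is applied to it. Since
    [lambda (K - f * K) = f], the sum [x + lambda K * x] becomes [x] and the drift [K * m] becomes
    [f * m / lambda]. *)
Lemma variation_of_constants t :
  x t = x0 * (p t - conv f p t) + conv f m t / lambda + (y t - conv f y t).
Proof.
have ix := L1loc_bounded cx bx.
have [i1 i2 _ e1 _] := resolvent_conv cK cf fK resolvent_ae cx ix (L1_conv_bounded t cK cx iK bx).
have [i3 i4 _ e2 _] := resolvent_conv cK cf fK resolvent_ae cm im (iKm t).
have i5 := L1_conv_bounded t cf cp if_ bp.
have -> : conv f y t = conv f x t - x0 * conv f p t - conv f (conv K m) t +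
    lambda * conv f (conv K x) t.
  transitivity (\int[leb]_s (f (t - s) * x s - x0 * (f (t - s) * p s) -
      f (t - s) * conv K m s + lambda * (f (t - s) * conv K x s))).
    apply: eq_Rintegral => s _; rewrite /y.
    by move: (conv K m s) (conv K x s) => *; ring.
  have j1 := L1Zl x0 i5; have j2 := L1Zl lambda i2.
  rewrite (RintegralTD (L1B (L1B i1 j1) i4) j2) (RintegralTB (L1B i1 j1) i4).
  by rewrite (RintegralTB i1 j1) (RintegralTZ _ i5) (RintegralTZ _ i2).
rewrite /y; move: e1 e2.
move: (conv f (conv K x) t) (conv f (conv K m) t) (conv K x t) (conv K m t).
move: (conv f x t) (conv f m t) (conv f p t) => a b c d' e g h -> ->.
by field.
Qed.

End VariationOfConstants.

(** * Convolution of a family with known inner products *)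

Section GramConvolution.
Context {R : realType} {d : measure_display} {T : measurableType d}.
Variable mu : {sigma_finite_measure set T -> \bar R}.
Local Notation leb := (@lebesgue_measure R).
Variables (Y : R -> T -> R) (a : R -> R) (t : R).
Hypothesis mY : measurable_fun setT (fun z : measurableTypeR R * T => Y z.1 z.2).
Hypothesis Y0 : forall s w, s < 0 -> Y s w = 0.
Hypothesis Y2 : forall s, L1 mu (fun w => Y s w ^+ 2).
Variable B : R.
Hypothesis YB : forall s, s <= t -> \int[mu]_w (Y s w ^+ 2) <= B.
Hypotheses (ca : causal a) (ia : L1loc a).

Let k s := (a \_ `[0, t]) (t - s).
(** Freezing the family after time [t] extends the bound [B], available only up to [t], to all
    times. Nothing is lost, as the weight [k] lives on [[0, t]]. *)
Let Yt s w := Y (Num.min s t) w.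

Let ik : L1 leb k.
Proof. exact: (L1_reflect t (L1_patch (L1loc_itv t ia))). Qed.

Let mYt : measurable_fun setT (fun z : measurableTypeR R * T => Yt z.1 z.2).
Proof.
have mm : measurable_fun setT (fun z : measurableTypeR R * T => (Num.min z.1 t, z.2) : measurableTypeR R * T).
  apply: measurable_fun_pair; last exact: measurable_snd.
  by apply: measurable_minr => //; exact: measurable_cst.
exact: (measurableT_comp mY mm).
Qed.

Let Yt2 s : L1 mu (fun w => Yt s w ^+ 2).
Proof. exact: Y2. Qed.

Let YtB s : \int[mu]_w (Yt s w ^+ 2) <= B.
Proof. by apply: YB; rewrite ge_min lexx orbT. Qed.

Lemma gram_convE w : conv a (Y ^~ w) t = \int[leb]_s (k s * Yt s w).
Proof.
apply: eq_Rintegral => s _; rewrite /k /Yt patchE.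
have [s0|s0] := ltP s 0.
  rewrite Y0// mulr0 memNset ?mul0r//= in_itv/= => /andP[_ ?].
  by move: s0; lra.
have [st|ts] := leP s t.
  rewrite mem_set// /= in_itv/=; apply/andP; split; lra.
rewrite (proj2 ca) ?mul0r ?subr_lt0// memNset ?mul0r//= in_itv/= => /andP[? _].
by move: ts; lra.
Qed.

Let L2Y s : L2 mu (Y s).
Proof. by split; [exact: (measurable_section1 mY)|exact: Y2]. Qed.

Lemma gram_conv_L2 : L2 mu (fun w => conv a (Y ^~ w) t).
Proof. by rewrite (funext gram_convE); exact: (gram_L2 mYt ik Yt2 YtB). Qed.

Lemma gram_conv_pairing V : L2 mu V ->
  \int[mu]_w (conv a (Y ^~ w) t * V w) = \int[leb]_s (k s * \int[mu]_w (Yt s w * V w)).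
Proof.
under eq_Rintegral do rewrite gram_convE.
exact: (gram_pairing mYt ik Yt2 YtB).
Qed.

Lemma gram_conv_orthogonal V : L2 mu V ->
  (forall s, s <= t -> \int[mu]_w (Y s w * V w) = 0) ->
  \int[mu]_w (conv a (Y ^~ w) t * V w) = 0.
Proof.
move=> LV YV; rewrite gram_conv_pairing//.
under eq_Rintegral do rewrite YV ?mulr0 ?ge_min ?lexx ?orbT//.
by rewrite Rintegral_cst// mul0r.
Qed.

Lemma gram_conv_norm (C : R -> R -> R) :
  (forall s r, s <= t -> r <= t -> \int[mu]_w (Y s w * Y r w) = C s r) ->
  \int[mu]_w ((Y t w - conv a (Y ^~ w) t) ^+ 2) =
  C t t - 2 * \int[leb]_s (k s * C (Num.min s t) t) +
  \int[leb]_s (k s * \int[leb]_r (k r * C (Num.min r t) (Num.min s t))).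
Proof.
move=> YC; under eq_Rintegral do rewrite gram_convE.
have mint s : Num.min s t <= t by rewrite ge_min lexx orbT.
have -> : Y t = Yt t by apply/funext => w; rewrite /Yt minxx.
have combine (x y z x' y' z' : R) : x = x' -> y = y' -> z = z' ->
    x - 2 * y + z = x' - 2 * y' + z' by move=> -> -> ->.
rewrite (gram_norm mYt ik Yt2 YtB); apply: combine.
- by rewrite YC ?minxx.
- by apply: eq_Rintegral => s _; rewrite YC ?minxx.
apply: eq_Rintegral => s _; congr (k s * _).
by apply: eq_Rintegral => r _; rewrite YC.
Qed.

End GramConvolution.

(* The norm of Y_t - (a * Y)_t only depends on the Gram kernel of Y, so that a
   stochastic family may be traded for a deterministic one. *)
Lemma gram_conv_norm_eq {R : realType} {d1 d2 : measure_display}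
    {T1 : measurableType d1} {T2 : measurableType d2}
    (mu1 : {sigma_finite_measure set T1 -> \bar R})
    (mu2 : {sigma_finite_measure set T2 -> \bar R})
    (Y1 : R -> T1 -> R) (Y2 : R -> T2 -> R) (a : R -> R) (t B : R) :
  measurable_fun setT (fun z : measurableTypeR R * T1 => Y1 z.1 z.2) ->
  measurable_fun setT (fun z : measurableTypeR R * T2 => Y2 z.1 z.2) ->
  (forall s w, s < 0 -> Y1 s w = 0) -> (forall s w, s < 0 -> Y2 s w = 0) ->
  (forall s, L1 mu1 (fun w => Y1 s w ^+ 2)) ->
  (forall s, L1 mu2 (fun w => Y2 s w ^+ 2)) ->
  (forall s, s <= t -> \int[mu1]_w (Y1 s w ^+ 2) <= B) ->
  causal a -> L1loc a ->
  (forall s r, s <= t -> r <= t ->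
    \int[mu1]_w (Y1 s w * Y1 r w) = \int[mu2]_w (Y2 s w * Y2 r w)) ->
  \int[mu1]_w ((Y1 t w - conv a (Y1 ^~ w) t) ^+ 2) =
  \int[mu2]_w ((Y2 t w - conv a (Y2 ^~ w) t) ^+ 2).
Proof.
move=> mY1 mY2 Y10 Y20 Y12 Y22 YB ca ia C12.
have YB2 s : s <= t -> \int[mu2]_w (Y2 s w ^+ 2) <= B.
  move=> st.
  by have <- : \int[mu1]_w (Y1 s w ^+ 2) = \int[mu2]_w (Y2 s w ^+ 2) := C12 s s st st; exact: YB.
rewrite (gram_conv_norm mY1 Y10 Y12 YB ca ia C12).
by rewrite (gram_conv_norm mY2 Y20 Y22 YB2 ca ia (fun _ _ _ _ => erefl)).
Qed.

(** * The integrand of the stochastic convolution and its Gram kernel *)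

Section StochasticConvolution.
Context {R : realType} {d : measure_display} {Omega : measurableType d}.
Variable P : probability Omega R.
Local Notation leb := (@lebesgue_measure R).
Local Notation M := (P \x leb)%E.
Local Notation ZT := (Omega * measurableTypeR R)%type.
Local Notation one := (ext (cst 1) : R -> R).
Variables (H : R -> Omega -> R) (q : R).
Hypothesis mH : measurable_fun setT
  (fun z : measurableTypeR R * Omega => ext (H ^~ z.2) z.1).
Hypothesis HE : forall u, 0 <= u -> (\int[P]_w (H u w ^+ 2)%:E = q%:E)%E.
Variable k : R -> R.
Hypotheses (ck : causal k) (k2 : L1loc (fun t => k t ^+ 2)).

Definition volterra_integrand (s : R) (z : ZT) : R := k (s - z.2) * ext (H ^~ z.1) z.2.

Let Hx u w := ext (H ^~ w) u.

Let mHs : measurable_fun setT (fun z : ZT => Hx z.2 z.1).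
Proof. exact: (measurable_prod_swap (F := Hx) mH). Qed.

Let mks s : measurable_fun setT (fun z : ZT => k (s - z.2)).
Proof.
apply: (measurableT_comp (proj1 ck)).
by apply: measurable_funB => //; exact: measurable_cst.
Qed.

Lemma measurable_volterra_integrand s : measurable_fun setT (volterra_integrand s).
Proof. exact: measurable_funM. Qed.

Let HxE u : (\int[P]_w (Hx u w ^+ 2)%:E = (q * one u)%:E)%E.
Proof.
have [u0|u0] := ltP u 0.
  under eq_integral do rewrite /Hx ext_lt0// expr0n/=.
  by rewrite integral0 ext_lt0// mulr0.
by under eq_integral do rewrite /Hx extE//; rewrite HE// extE// mulr1.
Qed.

Let Hx2 u : L1 P (fun w => Hx u w ^+ 2).
Proof.
apply: L1_abs_lty.
  by apply: measurable_funX; exact: (measurable_section1 mH u).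
under eq_integral do rewrite ger0_norm ?sqr_ge0//.
by rewrite HxE ltry.
Qed.

Let Hx2E u : \int[P]_w (Hx u w ^+ 2) = q * one u.
Proof. by rewrite /Rintegral HxE. Qed.

Let ik2 s : L1 leb (fun u => k (s - u) ^+ 2 * one u).
Proof.
apply: (@L1_conv_bounded _ (fun t => k t ^+ 2)) => //.
- by case: ck => mk k0; split; [exact: measurable_funX|move=> t /k0 ->; rewrite expr0n].
- exact: causal_one.
- exact: bounded_one.
Qed.

Let one2 u : one u = one u * one u.
Proof. by rewrite /ext; case: ifP => _ /=; rewrite ?mulr1 ?mulr0. Qed.

Lemma restricted_kernel_L2 s : L2 leb (fun u => k (s - u) * one u).
Proof.
split; first exact: (measurable_conv_integrand s (proj1 ck) (proj1 causal_one)).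
by have := ik2 s; under eq_fun do rewrite (one2 _) -expr2 -exprMn.
Qed.

Let ikk s r : L1 leb (fun u => k (s - u) * k (r - u) * one u).
Proof.
have := L1_L2M (restricted_kernel_L2 s) (restricted_kernel_L2 r).
by under eq_fun do rewrite mulrACA -one2.
Qed.

Lemma restricted_kernel_pairing s r : \int[leb]_u (k (s - u) * one u * (k (r - u) * one u)) =
  \int[leb]_u (k (s - u) * k (r - u) * one u).
Proof. by apply: eq_Rintegral => u _; rewrite mulrACA -one2. Qed.

Lemma volterra_integrand_L2 s : L2 M (volterra_integrand s).
Proof.
have mv := measurable_volterra_integrand s.
split => //.
apply: (L1_prod21 (F := fun w u => volterra_integrand s (w, u) ^+ 2)).
  by apply: measurable_funX; exact: mv.
have iq := L1Zl q (ik2 s).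
rewrite (_ : (\int[_]_u _)%E = (\int[leb]_u (q * (k (s - u) ^+ 2 * one u))%:E)%E).
  by rewrite -(EFin_Rintegral iq) ltry.
apply: eq_integral => u _; rewrite /volterra_integrand/=.
under eq_integral do rewrite ger0_norm ?sqr_ge0// exprMn.
have := EFin_Rintegral (L1Zl (k (s - u) ^+ 2) (Hx2 u)) => <-.
by rewrite (RintegralTZ _ (Hx2 u)) Hx2E; congr (_%:E); ring.
Qed.

(** The second moment of [H u] is the same constant [q] at every time [u >= 0], so integrating over
    the outcomes first leaves a deterministic integral. *)
Lemma volterra_integrand_pairing s r :
  \int[M]_z (volterra_integrand s z * volterra_integrand r z) =
  q * \int[leb]_u (k (s - u) * k (r - u) * one u).
Proof.
have Ls := volterra_integrand_L2 s; have Lr := volterra_integrand_L2 r.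
pose G w u := volterra_integrand s (w, u) * volterra_integrand r (w, u).
have mG : measurable_fun setT (fun z : ZT => G z.1 z.2).
  by apply: measurable_funM; exact: measurable_volterra_integrand.
have iG : L1 M (fun z : ZT => G z.1 z.2).
  have := L1_L2M Ls Lr.
  by congr (integrable _ _ _); apply/funext => -[w u].
transitivity (\int[M]_z G z.1 z.2); first by apply: eq_Rintegral => -[w u] _.
rewrite -(Rintegral12_prod mG iG) (RFubini mG iG).

rewrite -(RintegralTZ q (ikk s r)); apply: eq_Rintegral => u _.
transitivity (\int[P]_w (k (s - u) * k (r - u) * Hx u w ^+ 2)).
  by apply: eq_Rintegral => w _; rewrite /G /volterra_integrand -/(Hx u w) /Hx /=; ring.
by rewrite (RintegralTZ _ (Hx2 u)) Hx2E; ring.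
Qed.

End StochasticConvolution.

Section ConvolutionOfResolventKernel.
Context {R : realType}.
Local Notation leb := (@lebesgue_measure R).
Local Notation one := (ext (cst 1) : R -> R).
Variables (K f : R -> R) (lambda : R).
Hypotheses (lambda0 : lambda != 0) (cK : causal K) (cf : causal f).
Hypothesis fK : convolution_bounded f K.
Hypothesis f2 : L1loc (fun u => f u ^+ 2).
Hypothesis resolvent_ae :
  {ae leb, forall t, f t = lambda * K t - lambda * conv f K t}.

(** For fixed [u], convolving the translate of [K] by [u] gives the translate of [f * K]. *)
Lemma conv_restricted_kernel (b t u : R) :
  conv f (fun s => b * (K (s - u) * one u)) t = b * one u * conv f K (t - u).
Proof.
have [C HC] := fK (t - u).
have mfK := measurable_conv_integrand (t - u) (proj1 cf) (proj1 cK).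
have i : L1 leb (fun s => f (t - u - s) * K s).
  by apply: L1_abs_lty => //; apply: le_lt_trans (HC _ (lexx _)) _; exact: ltry.
rewrite /conv -(Rintegral_shift u mfK) -RintegralTZ; last exact: (L1_shift u i).
by apply: eq_Rintegral => s _; rewrite (_ : t - u - (s - u) = t - s); ring.
Qed.

(** For almost every [u] in [[0, t]] the resolvent identity at [t - u] turns the difference into
    [b f(t - u) / lambda]. *)
Lemma restricted_resolvent_norm (b t : R) :
  \int[leb]_u ((b * (K (t - u) * one u) - conv f (fun s => b * (K (s - u) * one u)) t) ^+ 2)
  = b ^+ 2 / lambda ^+ 2 * \int[leb]_(u in `[0, t]) (f u ^+ 2).
Proof.
pose g u := b * one u / lambda * f (t - u).
have co := causal_one : causal one.
have mfK := measurable_conv (proj1 cf) (proj1 cK).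
have E : {ae leb, forall u, (b * (K (t - u) * one u) -
    conv f (fun s => b * (K (s - u) * one u)) t) ^+ 2 = g u ^+ 2}.
  apply: aeS (ae_reflect t resolvent_ae) => u fu; congr (_ ^+ 2).
  rewrite conv_restricted_kernel /g fu.
  by move: (conv f K (t - u)) (one u) => x y; field.
have mg : measurable_fun setT (fun u => g u ^+ 2).
  apply: measurable_funX; apply: measurable_funM.
    by apply: measurable_funM => //; apply: measurable_funM => //; case: co.
  exact: (measurableT_comp (proj1 cf) (measurable_reflect t)).
rewrite (@ae_eq_Rintegral _ _ _ leb (fun u => (b * (K (t - u) * one u) -
    conv f (fun s => b * (K (s - u) * one u)) t) ^+ 2) (fun u => g u ^+ 2) _ mg E); last first.
  apply: measurable_funX; under eq_fun do rewrite conv_restricted_kernel.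
  apply: measurable_funB.
    apply: measurable_funM => //.
    exact: (measurable_conv_integrand t (proj1 cK) (proj1 co)).
  apply: measurable_funM; first by apply: measurable_funM => //; case: co.
  exact: (measurableT_comp mfK (measurable_reflect t)).
have cf2 : causal (fun u => f u ^+ 2).
  by case: cf => mf f0; split; [exact: measurable_funX|move=> u /f0 ->; rewrite expr0n].
have i2 := L1_conv_bounded t cf2 co f2 bounded_one.
transitivity (\int[leb]_u (b ^+ 2 / lambda ^+ 2 * (f (t - u) ^+ 2 * one u))).
  apply: eq_Rintegral => u _; rewrite /g.
  have -> : one u = one u * one u.
    by rewrite /ext; case: ifP => _ /=; rewrite ?mulr1 ?mulr0.
  have [->|->] : one u = 0 \/ one u = 1 by rewrite /ext; case: ifP => _; [right|left].
    by rewrite !(mul0r, mulr0) expr0n.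
  by field.
rewrite (RintegralTZ _ i2); congr (_ * _).
rewrite -[LHS]/(conv (fun u => f u ^+ 2) one t) convC; [|by case: cf2|by case: co].
by rewrite conv_one.
Qed.

End ConvolutionOfResolventKernel.

Section ItoVersion.
Context {R : realType} {d : measure_display} {Omega : measurableType d}.
Variable P : probability Omega R.
Variable F : R -> set (set Omega).
Hypothesis hF : usual_filtration P F.
Variable W : R -> Omega -> R.
Hypothesis hW : brownian_motion P F W.

(** An Ito integral is only determined up to a null set. This allows [ito_part], built for all times
    at once, to replace the version that the equation supplies at each single time. *)
Lemma ito_integral_ae (t : R) H Y Y' : 0 <= t -> is_ito_integral P F W t H Y ->
  measurable_fun setT Y' -> {ae P, forall w, Y w = Y' w} ->
  is_ito_integral P F W t H Y'.
Proof.
move=> t0 [mY [S [cS cI]]] mY' YY'; split => //; exists S; split => //.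
apply: cvg_trans cI; apply: near_eq_cvg; apply: nearW => n.
have [mI _] := sp_integral_L2 hF hW (S n) t0.
apply: ae_eq_integral => //.
- by apply/measurable_EFinP; apply: measurable_funX; exact: measurable_funB.
- by apply/measurable_EFinP; apply: measurable_funX; exact: measurable_funB.
- by apply: aeS YY' => w ->.
Qed.

End ItoVersion.

Lemma lipschitz_measurable {R : realType} (s : R -> R) : lipschitz s ->
  measurable_fun setT s.
Proof.
move=> [M [Mr HM]]; have {HM} HL := HM (M + 1) (ltr_pwDr ltr01 (lexx M)).
pose L := `|M| + 1; have L0 : 0 < L by rewrite ltr_wpDl.
have sL x y : `|s x - s y| <= L * `|x - y|.
  apply: le_trans (HL (x, y) (conj I I)) _.
  by rewrite ler_wpM2r// /L lerD2r ler_norm.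
apply: continuous_measurable_fun => x; apply/cvgrPdist_lt => e e0.
have /(@cvgr_dist_lt _ R _ _ _ _ x) : y @[y --> x] --> x by exact: cvg_id.
move=> /(_ (e / L) (divr_gt0 e0 L0)); apply: filterS => y xy.
by apply: le_lt_trans (sL x y) _; rewrite mulrC -ltr_pdivlMr.
Qed.

Lemma probability_ae_ex {R : realType} {d : measure_display} {T : measurableType d}
    (P : probability T R) (A : T -> Prop) : {ae P, forall w, A w} -> exists w, A w.
Proof.
move=> [B [mB PB0 sB]]; apply: contrapT => /forallNP nA.
have BT : B = setT by apply/seteqP; split => // w _; apply: sB; exact: nA.
by move: PB0; rewrite BT probability_setT => /eqP; rewrite onee_eq0.
Qed.

(** * Decomposition and moments of a solution *)

Section Solution.
Context {R : realType} {d : measure_display} {Omega : measurableType d}.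
Variable P : probability Omega R.
Variable F : R -> set (set Omega).
Hypothesis hF : usual_filtration P F.
Variable W : R -> Omega -> R.
Hypothesis hW : brownian_motion P F W.
Variables (phi K mu sigma Rl f : R -> R) (lambda : R) (X : R -> Omega -> R).
Hypothesis hphi : {within `[0, +oo[, continuous phi}.
Hypothesis hK : L2loc K.
Hypothesis lambda_gt0 : 0 < lambda.
Hypothesis hR : resolvent_assumption K lambda Rl f.
Hypothesis hsigma : lipschitz sigma.
Hypothesis hmu : L1loc mu.
Hypothesis hX0 : L2 P (X 0).
Hypothesis hX : volterra_sde_solution P F W phi K mu lambda sigma X.
Variable sbar : R.
Hypothesis hsig : forall t, 0 <= t -> ('E_P[fun w => (sigma (X t w) ^+ 2)%R] = (sbar ^+ 2)%:E)%E.

Local Notation leb := (@lebesgue_measure R).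
Local Notation one := (ext (cst 1) : R -> R).
Local Notation k := (ext K).
Local Notation fe := (ext f).
Local Notation m := (ext mu).
Local Notation p := (ext phi).
Local Notation x w := (ext (X ^~ w)).

Let lambda0 : lambda != 0. Proof. by rewrite gt_eqF. Qed.
Let ck : causal k := causal_K hK.
Let cfe : causal fe := causal_f hR.
Let ik : L1loc k := L1loc_ext (L2loc_L1loc hK).
Let f2 : L2loc f := square_integrable_L2loc (resolvent_f_L2 hR).
Let ife : L1loc fe := L1loc_ext (L2loc_L1loc f2).
Let fk : convolution_bounded fe k := convolution_bounded_fK hK hR.
Let res := resolvent_ae hK lambda_gt0 hR.
Let cm : causal m := L1loc_causal hmu.
Let im : L1loc m := L1loc_ext hmu.
Let cp : causal p := causal_continuous hphi.
Let bp : locally_bounded p := locally_bounded_continuous hphi.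
Let cX : forall w, {within `[0, +oo[, continuous (X ^~ w)}.
Proof. exact: (solution_continuous hX). Qed.
Let cx w : causal (x w). Proof. exact: causal_continuous. Qed.
Let bx w : locally_bounded (x w). Proof. exact: locally_bounded_continuous. Qed.
Let mX t : 0 <= t -> measurable_fun setT (X t) :=
  fun t0 => adapted_measurable hF t0 (solution_adapted hX t0).

Let ext_drift w : ext (fun s => mu s - lambda * X s w) = fun s => m s - lambda * x w s.
Proof.
by apply/funext => s; rewrite /ext; case: ifP => // _; rewrite mulr0 subr0.
Qed.

(** A deterministic fact drawn from a random one: the drift integral converges for almost every
    outcome, hence for some [w], and the part containing the locally bounded path of [w] converges
    by itself. *)
Lemma L1_kernel_drift t : L1 leb (fun s => k (t - s) * m s).
Proof.
have [t0|t0] := ltP t 0.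
  rewrite (_ : (fun s => (k (t - s) * m s)%:E) = cst 0%E); last first.
    apply/funext => s; rewrite (conv_supp ck cm)// /= in_itv/= => /andP[].
    by move: t0; lra.
  exact: integrable0.
have [w Hw] := probability_ae_ex (solution_drift hX t0).
move/convol_integrableE : Hw; rewrite ext_drift => i1.
have i2 := L1Zl lambda (L1_conv_bounded t ck (cx w) ik (@bx w)).
have := L1D i1 i2; congr (integrable _ _ _); apply/funext => s; congr (_%:E).
by ring.
Qed.

(** The stochastic convolution, obtained pathwise by solving the equation for it. This choice of
    versions is measurable jointly in time and outcome, which the convolution with [f] requires. *)
Definition ito_part t w :=
  x w t - X 0 w * p t - conv k m t + lambda * conv k (x w) t.
Local Notation Y := ito_part.

Let Y0 s w : s < 0 -> Y s w = 0.
Proof. by move=> s0; rewrite /Y !ext_lt0// !conv_lt0// !mulr0 !subr0 addr0. Qed.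

Let mx : measurable_fun setT (fun z : measurableTypeR R * Omega => x z.2 z.1) :=
  measurable_process mX cX.

Let mY : measurable_fun setT (fun z : measurableTypeR R * Omega => Y z.1 z.2).
Proof.
have m1 : measurable_fun setT (fun z : measurableTypeR R * Omega => X 0 z.2).
  exact: (measurableT_comp (mX (lexx 0)) measurable_snd).
have m2 : measurable_fun setT (fun z : measurableTypeR R * Omega => p z.1).
  exact: (measurableT_comp (proj1 cp) measurable_fst).
have m3 : measurable_fun setT (fun z : measurableTypeR R * Omega => conv k m z.1).
  exact: (measurableT_comp (measurable_conv (proj1 ck) (proj1 cm)) measurable_fst).
have m4 : measurable_fun setT (fun z : measurableTypeR R * Omega => conv k (x z.2) z.1).
  pose G (z : measurableTypeR R * Omega) (s : measurableTypeR R) := k (z.1 - s) * x z.2 s.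
  suff mG : measurable_fun setT
      (fun z : (measurableTypeR R * Omega) * measurableTypeR R => G z.1 z.2).
    exact: (measurable_Rintegral2 leb mG).
  have ms : measurable_fun setT (fun z : (measurableTypeR R * Omega) * measurableTypeR R =>
      (z.2, z.1.2) : measurableTypeR R * Omega).
    apply: measurable_fun_pair; first exact: measurable_snd.
    exact: (measurableT_comp measurable_snd measurable_fst).
  apply: measurable_funM; last exact: (measurableT_comp mx ms).
  apply: (measurableT_comp (proj1 ck)); apply: measurable_funB; last exact: measurable_snd.
  exact: (measurableT_comp measurable_fst measurable_fst).
apply: measurable_funD; last by apply: measurable_funM.
apply: measurable_funB => //; apply: measurable_funB => //.
exact: measurable_funM.
Qed.

Lemma ito_part_ito t : 0 <= t ->
  is_ito_integral P F W t (fun s w => K (t - s) * sigma (X s w)) (Y t).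
Proof.
move=> t0; have [Y' iY' XY'] := solution_eq hX t0.
apply: (ito_integral_ae hF hW t0 iY'); first exact: (measurable_section1 mY t).
apply: aeS XY' => w; rewrite /Y convolE ext_drift !extE// => ->.
have -> : conv k (fun s => m s - lambda * x w s) t = conv k m t - lambda * conv k (x w) t.
  have i2 := L1_conv_bounded t ck (cx w) ik (@bx w).
  rewrite -(RintegralTZ _ i2) -(RintegralTB (L1_kernel_drift t) (L1Zl lambda i2)).
  by apply: eq_Rintegral => s _; ring.
by move: (conv k m t) (conv k (x w) t) => a b; ring.
Qed.

Let sX u w := sigma (X u w).

Let msX : measurable_fun setT (fun z : measurableTypeR R * Omega => ext (sX ^~ z.2) z.1).
Proof.
have -> : (fun z : measurableTypeR R * Omega => ext (sX ^~ z.2) z.1) =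
    fun z => sigma (x z.2 z.1) * one z.1.
  by apply/funext => z; rewrite /ext; case: ifP; rewrite ?mulr1 ?mulr0.
apply: measurable_funM; last exact: (measurableT_comp (proj1 causal_one) measurable_fst).
exact: (measurableT_comp (lipschitz_measurable hsigma) mx).
Qed.

Let sXE u : 0 <= u -> (\int[P]_w (sX u w ^+ 2)%:E = (sbar ^+ 2)%:E)%E.
Proof. by move=> /hsig; rewrite unlock. Qed.

Let k2 : L1loc (fun t => k t ^+ 2) := L2loc_ext hK.

Let stoppedE t : stopped_integrand t (fun s w => K (t - s) * sigma (X s w)) =
  volterra_integrand sX k t.
Proof.
apply/funext => -[w u]; rewrite /stopped_integrand /volterra_integrand/= indicE.
have [u0|u0] := ltP u 0.
  by rewrite (ext_lt0 _ u0) memNset ?mulr0//= in_itv/= leNgt u0.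
rewrite (extE _ u0); have [ut|ut] := leP u t.
  by rewrite mem_set ?mulr1 ?extE ?subr_ge0//= in_itv/= u0.
rewrite memNset ?mulr0; last by rewrite /= in_itv/= u0/=; apply/negP; rewrite -ltNge.
by rewrite (ext_lt0 K) ?mul0r// subr_lt0.
Qed.

Let vL2 t := volterra_integrand_L2 msX sXE ck k2 t.

Lemma ito_part_L2 t : L2 P (Y t).
Proof.
have [t0|t0] := ltP t 0.
  by rewrite (_ : Y t = cst 0); [split; [exact: measurable_cst|]|apply/funext => w; exact: Y0];
    under eq_fun do rewrite expr0n; exact: integrable0.
have i := ito_part_ito t0; have v := vL2 t; rewrite -stoppedE in v.
by have [] := ito_pairing hF hW t0 t0 i i v v.
Qed.

Lemma ito_part_pairing s r : \int[P]_w (Y s w * Y r w) =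
  \int[leb]_u (sbar * (k (s - u) * one u) * (sbar * (k (r - u) * one u))).
Proof.
have zero t u : t < 0 -> k (t - u) * one u = 0.
  by move=> t0; apply: (conv_supp ck causal_one); rewrite /= in_itv/= => /andP[]; lra.
have [s0|s0] := ltP s 0.
  under eq_Rintegral do rewrite Y0// mul0r.
  under [RHS]eq_Rintegral do rewrite zero// mulr0 mul0r.
  by rewrite !Rintegral_cst// !mul0r.
have [r0|r0] := ltP r 0.
  under eq_Rintegral do rewrite (@Y0 r)// mulr0.
  under [RHS]eq_Rintegral do rewrite (@zero r)// !mulr0.
  by rewrite !Rintegral_cst// !mul0r.
have is' := ito_part_ito s0; have ir := ito_part_ito r0.
have vs := vL2 s; have vr := vL2 r; rewrite -stoppedE in vs; rewrite -stoppedE in vr.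
have [_ _ ->] := ito_pairing hF hW s0 r0 is' ir vs vr.
rewrite !stoppedE (volterra_integrand_pairing msX sXE ck k2).
rewrite -(restricted_kernel_pairing k s r).
have i := L1_L2M (restricted_kernel_L2 ck k2 s) (restricted_kernel_L2 ck k2 r).
rewrite -(RintegralTZ _ i); apply: eq_Rintegral => u _; rewrite expr2.
by move: (k (s - u) * one u) (k (r - u) * one u) => a b; ring.
Qed.

Lemma ito_part_orthogonal t V : measurable_wrt (F 0) V -> L2 P V ->
  \int[P]_w (Y t w * V w) = 0.
Proof.
move=> mV LV; have [t0|t0] := ltP t 0.
  by under eq_Rintegral do rewrite Y0// mul0r; rewrite Rintegral_cst// mul0r.
have v := vL2 t; rewrite -stoppedE in v.
rewrite -(ito_orthogonal hF hW t0 (ito_part_ito t0) v mV LV).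
by apply: eq_Rintegral => w _; rewrite mulrC.
Qed.

Definition residual t w := Y t w - conv fe (Y ^~ w) t.
Local Notation Z := residual.

Lemma square_resolvent_integral t :
  \int[leb]_(s in `[0, t]) (fe s ^+ 2) = \int[leb]_(s in `[0, t]) (f s ^+ 2).
Proof.
by apply: eq_Rintegral => s; rewrite inE/= in_itv/= => /andP[s0 _]; rewrite extE.
Qed.

Let ck2 : causal (fun u => k u ^+ 2).
Proof.
by case: ck => mk k0; split; [exact: measurable_funX|move=> u /k0 ->; rewrite expr0n].
Qed.

Let Yleb s u := sbar * (k (s - u) * one u).

Let mYleb : measurable_fun setT (fun z : measurableTypeR R * measurableTypeR R => Yleb z.1 z.2).
Proof.
apply: measurable_funM; first exact: measurable_cst.
exact: measurable_conv_kernel (proj1 ck) (proj1 causal_one).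
Qed.

Let Yleb0 s u : s < 0 -> Yleb s u = 0.
Proof.
move=> s0; rewrite /Yleb (conv_supp ck causal_one) ?mulr0//= in_itv/= => /andP[].
by move: s0; lra.
Qed.

Let Yleb2 s : L1 leb (fun u => Yleb s u ^+ 2).
Proof. exact: (proj2 (L2Z sbar (restricted_kernel_L2 ck k2 s))). Qed.

(** The second moment at time [s] is [sbar^2] times the integral of [K^2] over [[0, s]], controlled
    up to [t] by local square integrability. *)
Let ito_part_bound t : exists B, forall s, s <= t -> \int[P]_w (Y s w ^+ 2) <= B.
Proof.
have co := causal_one : causal one.
have [C HC] := convolution_bounded_bounded co ck2 bounded_one k2 t.
exists (sbar ^+ 2 * C) => s st.
have -> : \int[P]_w (Y s w ^+ 2) = \int[leb]_u (Yleb s u ^+ 2) := ito_part_pairing s s.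
have i := restricted_kernel_L2 ck k2 s.
under eq_Rintegral do rewrite exprMn.
rewrite (RintegralTZ _ (proj2 i)) ler_wpM2l ?sqr_ge0//.
have -> : \int[leb]_u ((k (s - u) * one u) ^+ 2) = conv one (fun u => k u ^+ 2) s.
  rewrite convC; [|by case: co|by case: ck2].
  apply: eq_Rintegral => u _; rewrite /ext exprMn.
  by congr (_ * _); case: ifP => _ /=; rewrite ?expr1n ?expr0n.
have i1 : L1 leb (fun u => one (s - u) * k u ^+ 2).
  exact: L1_convC (L1_conv_bounded s ck2 co k2 bounded_one).
rewrite -lee_fin EFin_Rintegral//; apply: le_trans (HC s st).
apply: ge0_le_integral => //.
- move=> u _; rewrite lee_fin mulr_ge0 ?sqr_ge0// /ext.
  by case: ifP.
- by apply/measurable_EFinP; exact: L1_measurable i1.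
- by apply/measurable_EFinP; apply: measurableT_comp => //; exact: L1_measurable i1.
- by move=> u _; rewrite lee_fin ler_norm.
Qed.

Lemma residual_L2 t : L2 P (Z t).
Proof.
have [B YB] := ito_part_bound t.
apply: (L2B (ito_part_L2 t)).
exact: (gram_conv_L2 mY Y0 (fun s => proj2 (ito_part_L2 s)) YB cfe ife).
Qed.

(** Used with [V = 1], for the mean of the residual, and with [V = X 0], to remove the cross term
    from the variance. *)
Lemma residual_orthogonal t V : measurable_wrt (F 0) V -> L2 P V ->
  \int[P]_w (Z t w * V w) = 0.
Proof.
move=> mV LV; have [B YB] := ito_part_bound t.
have Y2 s := proj2 (ito_part_L2 s).
have LU := gram_conv_L2 mY Y0 Y2 YB cfe ife.
under eq_Rintegral do rewrite /Z mulrBl.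
rewrite (RintegralTB (L1_L2M (ito_part_L2 t) LV) (L1_L2M LU LV)).
rewrite ito_part_orthogonal// sub0r.
rewrite (gram_conv_orthogonal mY Y0 Y2 YB cfe ife LV) ?oppr0// => s _.
exact: ito_part_orthogonal.
Qed.

Lemma residual_norm t : \int[P]_w (Z t w ^+ 2) =
  sbar ^+ 2 / lambda ^+ 2 * \int[leb]_(s in `[0, t]) (f s ^+ 2).
Proof.
have [B YB] := ito_part_bound t.
have Y2 s := proj2 (ito_part_L2 s).
have f2' : L1loc (fun u => fe u ^+ 2) := L2loc_ext f2.
rewrite -square_resolvent_integral -(restricted_resolvent_norm lambda0 ck cfe fk f2' res).
exact: (gram_conv_norm_eq mY mYleb Y0 Yleb0 Y2 Yleb2 YB cfe ife
  (fun s r _ _ => ito_part_pairing s r)).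
Qed.

Definition stationarity_profile t := p t - conv fe p t.
Local Notation psi := stationarity_profile.

Lemma solution_decomposition t w : 0 <= t ->
  X t w = X 0 w * psi t + conv fe m t / lambda + Z t w.
Proof.
move=> t0; rewrite -(extE (X ^~ w) t0).
exact: (variation_of_constants lambda0 ck cfe ik ife fk res (X 0 w) (cx w)
  (@bx w) cp bp cm im L1_kernel_drift t).
Qed.

Let L2cst (c : R) : L2 P (cst c).
Proof. by split; [exact: measurable_cst|exact: (finite_measure_integrable_cst P (c ^+ 2))]. Qed.

Lemma solution_L2 t : 0 <= t -> L2 P (X t).
Proof.
move=> t0; rewrite (funext (fun w => solution_decomposition w t0)).
apply: L2D; last exact: residual_L2.
apply: L2D; last exact: L2cst.
by under eq_fun do rewrite mulrC; exact: L2Z.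
Qed.

Let F0_cst : measurable_wrt (F 0) (cst 1 : Omega -> R).
Proof. exact: (measurable_wrt_cst (filtration_sigma_algebra hF (lexx 0))). Qed.

Let F0_X : measurable_wrt (F 0) (X 0).
Proof. exact: (solution_adapted hX (lexx 0)). Qed.

Lemma residual_mean t : \int[P]_w Z t w = 0.
Proof.
rewrite -[RHS](residual_orthogonal t F0_cst (L2cst 1)).
by apply: eq_Rintegral => w _; rewrite mulr1.
Qed.

Lemma solution_mean t : 0 <= t ->
  \int[P]_w X t w = \int[P]_w X 0 w * psi t + conv fe m t / lambda.
Proof.
move=> t0; under eq_Rintegral do rewrite solution_decomposition// [X 0 _ * _]mulrC.
have i0 := L1Zl (psi t) (L2_L1 hX0); have i1 := L2_L1 (L2cst (conv fe m t / lambda)).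
rewrite (RintegralTD (L1D i0 i1) (L2_L1 (residual_L2 t))) residual_mean addr0.
rewrite (RintegralTD i0 i1) (RintegralTZ _ (L2_L1 hX0)) Rintegral_cst//.
congr (_ + _); first exact: mulrC.
by have h := congr1 fine (probability_setT P); rewrite -[RHS]mulr1; congr (_ * _); exact: h.
Qed.

(** Since the mean is [m0] at both times, the deterministic terms cancel and
    [X_t - m0 = psi(t) (X_0 - m0) + Z_t], a sum of two orthogonal variables. *)
Lemma solution_variance t m0 : 0 <= t -> \int[P]_w X 0 w = m0 -> \int[P]_w X t w = m0 ->
  \int[P]_w ((X t w - m0) ^+ 2) = psi t ^+ 2 * \int[P]_w ((X 0 w - m0) ^+ 2) +
    sbar ^+ 2 / lambda ^+ 2 * \int[leb]_(s in `[0, t]) (f s ^+ 2).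
Proof.
move=> t0 E0 Et; rewrite -residual_norm.
have L0 : L2 P (fun w => X 0 w - m0) := L2B hX0 (L2cst m0).
have LZ := residual_L2 t.
have E w : X t w - m0 = psi t * (X 0 w - m0) + Z t w.
  rewrite solution_decomposition// -[in LHS]Et solution_mean// E0.
  by move: (conv fe m t / lambda) (psi t) (Z t w) => a b c; ring.
have LP := L2Z (psi t) L0.
under eq_Rintegral do rewrite E sqrrD exprMn.
have iPZ := L1Zl 2 (L1_L2M LP LZ).
have -> : (fun w => psi t ^+ 2 * (X 0 w - m0) ^+ 2 + psi t * (X 0 w - m0) * Z t w *+ 2 + Z t w ^+ 2)
  = (fun w => psi t ^+ 2 * (X 0 w - m0) ^+ 2 + 2 * (psi t * (X 0 w - m0) * Z t w) + Z t w ^+ 2).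
  by apply/funext => w; rewrite mulr_natl.
have i1 := L1Zl (psi t ^+ 2) (proj2 L0).
rewrite (RintegralTD (L1D i1 iPZ) (proj2 LZ)) (RintegralTD i1 iPZ).
rewrite (RintegralTZ _ (proj2 L0)) (RintegralTZ _ (L1_L2M LP LZ)).
suff -> : \int[P]_w (psi t * (X 0 w - m0) * Z t w) = 0 by rewrite mulr0 addr0.
have i2 := L1_L2M LZ hX0; have i3 := L1_L2M LZ (L2cst m0).
transitivity (\int[P]_w (psi t * (Z t w * X 0 w - Z t w * m0))).
  by apply: eq_Rintegral => w _; ring.
rewrite (RintegralTZ _ (L1B i2 i3)) (RintegralTB i2 i3).
rewrite (residual_orthogonal t F0_X hX0) sub0r.
under eq_Rintegral do rewrite mulrC.
by rewrite (RintegralTZ _ (L2_L1 LZ)) residual_mean mulr0 oppr0 mulr0.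
Qed.

End Solution.

(** * The stationarity profile *)

Section ContinuousConvolution.
Context {R : realType}.
Local Notation leb := (@lebesgue_measure R).
Implicit Types (g q : R -> R) (t T : R).

Lemma continuous_primitive g : causal g -> L1loc g ->
  continuous (fun t => \int[leb]_(s in `[0, t]) g s).
Proof.
move=> cg ig t0.
(* The starting point [a] is negative, where [g] vanishes, so the primitive from [a] coincides with
   the one from 0; moreover [t0] is interior to [[a, b]]. *)
pose a := Num.min t0 0 - 1; pose b := Num.max t0 0 + 1.
have [a0 at0] : a < 0 /\ a < t0.
  by rewrite /a; case: (leP t0 0) => ?; split; lra.
have [b0 bt0] : 0 < b /\ t0 < b.
  by rewrite /b; case: (leP t0 0) => ?; split; lra.
have iab : leb.-integrable `[a, b] (EFin \o g).
  apply: integrableS (causal_integrable_Ny b cg ig) => // t /=.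
  by rewrite !in_itv/= => /andP[].
have := parameterized_integral_continuous (ltW (lt_trans a0 b0)) iab.
move=> /(continuous_within_itvP _ (lt_trans a0 b0))[+ _ _].
move=> /(_ t0); rewrite in_itv/= at0 bt0 => /(_ isT).
have E t : a < t -> parameterized_integral leb a t g = \int[leb]_(s in `[0, t]) g s.
  move=> ta; rewrite /parameterized_integral Rintegral_mkcond [RHS]Rintegral_mkcond.
  apply: eq_Rintegral => s _; rewrite !patchE.
  have [s0|s0] := ltP s 0; first by rewrite (proj2 cg)//; case: ifP; case: ifP.
  by congr (if _ then _ else _); apply/idP/idP; rewrite !inE/= !in_itv/= s0 /= ?(lt_le_trans a0)// (ltW (lt_le_trans a0 s0)).
rewrite /continuous_at E// => h; apply: cvg_trans h; apply: near_eq_cvg.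
near=> t; rewrite E//; near: t; exact: lt_nbhsr.
Unshelve. all: by end_near. Qed.

Section WithRespectToMeasure.
Variable nu : {measure set (measurableTypeR R) -> \bar R}.
Variables (q b : R -> R).
Hypothesis cq : continuous q.
Hypothesis q0 : forall t, t < 0 -> q t = 0.
Hypothesis bq : locally_bounded q.
Hypothesis ib : forall T, nu.-integrable `[0, T] (EFin \o b).

Lemma conv_integrable_continuous t T :
  nu.-integrable `[0, T] (EFin \o (fun s => q (t - s) * b s)).
Proof.
have [C qC] := bq t.
have mI : measurable (`[0, T]%classic : set (measurableTypeR R)) by exact: measurable_itv.
have iC := integrable_EFinZ C mI (integrable_norm (ib T)).
apply: (le_integrable mI _ _ iC).
  apply/measurable_EFinP; apply: measurable_funM.
    apply: measurable_funTS; apply: (measurableT_comp (continuous_measurable_fun cq)).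
    exact: measurable_reflect.
  by apply/measurable_EFinP; exact: measurable_int (ib T).
move=> s; rewrite /= in_itv/= => /andP[s0 _].
rewrite lee_fin !normrM normr_id ler_wpM2r//.
by rewrite (le_trans (qC _ _)) ?ler_norm//; lra.
Qed.

Lemma conv_itv t T : t <= T ->
  \int[nu]_(s in `[0, t]) (q (t - s) * b s) = \int[nu]_(s in `[0, T]) (q (t - s) * b s).
Proof.
move=> tT; rewrite Rintegral_mkcond [RHS]Rintegral_mkcond.
apply: eq_Rintegral => s _; rewrite !patchE.
have [st|ts] := leP s t; last first.
  by rewrite q0 ?subr_lt0// mul0r; case: ifP; case: ifP.
congr (if _ then _ else _); apply/idP/idP; rewrite !inE/= !in_itv/= st ?(le_trans st)//.
Qed.

Lemma continuous_conv_measure :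
  continuous (fun t => \int[nu]_(s in `[0, t]) (q (t - s) * b s)).
Proof.
move=> t0; pose T := `|t0| + 1.
have tT : t0 < T by rewrite /T (le_lt_trans (ler_norm _))// ltrDl.
have Tt : - T < t0 by rewrite /T ltrNl (le_lt_trans (ler_norm _))// normrN ltrDl.
have mI : measurable (`[0, T]%classic : set (measurableTypeR R)) by exact: measurable_itv.
have [C qC] := bq T.
have C0 : 0 <= C by apply: le_trans (qC T (lexx T)).
pose G (t : R) (s : measurableTypeR R) := q (t - s) * b s.
have := @continuity_under_integral R _ (measurableTypeR R) nu G `[0, T]%classic mI (- T) T
  (fun t _ => @conv_integrable_continuous t T).
have iC := integrable_EFinZ C mI (integrable_norm (ib T)).
have cG : {ae nu, forall y, `[0, T]%classic y -> {in `]- T, T[%classic, continuous (G ^~ y)}}.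
  apply: aeW => s _ t _; apply: cvgM; last exact: cvg_cst.
  apply: (@cvg_comp _ _ _ (fun t => t - s) q); last exact: cq.
  by apply: cvgB; [exact: cvg_id|exact: cvg_cst].
move=> /(_ cG _ iC) h.
have {}h : {in `]- T, T[%classic, continuous (fun t => \int[nu]_(s in `[0, T]) G t s)}.
  apply: h => t; rewrite /= in_itv/= => /andP[_ tT']; apply: aeW => s.
  rewrite /= in_itv/= => /andP[s0 _].
  by rewrite /G normrM ler_wpM2r// qC//; lra.
have /h : t0 \in `]- T, T[%classic by rewrite inE/= in_itv/= Tt.
rewrite /continuous_at/= (conv_itv (ltW tT)) => {}h.
apply: cvg_trans h; apply: near_eq_cvg.
near=> t; rewrite (@conv_itv t T)//; apply: ltW; near: t; exact: lt_nbhsl.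
Unshelve. all: by end_near. Qed.

End WithRespectToMeasure.

Lemma continuous_conv q a : continuous q -> causal q -> locally_bounded q ->
  causal a -> L1loc a -> continuous (conv q a).
Proof.
move=> cq [mq q0] bq ca ia.
have -> : conv q a = fun t => \int[leb]_(s in `[0, t]) (q (t - s) * a s).
  apply/funext => t; rewrite (Rintegral_supp leb)// => s.
  by apply: conv_supp => //; split.
by apply: continuous_conv_measure => // T; exact: L1loc_itv.
Qed.

(** The extension by zero jumps at 0 by [phi 0]. Subtracting the jump leaves
    [phi (max t 0) - phi 0], which is continuous on the whole line. *)
Lemma continuous_shifted_ext (phi : R -> R) : {within `[0, +oo[, continuous phi} ->
  continuous (fun t => ext phi t - ext (cst (phi 0)) t).
Proof.
move=> /continuous_halflineP cphi t.
have -> : (fun t => ext phi t - ext (cst (phi 0)) t) = fun t => phi (Num.max t 0) - phi 0.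
  apply/funext => s; rewrite /ext; case: (leP 0 s) => s0 //.
  by rewrite !subrr.
apply: cvgB; last exact: cvg_cst.
have t0 : 0 <= Num.max t 0 by rewrite le_max lexx orbT.
apply: (@cvg_comp _ _ _ (fun s => Num.max s 0) phi _ _ _ _ (cphi _ t0)) => B hB.
have cm : (fun s => Num.max s 0) @ t --> Num.max t 0.
  by apply: continuous_max; [exact: cvg_id|exact: cvg_cst].
have : \forall s \near t, `[0, +oo[%classic (Num.max s 0) -> B (Num.max s 0).
  exact: (cm (fun x => `[0, +oo[%classic x -> B x) hB).
by apply: filterS => s; apply; rewrite /= in_itv/= andbT le_max lexx orbT.
Qed.

End ContinuousConvolution.

(** * Continuity and sign of the profile *)

Section Profile.
Context {R : realType}.
Local Notation leb := (@lebesgue_measure R).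
Local Notation one := (ext (cst 1) : R -> R).
Variables (phi f : R -> R).
Hypothesis hphi : {within `[0, +oo[, continuous phi}.
Hypothesis phi0 : phi 0 = 1.
Hypothesis if_ : L1loc f.

(** With [q = ext phi - one] continuous, the difference is [q] minus the primitive of [f] minus
    [q * f]: the jump of [phi] at 0 contributes only through that primitive. *)
Lemma continuous_profile : continuous (fun t => stationarity_profile phi f t - one t).
Proof.
have cq := continuous_shifted_ext hphi; rewrite phi0 in cq.
pose q t := ext phi t - one t; rewrite -/q in cq.
have cp := causal_continuous hphi; have bp := locally_bounded_continuous hphi.
have co := causal_one : causal one.
have caq : causal q.
  split; first by apply: measurable_funB; [case: cp|case: co].
  by move=> t t0; rewrite /q !ext_lt0 ?subrr.
have bq : locally_bounded q.
  move=> T; have [C pC] := bp T; have [C' oC] := @bounded_one R T.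
  exists (C + C') => t tT; apply: le_trans (ler_normB _ _) _.
  by apply: lerD; [exact: pC|exact: oC].
have cf := L1loc_causal if_; have ife := L1loc_ext if_.
have i1 t := L1_conv_bounded t cf co ife bounded_one.
have i2 t := L1_conv_bounded t cf caq ife bq.
have -> : (fun t => stationarity_profile phi f t - one t) =
    fun t => q t - \int[leb]_(s in `[0, t]) ext f s - conv q (ext f) t.
  apply/funext => t; rewrite -(conv_one t cf).
  rewrite (convC t (proj1 co) (proj1 cf)) (convC t (proj1 caq) (proj1 cf)).
  rewrite /stationarity_profile.
  have -> : conv (ext f) (ext phi) t = conv (ext f) one t + conv (ext f) q t.
    rewrite -(RintegralTD (i1 t) (i2 t)); apply: eq_Rintegral => s _.
    by rewrite /q; ring.
  by rewrite /q; move: (conv (ext f) one t) (conv (ext f) q t) => a b; ring.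
move=> t; apply: cvgB; last exact: continuous_conv.
by apply: cvgB; [exact: cq|exact: continuous_primitive].
Qed.

Lemma profile0 : stationarity_profile phi f 0 = 1.
Proof.
rewrite /stationarity_profile extE// phi0 -convolE /convol set_itv1.
by rewrite Rintegral_set1 subr0.
Qed.

(** The profile equals 1 at time 0 and cannot vanish, its square being positive; by the intermediate
    value theorem it stays positive, which selects the root [h]. *)
Lemma profile_eq_sqr (h : R -> R) : (forall t, 0 <= t -> 0 < h t) ->
  (forall t, 0 <= t -> stationarity_profile phi f t ^+ 2 = h t ^+ 2) ->
  forall t, 0 <= t -> stationarity_profile phi f t = h t.
Proof.
move=> h0 psi2 t t0; pose g s := 1 + (stationarity_profile phi f s - one s).
have gE s : 0 <= s -> g s = stationarity_profile phi f s.
  by move=> s0; rewrite /g extE//=; lra.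
have cg : continuous g.
  by move=> s; apply: cvgD; [exact: cvg_cst|exact: continuous_profile].
have g0 : 0 < g t.
  rewrite ltNge; apply/negP => gt0.
  have [] := @IVT R g 0 t 0 t0 (continuous_subspaceT cg).
    by rewrite (gE 0)// profile0 min_r ?max_l//= ?gt0//= ?(le_trans gt0)//.
  move=> s; rewrite in_itv/= => /andP[s0 _] gs0.
  have := psi2 s s0; rewrite -gE// gs0 expr0n/= => /esym/eqP.
  by rewrite sqrf_eq0 gt_eqF// h0.
have := psi2 t t0; rewrite -gE// => /eqP; rewrite eqf_sqr => /orP[/eqP//|/eqP E].
by have := h0 t t0; move: g0; rewrite E; lra.
Qed.

End Profile.

(** * Properties of the function [h] *)

Section StationaryScale.
Context {R : realType}.
Local Notation leb := (@lebesgue_measure R).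
Variables (f : R -> R) (lambda c : R).
Hypothesis f2 : square_integrable `[0, +oo[ f.
Hypothesis f0 : ae_halfline (fun t => f t != 0).
Hypothesis lambda0 : 0 < lambda.
Hypothesis cS : (lambda ^+ 2)^-1 * \int[leb]_(s in `[0, +oo[) (f s ^+ 2) <= c.

Let J t := \int[leb]_(s in `[0, t]) (f s ^+ 2).
Let S := \int[leb]_(s in `[0, +oo[) (f s ^+ 2).

Lemma integral_sqr_gt0 (i : interval R) : [set` i] `<=` `[0, +oo[ ->
  (0 < leb [set` i])%E -> 0 < \int[leb]_(s in [set` i]) (f s ^+ 2).
Proof.
move=> i0 li; rewrite lt_neqAle; apply/andP; split; last first.
  by apply: Rintegral_ge0 => s _; exact: sqr_ge0.
rewrite eq_sym; apply/negP => /eqP; rewrite Rintegral_mkcond => E.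
have mi : measurable [set` i] by exact: measurable_itv.
have ii : leb.-integrable [set` i] (EFin \o (fun s => f s ^+ 2)).
  exact: integrableS (proj2 f2).
have iP : L1 leb ((fun s => f s ^+ 2) \_ [set` i]).
  by move: ii; rewrite integrable_mkcond// restrict_EFin.
have P0 s : 0 <= ((fun s => f s ^+ 2) \_ [set` i]) s.
  by rewrite patchE; case: ifP => // _; exact: sqr_ge0.
have ae0 := Rintegral0_ae iP P0 E.
suff : leb.-negligible [set` i].
  move=> /(negligibleP leb mi).1 l0; have := li.
  by rewrite [X in (_ < X)%E](_ : _ = 0%E) ?ltxx//; exact: l0.
have H : {ae leb, forall s, ~ [set` i] s}.
  move: f0; rewrite /ae_halfline; apply: aeS2 ae0 => s; rewrite patchE => + fs si.
  rewrite mem_set// => /eqP; rewrite sqrf_eq0; apply/negP/fs.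
  by have := i0 _ si; rewrite /= in_itv/= andbT.
by apply: negligibleS H => s si /(_ si).
Qed.

(** The inequality is strict because [f^2] has positive integral over every tail. It keeps [h]
    positive even in the limiting case where [c lambda^2] equals the whole integral. *)
Lemma integral_sqr_lt t : 0 <= t -> J t < S.
Proof.
move=> t0; rewrite -subr_gt0 /S /J Rintegral_itvB//; last exact: (proj2 f2).
apply: integral_sqr_gt0; last by rewrite lebesgue_measure_itv/= ltry lt0y.
by move=> s; rewrite /= !in_itv/= !andbT => /ltW; exact: le_trans.
Qed.

Lemma integral_sqr_pos t : 0 < t -> 0 < J t.
Proof.
move=> t0; apply: integral_sqr_gt0; last first.
  by rewrite lebesgue_measure_itv/= lte_fin t0 -EFinD lte_fin subr0.
by move=> s; rewrite /= !in_itv/= andbT => /andP[].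
Qed.

Let S0 : 0 < S.
Proof.
apply: le_lt_trans (integral_sqr_lt (lexx 0)).
by apply: Rintegral_ge0 => s _; exact: sqr_ge0.
Qed.

Let C := (c * lambda ^+ 2)^-1.

Let l2 : 0 < lambda ^+ 2. Proof. exact: exprn_gt0. Qed.

Lemma scale_gt0 : 0 < c.
Proof. by apply: lt_le_trans cS; rewrite mulr_gt0// invr_gt0. Qed.

Let C0 : 0 < C. Proof. by rewrite invr_gt0 mulr_gt0// scale_gt0. Qed.

Let CS : C * S <= 1.
Proof.
rewrite mulrC ler_pdivrMr ?mul1r; last by rewrite mulr_gt0// scale_gt0.
by move: cS; rewrite mulrC ler_pdivrMr.
Qed.

Lemma hfun_sqr t : 0 <= t -> hfun f lambda c t ^+ 2 = 1 - C * J t.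
Proof.
move=> t0; rewrite sqr_sqrtr// subr_ge0; apply: le_trans CS.
by rewrite ler_wpM2l ?(ltW C0)// ltW// integral_sqr_lt.
Qed.

Lemma hfun_npos t : t <= 0 -> hfun f lambda c t = 1.
Proof.
rewrite le_eqVlt => /predU1P[->|t0]; rewrite /hfun.
  by rewrite set_itv1 Rintegral_set1 mulr0 subr0 sqrtr1.
by rewrite set_itv_ge ?Rintegral_set0 ?mulr0 ?subr0 ?sqrtr1// bnd_simp -ltNge.
Qed.

Lemma hfun_gt0 t : 0 < hfun f lambda c t.
Proof.
have [t0|t0] := leP t 0; first by rewrite hfun_npos.
rewrite sqrtr_gt0 subr_gt0; apply: lt_le_trans CS.
by rewrite ltr_pM2l// integral_sqr_lt// ltW.
Qed.

Lemma hfun_lt1 t : 0 < t -> hfun f lambda c t < 1.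
Proof.
move=> t0; rewrite -[ltRHS]sqrtr1 ltr_sqrt// ltrBlDr ltrDl mulr_gt0//.
exact: integral_sqr_pos.
Qed.

Lemma hfun_le1 t : hfun f lambda c t <= 1.
Proof. by have [t0|/hfun_lt1/ltW//] := leP t 0; rewrite hfun_npos. Qed.

Lemma continuous_hfun : continuous (hfun f lambda c).
Proof.
have cf : causal (fun t => ext f t ^+ 2).
  have [mf f00] : causal (ext f) := L1loc_causal (L2loc_L1loc (square_integrable_L2loc f2)).
  by split; [exact: measurable_funX|move=> t /f00 ->; rewrite expr0n].
have -> : hfun f lambda c = fun t => Num.sqrt (1 - C * \int[leb]_(s in `[0, t]) (ext f s ^+ 2)).
  by apply/funext => t; rewrite /hfun -/C square_resolvent_integral.
move=> t; apply: (@cvg_comp _ _ _ (fun t => 1 - C * \int[leb]_(s in `[0, t]) (ext f s ^+ 2))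
  Num.sqrt _ _ _ _ (@sqrt_continuous R _)).
apply: cvgB; first exact: cvg_cst.
apply: cvgM; first exact: cvg_cst.
exact: (continuous_primitive cf (L2loc_ext (square_integrable_L2loc f2))).
Qed.

End StationaryScale.

(** * Uniqueness for the first-kind equation *)

Section DyadicPower.
Context {R : realType}.
Implicit Types (a x y : R) (n N : nat).

Lemma bernoulli_ge x n : -1 <= x -> 1 + n%:R * x <= (1 + x) ^+ n.
Proof.
move=> x1; elim: n => [|n IH]; first by rewrite mul0r addr0 expr0.
rewrite exprS; apply: (@le_trans _ _ ((1 + x) * (1 + n%:R * x))); last first.
  by rewrite ler_wpM2l//; lra.
have : 0 <= n%:R * x ^+ 2 by rewrite mulr_ge0// sqr_ge0.
by rewrite -natr1; move: (n%:R : R) => m; rewrite expr2; nra.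
Qed.

(** Bernoulli's inequality reduces this to [(1 - y)^N (1 + y)^N <= 1]. *)
Lemma one_sub_expr_le y N : 0 <= y <= 1 -> (1 - y) ^+ N * (1 + N%:R * y) <= 1.
Proof.
move=> /andP[y0 y1]; apply: (@le_trans _ _ ((1 - y) ^+ N * (1 + y) ^+ N)).
  by rewrite ler_wpM2l ?exprn_ge0//; [lra|apply: bernoulli_ge; lra].
rewrite -exprMn exprn_ile1//; nra.
Qed.

(** The threshold is [a = 1/2]. Below it, Bernoulli's inequality keeps the power within [(2 a)^n] of
    1. *)
Lemma dyadic_power_cvg1 a : 0 <= a -> a * 2 < 1 ->
  (fun n => (1 - a ^+ n) ^+ (2 ^ n)) @ \oo --> (1 : R).
Proof.
move=> a0 a2; have a1 n : 0 <= a ^+ n <= 1.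
  by rewrite exprn_ge0//= exprn_ile1//; lra.
apply: (@squeeze_cvgr _ \oo _ _ (fun n => 1 - (a * 2) ^+ n) (fun=> 1)).
- apply: nearW => n; have /andP[h0 h1] := a1 n; apply/andP; split; last first.
    by rewrite exprn_ile1//; lra.
  have := @bernoulli_ge (- a ^+ n) (2 ^ n)%N; rewrite natrX exprMn => h.
  by have := h ltac:(lra); lra.
- have c0 : (fun n => (a * 2) ^+ n) @ \oo --> (0 : R).
    by apply: cvg_expr; rewrite ger0_norm// mulr_ge0.
  have c1 : (fun=> 1 : R) @ \oo --> (1 : R) by exact: cvg_cst.
  by have := cvgB c1 c0; rewrite subr0; exact.
- exact: cvg_cst.
Qed.

(** Above the threshold, [one_sub_expr_le] with exponent [2^n] bounds the power by [(2 a)^(-n)]. *)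
Lemma dyadic_power_cvg0 a : a <= 1 -> 1 < a * 2 ->
  (fun n => (1 - a ^+ n) ^+ (2 ^ n)) @ \oo --> (0 : R).
Proof.
move=> a1 a2; have a0 : 0 < a by lra.
have an n : 0 <= a ^+ n <= 1.
  by rewrite exprn_ge0 ?exprn_ile1//; exact: ltW.
apply: (@squeeze_cvgr _ \oo _ _ (fun=> 0) (fun n => (a * 2)^-1 ^+ n)).
- apply: nearW => n; have /andP[h0 h1] := an n.
  rewrite exprn_ge0 ?subr_ge0//=.
  have := one_sub_expr_le (2 ^ n) (an n); rewrite natrX -exprMn [2 * a]mulrC => h.
  rewrite exprVn -div1r ler_pdivlMr; last by rewrite exprn_gt0//; lra.
  apply: le_trans h; rewrite ler_wpM2l ?lerDr// exprn_ge0//; lra.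
- exact: cvg_cst.
- apply: cvg_expr; rewrite ger0_norm ?invf_lt1//; last by rewrite invr_ge0; lra.
  lra.
Qed.

End DyadicPower.

(** * Injectivity of the Laplace transform *)

Section LaplaceInjective.
Context {R : realType}.
Local Notation leb := (@lebesgue_measure R).
Variable g : R -> R.
Hypothesis cg : causal g.
Hypothesis ig : L1 leb g.

Let e r t : R := expR (- (r * t)).

Lemma measurable_expR_linear r : measurable_fun setT (e r).
Proof.
apply: measurableT_comp => //; apply: measurableT_comp => //.
Qed.

Let e01 r t : 0 <= r -> 0 <= t -> 0 <= e r t <= 1.
Proof.
by move=> r0 t0; rewrite expR_ge0/= -[leRHS]expR0 ler_expR oppr_le0 mulr_ge0.
Qed.

Lemma L1_causal_bounded (w : R -> R) : measurable_fun setT w ->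
  (forall t, 0 <= t -> `|w t| <= 1) -> L1 leb (fun t => g t * w t).
Proof.
move=> mw w1; apply: (L1_le _ ig).
  by apply: measurable_funM => //; case: cg.
move=> t; have [t0|t0] := ltP t 0; first by rewrite (proj2 cg)// mul0r normr0.
by rewrite normrM ler_piMr// w1.
Qed.

Hypothesis laplace0 : forall q, 0 <= q -> \int[leb]_t (g t * e q t) = 0.

Let bnd q r N t : 0 <= q -> 0 <= r -> 0 <= t -> `|e q t * (1 - e r t) ^+ N| <= 1.
Proof.
move=> q0 r0 t0; have /andP[h0 h1] := e01 q0 t0; have /andP[h2 h3] := e01 r0 t0.
rewrite ger0_norm ?mulr_ge0 ?exprn_ge0 ?subr_ge0// mulr_ile1 ?exprn_ge0 ?subr_ge0//.
by rewrite exprn_ile1//; lra.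
Qed.

(** The weight is a linear combination of exponentials. The free parameter [q] carries the
    induction: one more factor [1 - e r] turns [q] into a difference of the cases [q] and
    [q + r]. *)
Lemma laplace_binomial0 N q r : 0 <= q -> 0 <= r ->
  \int[leb]_t (g t * (e q t * (1 - e r t) ^+ N)) = 0.
Proof.
move=> + r0; elim: N q => [|N IH] q q0.
  by rewrite -[RHS](laplace0 q0); apply: eq_Rintegral => t _; rewrite expr0 mulr1.
have m1 q' : measurable_fun setT (fun t => e q' t * (1 - e r t) ^+ N).
  apply: measurable_funM; first exact: measurable_expR_linear.
  apply: measurable_funX; apply: measurable_funB; first exact: measurable_cst.
  exact: measurable_expR_linear.
have i q' : 0 <= q' -> L1 leb (fun t => g t * (e q' t * (1 - e r t) ^+ N)).
  by move=> q0'; apply: L1_causal_bounded => // t t0; exact: bnd.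
have qr0 : 0 <= q + r by rewrite addr_ge0.
have E : (fun t => g t * (e q t * (1 - e r t) ^+ N.+1)) =
    fun t => g t * (e q t * (1 - e r t) ^+ N) - g t * (e (q + r) t * (1 - e r t) ^+ N).
  have eD t : e (q + r) t = e q t * e r t by rewrite /e mulrDl opprD expRD.
  by apply/funext => t; rewrite eD exprS; ring.
by rewrite E (RintegralTB (i _ q0) (i _ qr0)) !IH// subr0.
Qed.

(* For r = n ln 2 / x the weights (1 - exp (- r t)) ^ (2 ^ n) tend to the
   indicator of t > x. *)
Lemma tail_integral0 x : 0 < x -> \int[leb]_t (g t * (\1_(`]x, +oo[ : set R) t)) = 0.
Proof.
move=> x0; pose r n : R := n%:R * (ln 2 / x).
have l2 : 0 < ln 2 :> R by rewrite ln_gt0// ltr1n.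
have r0 n : 0 <= r n by rewrite mulr_ge0// divr_ge0// ltW.
(* This is [2^(- t / x)], which crosses the threshold 1/2 exactly at [t = x]. *)
pose a t := expR (- (ln 2 / x * t)).
have eE n t : e (r n) t = a t ^+ n.
  by rewrite /e /r /a -expRM_natl; congr expR; ring.
pose F n t := g t * (e 0 t * (1 - e (r n) t) ^+ (2 ^ n)).
have F0 n : \int[leb]_t F n t = 0 by exact: laplace_binomial0.
pose G t := g t * \1_(`]x, +oo[ : set R) t.
have aE t : a t * 2 = expR (ln 2 / x * (x - t)).
  rewrite -{1}(@lnK R 2) ?posrE// -expRD; congr expR.
  have : x != 0 by rewrite gt_eqF.
  by move=> xn0; field.
have mw N q s : measurable_fun setT (fun t => e q t * (1 - e s t) ^+ N).
  apply: measurable_funM; first exact: measurable_expR_linear.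
  apply: measurable_funX; apply: measurable_funB; first exact: measurable_cst.
  exact: measurable_expR_linear.
have e0 t : e 0 t = 1 by rewrite /e mul0r oppr0 expR0.
have [||||||_] := @Rintegral_dominated_cvg _ _ _ leb setT F G (fun t => `|g t|).
- exact: measurableT.
- by move=> n; apply: measurable_funM; [case: cg|exact: mw].
- apply: measurable_funM; first by case: cg.
  by apply: measurable_indic; exact: measurable_itv.
- apply: aeS (ae_not_in_set1 x) => t tx _; rewrite /F /G.
  have [t0|t0] := ltP t 0.
    by rewrite (proj2 cg)// mul0r; under eq_fun do rewrite mul0r; exact: cvg_cst.
  under eq_fun do rewrite e0 mul1r eE.
  apply: cvgM; first exact: cvg_cst.
  have [xt|xt] := ltP x t.
    rewrite indicE mem_set/= ?in_itv/= ?xt//; apply: dyadic_power_cvg1.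
      exact: expR_ge0.
    by rewrite aE expR_lt1 pmulr_rlt0 ?divr_gt0//; lra.
  have {xt}xt : t < x by rewrite lt_neqAle tx.
  rewrite indicE memNset/=; last by rewrite in_itv/= andbT; apply/negP; rewrite -leNgt ltW.
  apply: dyadic_power_cvg0.
    by rewrite -[leRHS]expR0 ler_expR oppr_le0 mulr_ge0 ?divr_ge0// ltW.
  by rewrite aE expR_gt1 mulr_gt0 ?divr_gt0//; lra.
- exact: integrable_norm ig.
- apply: aeT => t n _; rewrite /F.
  have [t0|t0] := ltP t 0; first by rewrite (proj2 cg)// mul0r normr0.
  by rewrite normrM ler_piMr// bnd.
rewrite (funext F0) => h; apply: (cvg_unique _ h); rewrite //=; exact: cvg_cst.
Qed.

Lemma laplace_injective : {ae leb, forall t, g t = 0}.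
Proof.
have iloc : L1loc g by move=> T T0; exact: integrableS ig.
apply: integrals_eq0_ae => // x x0.
have g0 : \int[leb]_t g t = 0.
  rewrite -[RHS](laplace0 (lexx 0)); apply: eq_Rintegral => t _.
  by rewrite /e mul0r oppr0 expR0 mulr1.
have it : L1 leb (fun t => g t * \1_(`]x, +oo[ : set R) t).
  apply: L1_causal_bounded; first by apply: measurable_indic; exact: measurable_itv.
  by move=> t _; rewrite indicE; case: (_ \in _); rewrite ?normr1 ?normr0.
transitivity (\int[leb]_t g t - \int[leb]_t (g t * \1_(`]x, +oo[ : set R) t)).
  rewrite -(RintegralTB ig it) Rintegral_mkcond; apply: eq_Rintegral => t _; rewrite patchE indicE.
  have [t0|t0] := ltP t 0; first by rewrite (proj2 cg)// mul0r subr0; case: ifP.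
  have [tx|xt] := leP t x.
    rewrite mem_set/= ?in_itv/= ?t0// memNset ?mulr0 ?subr0//=.
    by rewrite in_itv/= andbT; apply/negP; rewrite -leNgt.
  rewrite memNset/= ?in_itv/= ?t0 ?leNgt ?xt// mem_set ?mulr1 ?subrr//=.
  by rewrite in_itv/= xt.
by rewrite g0 tail_integral0// subr0.
Qed.

End LaplaceInjective.

(** * Laplace transforms of convolutions *)

Section LaplaceConvolution.
Context {R : realType}.
Local Notation leb := (@lebesgue_measure R).
Implicit Types (a b g : R -> R) (p t : R).

Lemma L1_conv_Rintegral a b : measurable_fun setT a -> measurable_fun setT b ->
  L1 leb a -> L1 leb b ->
  L1 leb (conv a b) /\ \int[leb]_t conv a b t = (\int[leb]_t a t) * (\int[leb]_t b t).
Proof.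
move=> ma mb ia ib; pose G (t s : measurableTypeR R) := a (t - s) * b s.
have mG : measurable_fun setT (fun z : measurableTypeR R * measurableTypeR R => G z.1 z.2).
  exact: measurable_conv_kernel.
have iGs s : L1 leb (fun t => G t s) by apply: L1Zr; exact: L1_shift.
have EG s : \int[leb]_t `|G t s| = (\int[leb]_t `|a t|) * `|b s|.
  have ian := L1_norm ia.
  rewrite -(Rintegral_shift s (f := fun t => `|a t|)); last exact: L1_measurable ian.
  rewrite -RintegralZr//; last exact: (L1_shift s ian).
  by apply: eq_Rintegral => t _; rewrite /G normrM.
have iG : L1 (leb \x leb)%E (fun z => G z.1 z.2).
  apply: (L1_prod21 mG).
  have iA := L1Zl (\int[leb]_t `|a t|) (L1_norm ib).
  rewrite (_ : (\int[_]_s _)%E = (\int[leb]_s ((\int[leb]_t `|a t|) * `|b s|)%:E)%E).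
    by rewrite -(EFin_Rintegral iA) ltry.
  by apply: eq_integral => s _; rewrite -EG (EFin_Rintegral (L1_norm (iGs s))).
split; first exact: (L1_Rintegral2 mG iG).
rewrite [LHS](RFubini mG iG).
rewrite -RintegralZl//; apply: eq_Rintegral => s _.
by rewrite -(Rintegral_shift s ma) -RintegralZr//; exact: (L1_shift s ia).
Qed.

Definition laplace_weight p g t : R := expR (- (p * t)) * g t.

Lemma causal_laplace_weight p g : causal g -> causal (laplace_weight p g).
Proof.
case=> mg g0; split; last by move=> t /g0 E; rewrite /laplace_weight E mulr0.
by apply: measurable_funM => //; exact: measurable_expR_linear.
Qed.

(** The exponential factors over [t = (t - s) + s]. Multiplicativity of the Laplace transform thus
    reduces to that of the total integral. *)
Lemma conv_laplace_weight p a b t : L1 leb (fun s => a (t - s) * b s) ->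
  conv (laplace_weight p a) (laplace_weight p b) t = laplace_weight p (conv a b) t.
Proof.
move=> iab; rewrite /laplace_weight /conv -(RintegralTZ _ iab).
apply: eq_Rintegral => s _.
have -> : expR (- (p * t)) = expR (- (p * (t - s))) * expR (- (p * s)).
  by rewrite -expRD; congr expR; ring.
by ring.
Qed.

Lemma L1_laplace_weight_one p : 0 < p -> L1 leb (laplace_weight p (ext (cst 1))).
Proof.
move=> p0; have := L1Zl p^-1 (integrable_exponential_pdf p0).
congr (integrable _ _ _); apply/funext => t; congr (_%:E).
rewrite /laplace_weight; have [t0|t0] := ltP t 0.
  by rewrite lt0_exponential_pdf// ext_lt0// !mulr0.
by rewrite exponential_pdfE// extE//= mulKf ?gt_eqF// mulr1 mulNr.
Qed.

(** On the half-line the exponential is itself square-integrable, so the weighted function is a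
    product of two elements of [L^2]. *)
Lemma L1_laplace_weight_sqr p g : 0 < p -> causal g -> L1 leb (fun t => g t ^+ 2) ->
  L1 leb (laplace_weight p g).
Proof.
move=> p0 cg g2; have [mw w0] := causal_laplace_weight p (causal_one (R := R)).
have Lw : L2 leb (laplace_weight p (ext (cst 1))).
  split => //; have p20 : 0 < p * 2 by rewrite mulr_gt0.
  have := L1_laplace_weight_one p20; congr (integrable _ _ _).
  apply/funext => t; congr (_%:E); rewrite /laplace_weight exprMn -expRM_natl.
  congr (expR _ * _); first by ring.
  by rewrite /ext; case: ifP; rewrite ?expr1n ?expr0n.
have Lg : L2 leb g by split => //; case: cg.
have := L1_L2M Lw Lg; congr (integrable _ _ _).
apply/funext => t; congr (_%:E); rewrite /laplace_weight.
have [t0|t0] := ltP t 0; first by rewrite (proj2 cg)// !mulr0.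
by rewrite extE// mulr1.
Qed.

(** Up to [A] local integrability suffices; after [A] the function is dominated almost everywhere by
    [|M| exp (- p t)]. *)
Lemma L1_laplace_weight_bounded p g : 0 < p -> L1loc g -> bounded_at_infty g ->
  L1 leb (laplace_weight p (ext g)).
Proof.
move=> p0 ig [A [M HM]].
have cg := L1loc_causal ig.
have [mw _] := causal_laplace_weight p cg.
have i1 := L1_norm (L1_patch (L1loc_itv A ig)).
have i2 := L1Zl `|M| (L1_laplace_weight_one p0).
have [mD iD] : measurable_fun setT (fun t => `|(g \_ `[0, A]) t| + `|M| * laplace_weight p (ext (cst 1)) t) /\
    L1 leb (fun t => `|(g \_ `[0, A]) t| + `|M| * laplace_weight p (ext (cst 1)) t).
  by split; [exact: L1_measurable (L1D i1 i2)|exact: L1D].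
apply: L1_abs_lty => //.
apply: (@le_lt_trans _ _ (\int[leb]_t (`|(g \_ `[0, A]) t| + `|M| * laplace_weight p (ext (cst 1)) t)%:E)%E); last first.
  by rewrite -(EFin_Rintegral iD) ltry.
have w0 t : 0 <= laplace_weight p (ext (cst 1)) t.
  by rewrite mulr_ge0 ?expR_ge0// /ext; case: ifP.
apply: ae_ge0_le_integral => //.
- by apply/measurable_EFinP; exact: measurableT_comp.
- by move=> t _; rewrite lee_fin addr_ge0// mulr_ge0.
- exact/measurable_EFinP.
apply: aeS HM => t Ht _; rewrite lee_fin.
have [t0|t0] := ltP t 0.
  have -> : laplace_weight p (ext g) t = 0 by rewrite /laplace_weight ext_lt0// mulr0.
  by rewrite normr0 addr_ge0// mulr_ge0.
have E : laplace_weight p (ext g) t = expR (- (p * t)) * g t.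
  by rewrite /laplace_weight extE.
rewrite E normrM ger0_norm ?expR_ge0//.
have e1 : expR (- (p * t)) <= 1.
  by rewrite -[leRHS]expR0 ler_expR oppr_le0 mulr_ge0// ltW.
have [tA|At] := leP t A.
  rewrite patchE mem_set/= ?in_itv/= ?t0//.
  by apply: (@le_trans _ _ `|g t|); [rewrite ler_piMl|rewrite lerDl mulr_ge0].
rewrite ler_wpDl// /laplace_weight extE//= mulr1 mulrC ler_wpM2r ?expR_ge0//.
by apply: le_trans (ler_norm _); apply: Ht => //; exact: ltW.
Qed.

End LaplaceConvolution.

(** * The homogeneous first-kind equation *)

Section FirstKindUniqueness.
Context {R : realType}.
Local Notation leb := (@lebesgue_measure R).
Variables (K f Rl : R -> R) (lambda : R).
Hypothesis hK : kernel_assumption K.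
Hypothesis lambda_gt0 : 0 < lambda.
Hypothesis hR : resolvent_assumption K lambda Rl f.
Local Notation k := (ext K).
Local Notation fe := (ext f).
Local Notation L p g := (\int[leb]_t laplace_weight p g t).

Let K2 : L2loc K := kernel_L2loc hK.
Let ck : causal k := causal_K K2.
Let cf : causal fe := causal_f hR.
Let res := resolvent_ae K2 lambda_gt0 hR.
Let fk : convolution_bounded fe k := convolution_bounded_fK K2 hR.

Let k0 t : 0 <= k t.
Proof. by rewrite /ext; case: ifP => // t0; exact: (kernel_ge0 hK t0). Qed.

Let L1k p : 0 < p -> L1 leb (laplace_weight p k).
Proof.
move=> p0; have := kernel_laplace hK p0.
rewrite integrable_mkcond//; congr (integrable _ _ _); apply/funext => t.
rewrite patchE /laplace_weight /ext; case: (leP 0 t) => t0.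
  by rewrite mem_set//= in_itv/= t0.
by rewrite memNset/= ?mulr0// in_itv/= andbT; apply/negP; rewrite -ltNge.
Qed.

Let L1f p : 0 < p -> L1 leb (laplace_weight p fe).
Proof.
move=> p0; apply: L1_laplace_weight_sqr => //.
have := proj2 (resolvent_f_L2 hR); rewrite integrable_mkcond//.
congr (integrable _ _ _); apply/funext => t; rewrite patchE /ext; case: (leP 0 t) => t0.
  by rewrite mem_set//= in_itv/= t0.
by rewrite memNset/= ?expr0n// in_itv/= andbT; apply/negP; rewrite -ltNge.
Qed.

(* L f (1 + lambda L K) = lambda L K with K nonnegative: if L f vanished at one
   point then K, and therefore f, would be zero. *)
Lemma laplace_resolvent_neq0 p : 0 < p -> L p fe != 0.
Proof.
move=> p0; apply/negP => /eqP Lf0.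
have [mwk _] := causal_laplace_weight p ck; have [mwf _] := causal_laplace_weight p cf.
have [iC eC] := L1_conv_Rintegral mwf mwk (L1f p0) (L1k p0).
have fkL1 t : L1 leb (fun s => fe (t - s) * k s).
  have [C HC] := fk t; apply: L1_abs_lty.
    exact: measurable_conv_integrand (proj1 cf) (proj1 ck).
  by apply: le_lt_trans (HC t (lexx t)) _; exact: ltry.
have Lk0 : L p k = 0.
  have il := L1Zl lambda (L1k p0); have ic := L1Zl lambda iC.
  have : L p fe = lambda * L p k - lambda * (L p fe * L p k).
    rewrite -eC -(RintegralTZ _ (L1k p0)) -(RintegralTZ _ iC) -(RintegralTB il ic).
    apply: ae_eq_Rintegral => //; first exact: L1_measurable (L1B il ic).
    apply: aeS res => t E; rewrite conv_laplace_weight// /laplace_weight E.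
    by move: (conv fe k t) (k t) (expR (- (p * t))) => a b c; ring.
  by rewrite Lf0 mul0r mulr0 subr0 => /esym/eqP; rewrite mulf_eq0 gt_eqF//= => /eqP.
have wk0 t : 0 <= laplace_weight p k t by rewrite mulr_ge0 ?expR_ge0.
have kae : {ae leb, forall t, k t = 0}.
  apply: aeS (Rintegral0_ae (L1k p0) wk0 Lk0) => t /eqP.
  by rewrite mulf_eq0 gt_eqF ?expR_gt0//= => /eqP.
have conv0 t : conv fe k t = 0.
  have m0 : measurable_fun setT (cst 0 : R -> R) by exact: measurable_cst.
  have mfk : measurable_fun setT (fun s : R => fe (t - s) * k s).
    exact: measurable_conv_integrand (proj1 cf) (proj1 ck).
  have h : {ae leb, forall s : R, fe (t - s) * k s = cst 0 s}.
    by apply: aeS kae => s ->; rewrite mulr0.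
  by rewrite /conv (@ae_eq_Rintegral _ _ _ leb (fun s => fe (t - s) * k s) (cst 0) mfk m0 h) Rintegral_cst// mul0r.
have fae : {ae leb, forall t, fe t = 0}.
  by apply: aeS2 res kae => t -> ->; rewrite conv0 !mulr0 subrr.
have : {ae leb, forall t : R, ~ [set` `[0, 1]] t}.
  apply: aeS2 fae (resolvent_f_neq0 hR) => t f0 fn0; rewrite /= in_itv/= => /andP[t0 _].
  by have := fn0 t0; rewrite -(extE f t0) f0 eqxx.
move=> H; have nl : leb.-negligible [set` `[0, 1]] by apply: negligibleS H => s si /(_ si).
have mi : measurable ([set` `[0, 1]] : set R) by exact: measurable_itv.
have := (negligibleP leb mi).1 nl.
by rewrite /= lebesgue_measure_itv/= lte_fin ltr01 -EFinD subr0 => /eqP; rewrite onee_eq0.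
Qed.

(** The transform of [f * nu] is a product whose factor [L p fe] is nonzero for every [p > 0], so
    the transform of [nu] vanishes on the open half-line. *)
Lemma first_kind_kernel0 nu : admissible_drift nu ->
  (forall t, 0 <= t -> L1 leb (fun s => fe (t - s) * ext nu s)) ->
  (forall t, 0 <= t -> conv fe (ext nu) t = 0) ->
  {ae leb, forall t, ext nu t = 0}.
Proof.
move=> [inu bnu] ifn fn0.
have cn := L1loc_causal inu.
have L1n p : 0 < p -> L1 leb (laplace_weight p (ext nu)).
  by move=> p0; exact: L1_laplace_weight_bounded.
have Ln0 p : 0 < p -> L p (ext nu) = 0.
  move=> p0; have [mwn _] := causal_laplace_weight p cn.
  have [mwf _] := causal_laplace_weight p cf.
  have [_ eC] := L1_conv_Rintegral mwf mwn (L1f p0) (L1n _ p0).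
  apply/eqP; have : L p fe * L p (ext nu) == 0.
    rewrite -eC -[X in _ == X](mul0r (fine (leb setT))) -Rintegral_cst//.
    apply/eqP; apply: eq_Rintegral => t _; have [t0|t0] := ltP t 0.
      by rewrite conv_lt0//; exact: causal_laplace_weight.
    by rewrite conv_laplace_weight ?ifn// /laplace_weight fn0// mulr0.
  by rewrite mulf_eq0 (negbTE (laplace_resolvent_neq0 p0)).
(* Damping by [exp (- t)] makes [nu] integrable, and the transform of the result at [q >= 0] is that
   of [nu] at [1 + q]. *)
have cw := causal_laplace_weight 1 cn.
have E q : 0 <= q -> \int[leb]_t (laplace_weight 1 (ext nu) t * expR (- (q * t))) = 0.
  move=> q0; rewrite -[RHS](Ln0 (1 + q)); last by lra.
  apply: eq_Rintegral => t _; rewrite /laplace_weight mulrAC -expRD.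
  by congr (expR _ * _); ring.
apply: aeS (laplace_injective cw (L1n _ ltr01) E) => t /eqP.
by rewrite mulf_eq0 gt_eqF ?expR_gt0//= => /eqP.
Qed.

End FirstKindUniqueness.

(** * Resolvents of the first kind *)

Section MeasureConvolution.
Context {R : realType}.
Local Notation leb := (@lebesgue_measure R).
Variable nu : {measure set (measurableTypeR R) -> \bar R}.
Hypothesis nu_fin : forall T : R, (nu `[0%R, T]%classic < +oo)%E.

Definition mc (g : R -> R) (t : R) : R := \int[nu]_(s in `[0, t]) g (t - s).

Variables (a b : R -> R) (T : R).
Hypotheses (ca : causal a) (cb : causal b) (ba : convolution_bounded b a).

Let D : set (measurableTypeR R) := `[0, T]%classic.
Let mD : measurable D. Proof. exact: measurable_itv. Qed.
(** Restricting [nu] to [[0, T]] gives a finite measure, for which Fubini is available; the values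
    at times up to [T] do not see the rest. *)
Let nuT : {finite_measure set (measurableTypeR R) -> \bar R} := mfrestr mD (nu_fin T).
Let i (s : R) : R := \1_D s.

Let Rintegral_nuT (g : R -> R) : \int[nuT]_s (i s * g s) = \int[nu]_(s in D) g s.
Proof.
rewrite -(Rintegral_supp nuT (D := D)); last first.
  by move=> s nDs; rewrite /i indicE memNset// mul0r.
transitivity (\int[nuT]_(s in D) g s).
  by apply: eq_Rintegral => s sD; rewrite /i indicE sD mul1r.
congr fine; apply: eq_measure_integral => A mA AD.
by rewrite /nuT /= /mfrestr /mrestr setIidl.
Qed.

Let G (s t : measurableTypeR R) : R := i s * (b (T - t) * a (t - s)).

Let mG : measurable_fun setT (fun z : measurableTypeR R * measurableTypeR R => G z.1 z.2).
Proof.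
apply: measurable_funM.
  by apply: (measurableT_comp (f := i)) => //; exact: measurable_indic.
apply: measurable_funM.
  apply: (measurableT_comp (proj1 cb)).
  by apply: measurable_funB; [exact: measurable_cst|exact: measurable_snd].
apply: (measurableT_comp (proj1 ca)).
by apply: measurable_funB; [exact: measurable_snd|exact: measurable_fst].
Qed.

Let shiftE s : \int[leb]_t (b (T - t) * a (t - s)) = conv b a (T - s).
Proof.
rewrite -[RHS](Rintegral_shift s); last exact: measurable_conv_integrand (proj1 cb) (proj1 ca).
by apply: eq_Rintegral => t _; congr (b _ * _); lra.
Qed.

Let iG : L1 (nuT \x leb)%E (fun z => G z.1 z.2).
Proof.
have [C HC] := ba T; pose C' := `|C|.
apply: (L1_prod12 mG).
have iC : L1 nuT (cst C') by exact: finite_measure_integrable_cst.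
apply: (@le_lt_trans _ _ (\int[nuT]_s (cst C' s)%:E)%E); last first.
  by rewrite -(EFin_Rintegral iC) ltry.
have mabsG : measurable_fun setT
    (fun z : measurableTypeR R * measurableTypeR R => `|G z.1 z.2|%:E).
  by apply/measurable_EFinP; exact: measurableT_comp.
apply: ge0_le_integral => //.
- by move=> s _; apply: integral_ge0 => t _; rewrite lee_fin.
- exact: (measurable_fun_fubini_tonelli_F _ mabsG).
- by apply/measurable_EFinP; exact: L1_measurable iC.
- move=> s _; have [sD|nsD] := pselect (D s); last first.
    rewrite (_ : (\int[_]_t _)%E = 0%E) ?lee_fin//.
    apply: integral0_eq => t _.
    by rewrite /G /i indicE memNset// mul0r normr0.
  have m1 : measurable_fun setT (fun t : R => `|b (T - s - t) * a t|%:E).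
    apply/measurable_EFinP; apply: measurableT_comp => //.
    exact: measurable_conv_integrand (proj1 cb) (proj1 ca).
  have := HC (T - s); rewrite /conv_abs -(ge0_integral_shift s m1)// => h.
  apply: (@le_trans _ _ C%:E); last by rewrite lee_fin ler_norm.
  rewrite (_ : (\int[_]_t _)%E = (\int[leb]_t `|b (T - s - (t - s)) * a (t - s)|%:E)%E).
    by apply: h; move: sD; rewrite /D/= in_itv/= => /andP[s0 _]; lra.
  apply: eq_integral => t _; rewrite /G /i indicE mem_set// mul1r.
  by congr (`|b _ * _|%:E); lra.
Qed.

Let V t := \int[nuT]_s (i s * a (t - s)).

Let mV : measurable_fun setT V.
Proof.
apply: (measurable_Rintegral2 nuT (F := fun t s : measurableTypeR R => i s * a (t - s))).
apply: measurable_funM.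
  by apply: (measurableT_comp (f := i)) => //; exact: measurable_indic.
apply: (measurableT_comp (proj1 ca)).
by apply: measurable_funB; [exact: measurable_fst|exact: measurable_snd].
Qed.

Let VE t : b (T - t) * V t = b (T - t) * mc a t.
Proof.
have [tT|Tt] := leP t T; last by rewrite (proj2 cb) ?subr_lt0// !mul0r.
congr (_ * _); rewrite /V Rintegral_nuT /mc Rintegral_mkcond [RHS]Rintegral_mkcond.
apply: eq_Rintegral => s _; rewrite !patchE.
have [st|ts] := leP s t; last first.
  by rewrite (proj2 ca) ?subr_lt0//; case: ifP; case: ifP.
by congr (if _ then _ else _); rewrite /D; apply/idP/idP; rewrite !inE/= !in_itv/= st (le_trans st tT).
Qed.

Let innerE : {ae leb, forall t, \int[nuT]_s G s t = b (T - t) * mc a t}.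
Proof.
apply: aeS (ae_L1_section2 mG iG) => t iGt.
rewrite -VE /V -RintegralZ_L1; first by apply: eq_Rintegral => s _; rewrite /G mulrCA.
by have := iGt; under eq_fun do rewrite /G mulrCA.
Qed.

Let m_bmc : measurable_fun setT (fun t : R => b (T - t) * mc a t).
Proof.
rewrite -(funext VE); apply: measurable_funM => //.
exact: (measurableT_comp (proj1 cb) (measurable_reflect T)).
Qed.

Lemma L1_mc_conv : L1 leb (fun t => b (T - t) * mc a t).
Proof. exact: (L1_ae (L1_Rintegral1 mG iG) m_bmc innerE). Qed.

Lemma mc_conv : mc (conv b a) T = conv b (mc a) T.
Proof.
rewrite /mc -/D -Rintegral_nuT.
transitivity (\int[nuT]_s \int[leb]_t G s t).
  apply: eq_Rintegral => s _; rewrite -shiftE /G /i indicE; case: (_ \in _).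
    by rewrite mul1r; apply: eq_Rintegral => t _; rewrite mul1r.
  by rewrite mul0r; under eq_Rintegral do rewrite mul0r; rewrite Rintegral_cst// mul0r.
rewrite (RFubini mG iG).
exact: (ae_eq_Rintegral (L1_measurable (L1_Rintegral1 mG iG)) m_bmc innerE).
Qed.

End MeasureConvolution.

Section CausalContinuous.
Context {R : realType}.
Local Notation leb := (@lebesgue_measure R).
Implicit Types g : R -> R.

Lemma continuous_causal g : continuous g -> (forall t, t < 0 -> g t = 0) -> causal g.
Proof. by move=> cg g0; split => //; exact: continuous_measurable_fun. Qed.

Lemma continuous_locally_bounded g : continuous g -> (forall t, t < 0 -> g t = 0) ->
  locally_bounded g.
Proof.
move=> cg g0; have -> : g = ext g.
  by apply/funext => t; rewrite /ext; case: ltP => // /g0.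
by apply: locally_bounded_continuous; exact: continuous_subspaceT.
Qed.

Lemma continuous_ae0 g : continuous g -> {ae leb, forall t, g t = 0} ->
  forall t, g t = 0.
Proof.
move=> cg ae0 t; apply/eqP/negPn/negP => gt0.
have /nbhs_ballP[e /= e0 He] : \forall s \near t, g s != 0.
  exact: (cvgr_neq0 (g t) (cg t) gt0).
have mB : measurable (ball t e) by exact: measurable_ball.
have nB : leb.-negligible (ball t e).
  by apply: negligibleS ae0 => s /He /= /eqP.
have := (negligibleP leb mB).1 nB; rewrite /= lebesgue_measure_ball ?(ltW e0)//.
by move=> -[] /eqP; rewrite mulrn_eq0 /= gt_eqF.
Qed.

End CausalContinuous.

(** * Inversion by a resolvent of the first kind *)

Section FirstKindResolvent.
Context {R : realType}.
Local Notation leb := (@lebesgue_measure R).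
Local Notation one := (ext (cst 1) : R -> R).
Variables (f m D : R -> R) (r : @locfin_signed_measure R).
Hypotheses (cf : causal f) (if_ : L1loc f) (cm : causal m) (im : L1loc m).
Hypotheses (cD : continuous D) (D0 : forall t, t < 0 -> D t = 0).
Hypothesis fmD : forall t, conv f m t = D t.
Hypothesis rf : forall t, 0 < t -> mconv r f t = 1.

Let mconvE g t : mconv r g t = mc (lsm_pos r) g t - mc (lsm_neg r) g t.
Proof. by []. Qed.

Lemma mconv_lt0 g t : t < 0 -> mconv r g t = 0.
Proof.
move=> t0; rewrite /mconv set_itv_ge ?Rintegral_set0 ?subr0//.
by rewrite bnd_simp -ltNge.
Qed.

Lemma mconv_conv a b t : causal a -> causal b -> convolution_bounded b a ->
  L1 leb (fun s => b (t - s) * mconv r a s) /\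
  mconv r (conv b a) t = conv b (mconv r a) t.
Proof.
move=> ca cb ba.
have ip := L1_mc_conv (lsm_pos_fin r) t ca cb ba.
have in_ := L1_mc_conv (lsm_neg_fin r) t ca cb ba.
have E s : b (t - s) * mc (lsm_pos r) a s - b (t - s) * mc (lsm_neg r) a s =
    b (t - s) * mconv r a s by rewrite mconvE mulrBr.
split.
  have := L1B ip in_; congr (integrable _ _ _).
  by apply/funext => s; rewrite E.
rewrite mconvE (mc_conv (lsm_pos_fin r) t ca cb ba) (mc_conv (lsm_neg_fin r) t ca cb ba).
by rewrite /conv -(RintegralTB ip in_); apply: eq_Rintegral => s _; rewrite E.
Qed.

Lemma continuous_mconv (g : R -> R) : continuous g -> (forall t, t < 0 -> g t = 0) ->
  continuous (mconv r g).
Proof.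
move=> cg g0.
have bg := continuous_locally_bounded cg g0.
have c (nu : {measure set (measurableTypeR R) -> \bar R}) :
    (forall T : R, (nu `[0%R, T]%classic < +oo)%E) -> continuous (mc nu g).
  move=> nuf; have -> : mc nu g = fun t => \int[nu]_(s in `[0, t]) (g (t - s) * cst 1 s).
    by apply/funext => t; apply: eq_Rintegral => s _; rewrite mulr1.
  apply: continuous_conv_measure => // T.
  have mT : measurable (`[0, T]%classic : set (measurableTypeR R)) by exact: measurable_itv.
  apply/integrableP; split; first by apply/measurable_EFinP; exact: measurable_cst.
  by under eq_integral do rewrite /= normr1; rewrite integral_cst// mul1e; exact: nuf.
move=> t; apply: cvgB; [exact: (c _ (lsm_pos_fin r) t)|exact: (c _ (lsm_neg_fin r) t)].
Qed.

Let co : causal one := causal_one.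
Let bo : locally_bounded one := bounded_one.
Let bof : convolution_bounded one f := convolution_bounded_bounded co cf bo if_.
Let Phi := conv one f.

Let cPhi : continuous Phi.
Proof.
have -> : Phi = fun t => \int[leb]_(s in `[0, t]) f s by apply/funext => t; exact: conv_one.
exact: continuous_primitive.
Qed.

Let Phi0 t : t < 0 -> Phi t = 0. Proof. exact: conv_lt0. Qed.

(* An atom of r at t gives a weight to the arbitrary value f 0; integrating the
   equation in t removes this contribution. *)
Lemma mconv_primitive t : mconv r Phi t = conv one one t.
Proof.
have [i ->] := mconv_conv t cf co bof.
apply: ae_eq_Rintegral; first exact: L1_measurable i.
  exact: measurable_conv_integrand (proj1 co) (proj1 co).
apply: aeS (ae_not_in_set1 0) => s s0; congr (_ * _).
have [sn|sp] := ltP s 0; first by rewrite mconv_lt0// ext_lt0.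
by rewrite rf ?extE// lt_neqAle eq_sym s0.
Qed.

(* Both sides are recovered from their primitives, using
   r * (1 * (f * m)) = (r * (1 * f)) * m. *)
Lemma first_kind_inversion t : mconv r D t = \int[leb]_(s in `[0, t]) m s.
Proof.
have cPhi' := continuous_causal cPhi Phi0.
have bPhi := continuous_locally_bounded cPhi Phi0.
have cD' := continuous_causal cD D0; have bD := continuous_locally_bounded cD D0.
have iD := L1loc_bounded cD' bD.
have bm : convolution_bounded m Phi.
  exact: convolution_boundedC (convolution_bounded_bounded cPhi' cm bPhi im).
have E1 T : mconv r (conv m Phi) T = conv one (conv one m) T.
  have [_ ->] := mconv_conv T cPhi' cm bm.
  have [C1 HC1] := convolution_bounded_bounded co co bo (L1loc_bounded co bo) T.
  rewrite (conv_assoc co cm co HC1 (L1loc_itv T im)).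
  rewrite [RHS]convC; [|exact: (measurable_conv (proj1 co) (proj1 co))|exact: (proj1 cm)].
  by apply: eq_Rintegral => s _; rewrite mconv_primitive.
have E2 : conv m Phi = conv one D.
  apply/funext => T; rewrite convC; [|exact: (proj1 cm)|exact: (proj1 cPhi')].
  have [C1 HC1] := bof T.
  rewrite /Phi -(conv_assoc cf cm co HC1 (L1loc_itv T im)).
  by apply: eq_Rintegral => s _; rewrite fmD.
pose M s := \int[leb]_(u in `[0, s]) m u.
have M1 s : conv one m s = M s by exact: conv_one.
have cM : continuous M by exact: continuous_primitive.
(* This error is continuous, so it is zero everywhere as soon as all its integrals over [[0, T]]
   vanish. *)
pose Er s := mconv r D s - M s.
have cE : continuous Er by move=> s; apply: cvgB; [exact: continuous_mconv|exact: cM].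
have E0 s : s < 0 -> Er s = 0.
  by move=> s0; rewrite /Er mconv_lt0// -M1 conv_lt0// subrr.
have cE' := continuous_causal cE E0.
have iE := L1loc_bounded cE' (continuous_locally_bounded cE E0).
suff : Er t = 0 by move/eqP; rewrite subr_eq0 => /eqP.
apply: continuous_ae0 => //; apply: integrals_eq0_ae => // T T0.
rewrite -conv_one//.
have [iD1 eD1] := mconv_conv T cD' co (convolution_bounded_bounded co cD' bo iD).
have cMc : causal M by rewrite -(funext M1); exact: causal_conv.
have iM1 : L1 leb (fun s => one (T - s) * M s).
  apply: L1_convC; apply: L1_conv_bounded => //.
  apply: L1loc_bounded => //; apply: continuous_locally_bounded => //; exact: (proj2 cMc).
transitivity (conv one (mconv r D) T - conv one M T).
  rewrite -(RintegralTB iD1 iM1); apply: eq_Rintegral => s _.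
  by rewrite /Er mulrBr.
rewrite -eD1 -E2 E1; apply/eqP; rewrite subr_eq0; apply/eqP.
by apply: eq_Rintegral => s _; rewrite M1.
Qed.

End FirstKindResolvent.

(** * Stationary solutions *)

Section StationarySolutions.
Context {R : realType} {d : measure_display} {Omega : measurableType d}.
Variable P : probability Omega R.
Variable F : R -> set (set Omega).
Hypothesis hF : usual_filtration P F.
Variable W : R -> Omega -> R.
Hypothesis hW : brownian_motion P F W.
Variables (phi K mu sigma Rl f : R -> R) (lambda : R) (X : R -> Omega -> R).
Hypothesis hphi : {within `[0, +oo[, continuous phi}.
Hypothesis hphi0 : phi 0 = 1.
Hypothesis hK : kernel_assumption K.
Hypothesis lambda_gt0 : 0 < lambda.
Hypothesis hR : resolvent_assumption K lambda Rl f.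
Hypothesis hsigma : lipschitz sigma.
Hypothesis hmu : admissible_drift mu.
Hypothesis hX0 : X 0 \in Lfun P 2%:E.
Hypothesis hX : volterra_sde_solution P F W phi K mu lambda sigma X.
Variables (m0 v0 sbar : R).
Hypothesis hmean : forall t : R, 0 <= t -> ('E_P[X t] = m0%:E)%E.
Hypothesis hvar0 : variance P (X 0) = v0%:E.
Hypothesis hsig : forall t, 0 <= t -> ('E_P[fun w => (sigma (X t w) ^+ 2)%R] = (sbar ^+ 2)%:E)%E.

Local Notation leb := (@lebesgue_measure R).
Local Notation one := (ext (cst 1) : R -> R).
Local Notation k := (ext K).
Local Notation fe := (ext f).
Local Notation m := (ext mu).
Local Notation psi := (stationarity_profile phi f).
Local Notation J t := (\int[leb]_(s in `[0, t]) (f s ^+ 2)).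

Let lambda0 : lambda != 0. Proof. by rewrite gt_eqF. Qed.
Let K2 : L2loc K := kernel_L2loc hK.
Let ck : causal k := causal_K K2.
Let cfe : causal fe := causal_f hR.
Let ik : L1loc k := L1loc_ext (L2loc_L1loc K2).
Let if_ : L1loc f := L2loc_L1loc (square_integrable_L2loc (resolvent_f_L2 hR)).
Let fk : convolution_bounded fe k := convolution_bounded_fK K2 hR.
Let res := resolvent_ae K2 lambda_gt0 hR.
Let imu : L1loc mu := proj1 hmu.
Let cm : causal m := L1loc_causal imu.

Let LX0 : L2 P (X 0).
Proof.
by split; [exact: (adapted_measurable hF (lexx 0) (solution_adapted hX (lexx 0)))|
  exact: Lfun2_integrable_sqr].
Qed.

Let LX t (t0 : 0 <= t) : L2 P (X t) :=
  solution_L2 hF hW hphi K2 lambda_gt0 hR hsigma imu LX0 hX hsig t0.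

Let EX t : 0 <= t -> \int[P]_w X t w = m0.
Proof. by move=> /hmean; rewrite unlock /Rintegral => ->. Qed.

Lemma variance_L2 t : 0 <= t ->
  variance P (X t) = (\int[P]_w ((X t w - m0) ^+ 2))%:E.
Proof.
move=> t0; have L0 : L2 P (cst m0).
  by split; [exact: measurable_cst|exact: (finite_measure_integrable_cst P (m0 ^+ 2))].
rewrite (EFin_Rintegral (proj2 (L2B (LX t0) L0))).
rewrite /variance unlock hmean//= unlock; apply: eq_integral => w _.
by rewrite /= expr2.
Qed.

Lemma variance_profile t : 0 <= t ->
  variance P (X t) = (psi t ^+ 2 * v0 + sbar ^+ 2 / lambda ^+ 2 * J t)%:E.
Proof.
move=> t0; rewrite variance_L2//.
rewrite (solution_variance hF hW hphi K2 lambda_gt0 hR hsigma imu LX0 hX hsig t0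
  (EX (lexx 0)) (EX t0)).
by have := variance_L2 (lexx 0); rewrite hvar0 => -[<-].
Qed.

Lemma drift_convolution t : 0 <= t ->
  convol_integrable f mu t /\ convol f mu t = lambda * m0 * (1 - psi t).
Proof.
move=> t0; rewrite convol_integrableE convolE.
have i := L1_kernel_drift K2 imu hX t.
have [i1 _ _ _ _] := resolvent_conv ck cfe fk res cm (L1loc_ext imu) i.
split => //.
have := solution_mean hF hW hphi K2 lambda_gt0 hR hsigma imu LX0 hX hsig t0.
rewrite (EX t0) (EX (lexx 0)); move: (conv fe m t) (psi t) => a b E.
have -> : a = lambda * (a / lambda) by rewrite mulrCA divff ?mulr1.
have -> : a / lambda = m0 - m0 * b by lra.
by ring.
Qed.

(** Applied with [g = h], and in the degenerate case with [g = 1], for which the right-hand side is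
    the critical function [1 + lambda \int K]. *)
Lemma profile_inverse (g : R -> R) : causal (ext g) -> locally_bounded (ext g) ->
  (forall t, 0 <= t -> psi t = g t) <->
  (forall t, 0 <= t -> phi t = g t + lambda * convol K g t).
Proof.
move=> cg bg.
have [cp bp] := (causal_continuous hphi, locally_bounded_continuous hphi).
have := resolvent_inverse ck cfe ik fk res cp cg bp bg => -[H1 H2].
split => E t t0.
  rewrite convolE -(extE g t0) -(extE phi t0); apply: H1 => {t0}t.
  have [t0|t0] := ltP t 0; last by rewrite (extE g t0) -E.
  by rewrite !ext_lt0// conv_lt0// subrr.
rewrite -(extE g t0); apply: H2 => {t0}t.
have [t0|t0] := ltP t 0; last by rewrite !extE// E// convolE.
by rewrite !ext_lt0// conv_lt0// mulr0 addr0.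
Qed.

Lemma convol_cst1 t : convol K (cst 1) t = \int[leb]_(s in `[0, t]) K s.
Proof.
have co := causal_one : causal one.
rewrite convolE convC; [|by case: ck|by case: co].
rewrite conv_one//; apply: eq_Rintegral => s.
by rewrite inE/= in_itv/= => /andP[s0 _]; rewrite extE.
Qed.

Lemma ae_zero_ext (g : R -> R) : ae_zero g <-> {ae leb, forall t, ext g t = 0}.
Proof.
split; apply: aeS => t.
  by rewrite /ext; case: ifP => // t0; apply.
by move=> + t0; rewrite extE.
Qed.

(** The difference of two solutions is again bounded at infinity, hence has a Laplace transform, and
    solves the homogeneous equation. *)
Lemma first_kind_solution_unique (g nu1 nu2 : R -> R) :
  admissible_drift nu1 -> admissible_drift nu2 ->
  first_kind_volterra_solution f g nu1 -> first_kind_volterra_solution f g nu2 ->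
  ae_halfline (fun t => nu1 t = nu2 t).
Proof.
move=> [i1 [A1 [M1 b1]]] [i2 [A2 [M2 b2]]] s1 s2.
pose nu t := nu1 t - nu2 t.
have nuE : ext nu = fun t => ext nu1 t - ext nu2 t.
  by apply/funext => t; rewrite /ext /nu; case: ifP => // _; rewrite subr0.
have anu : admissible_drift nu.
  split; first by move=> T T0; apply: integrable_EFinB; [|exact: i1|exact: i2].
  exists (Num.max A1 A2), (M1 + M2).
  apply: aeS2 b1 b2 => t h1 h2 t0; rewrite ge_max => /andP[a1 a2].
  by apply: le_trans (ler_normB _ _) _; apply: lerD; [exact: h1|exact: h2].
have L t : 0 <= t -> L1 leb (fun s => fe (t - s) * ext nu s) /\ conv fe (ext nu) t = 0.
  move=> t0; have [/convol_integrableE j1 e1] := s1 t t0.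
  have [/convol_integrableE j2 e2] := s2 t t0.
  rewrite convolE in e1; rewrite convolE in e2.
  have E s : fe (t - s) * ext nu1 s - fe (t - s) * ext nu2 s = fe (t - s) * ext nu s.
    by rewrite nuE mulrBr.
  split; first by have := L1B j1 j2; congr (integrable _ _ _); apply/funext => s; rewrite E.
  transitivity (conv fe (ext nu1) t - conv fe (ext nu2) t); last by rewrite e1 e2 subrr.
  by rewrite -(RintegralTB j1 j2); apply: eq_Rintegral => s _; rewrite E.
have := first_kind_kernel0 hK lambda_gt0 hR anu (fun t t0 => proj1 (L t t0))
  (fun t t0 => proj2 (L t t0)).
apply: aeS => t E t0; move: E; rewrite extE// => /eqP.
by rewrite subr_eq0 => /eqP.
Qed.

Lemma ae_zero_drift t : ae_zero mu -> 0 <= t -> m0 * (1 - psi t) = 0.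
Proof.
move=> /ae_zero_ext mu0 t0; have [_ E] := drift_convolution t0.
have mc : measurable_fun setT (cst 0 : R -> R) by exact: measurable_cst.
have h : {ae leb, forall s : R, fe (t - s) * m s = cst 0 s}.
  by apply: aeS mu0 => s ->; rewrite mulr0.
have c0 : conv fe m t = 0.
  rewrite /conv (@ae_eq_Rintegral _ _ _ leb (fun s => fe (t - s) * m s) (cst 0)
    (measurable_conv_integrand t (proj1 cfe) (proj1 cm)) mc h).
  by rewrite Rintegral_cst// mul0r.
move: E; rewrite convolE c0 -mulrA => /esym/eqP.
by rewrite mulf_eq0 (negbTE lambda0) => /eqP.
Qed.

Lemma drift_ae_zero : (forall t, 0 <= t -> convol f mu t = 0) -> ae_zero mu.
Proof.
move=> E; apply/ae_zero_ext; apply: (first_kind_kernel0 hK lambda_gt0 hR hmu) => t t0.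
  by have [/convol_integrableE] := drift_convolution t0.
by rewrite -convolE E.
Qed.

(** * The case of vanishing noise *)

Section DegenerateNoise.
Hypothesis sbar0 : sbar = 0.
Hypothesis hstat : stationary_variance P X v0.

Let sigma_ae t : 0 <= t -> {ae P, forall w, sigma (X t w) = 0}.
Proof.
move=> t0; have ms : measurable_fun setT (fun w => sigma (X t w)).
  exact: (measurableT_comp (lipschitz_measurable hsigma) (proj1 (LX t0))).
have Es : (\int[P]_w (sigma (X t w) ^+ 2)%:E = 0)%E.
  by have := hsig t0; rewrite unlock sbar0 expr0n.
have is2 : L1 P (fun w => sigma (X t w) ^+ 2).
  apply: L1_abs_lty; first exact: measurable_funX.
  by under eq_integral do rewrite ger0_norm ?sqr_ge0//; rewrite Es ltry.
have := Rintegral0_ae is2 (fun w => sqr_ge0 _); rewrite /Rintegral Es => /(_ erefl).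
by apply: aeS => w /eqP; rewrite sqrf_eq0 => /eqP.
Qed.

Let profile_sqr t : 0 <= t -> psi t ^+ 2 * v0 = v0.
Proof.
move=> t0; have := hstat t0; rewrite variance_profile// sbar0 expr0n/= mul0r mul0r addr0.
by case.
Qed.

(** A positive variance can be divided out, leaving [psi^2 = 1]; continuity selects [psi = 1]. *)
Let profile1 : v0 != 0 -> forall t, 0 <= t -> psi t = 1.
Proof.
move=> v0n; apply: (profile_eq_sqr hphi hphi0 if_ (h := cst 1)) => // t t0.
rewrite expr1n; apply: (mulIf v0n); rewrite mul1r; exact: profile_sqr.
Qed.

Let constant t : v0 = 0 -> 0 <= t -> {ae P, forall w, X t w = m0}.
Proof.
move=> v00 t0; have L0 : L2 P (cst m0).
  by split; [exact: measurable_cst|exact: (finite_measure_integrable_cst P (m0 ^+ 2))].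
have := Rintegral0_ae (proj2 (L2B (LX t0) L0)) (fun w => sqr_ge0 _).
have := hstat t0; rewrite variance_L2// v00 => -[->] /(_ erefl).
by apply: aeS => w /eqP; rewrite sqrf_eq0 subr_eq0 => /eqP.
Qed.

(** If [v0] were nonzero, then [psi = 1], so [f * mu = 0] and [mu = 0] a.e., and [phi] would be the
    critical function: both alternatives are excluded. Thus [v0 = 0] and [X] is the constant [m0]; a
    single outcome with [X 0 = m0] and [sigma (X 0) = 0] gives [sigma m0 = 0]. *)
Lemma degenerate_constant :
  (~ ae_zero mu \/ (ae_zero mu /\
    ~ ae_halfline (fun t => phi t = 1 + lambda * \int[leb]_(s in `[0, t]) K s))) ->
  sigma m0 = 0 /\ forall t : R, 0 <= t -> {ae P, forall w, X t w = m0}.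
Proof.
move=> H; have v00 : v0 = 0.
  apply/eqP/negPn/negP => /profile1 psi1.
  have mu0 : ae_zero mu.
    apply: drift_ae_zero => t t0; have [_ ->] := drift_convolution t0.
    by rewrite psi1// subrr mulr0.
  case: H => [//|[_]]; apply; apply: aeT => t t0.
  have := (profile_inverse causal_one (@bounded_one R)).1 psi1 t t0.
  by rewrite convol_cst1.
split; last by move=> t; exact: constant.
have h0 := lexx (0 : R).
have [w [<- //]] := probability_ae_ex (aeS2 (fun w => @conj _ _) (constant v00 h0) (sigma_ae h0)).
Qed.

(** If [v0 = 0], both variables equal [m0]. Otherwise [psi = 1], which cancels the drift term of the
    decomposition, and the residual has norm zero, so only [X 0] remains. *)
Lemma degenerate_frozen : ae_zero mu ->
  {ae P, forall w, sigma (X 0 w) = 0} /\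
  forall t : R, 0 <= t -> {ae P, forall w, X t w = X 0 w}.
Proof.
move=> mu0; split; first exact: sigma_ae.
move=> t t0; have [v00|v0n] := eqVneq v0 0.
  by apply: aeS2 (constant v00 t0) (constant v00 (lexx 0)) => w -> ->.
have psi1 := profile1 v0n.
have LZ := residual_L2 hF hW hphi K2 hR hsigma imu hX hsig t.
have := residual_norm hF hW hphi K2 lambda_gt0 hR hsigma imu hX hsig t.
rewrite sbar0 expr0n/= !mul0r => /(Rintegral0_ae (proj2 LZ) (fun w => sqr_ge0 _)).
apply: aeS => w /eqP; rewrite sqrf_eq0 => /eqP Z0.
have := solution_decomposition hphi K2 lambda_gt0 hR imu hX w t0.
have [_] := drift_convolution t0; rewrite convolE psi1// subrr mulr0 => ->.
by rewrite Z0 mul0r !addr0 mulr1.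
Qed.

End DegenerateNoise.

(** * The case of positive noise *)

Section NondegenerateNoise.
Hypothesis sbar0 : 0 < sbar.
Let c := v0 / sbar ^+ 2.
Hypothesis cS : (lambda ^+ 2)^-1 * \int[leb]_(s in `[0, +oo[) (f s ^+ 2) <= c.
Let h := hfun f lambda c.
Let rhs t := lambda * m0 * (1 - h t).

Let f2 : square_integrable `[0, +oo[ f := resolvent_f_L2 hR.
Let fn0 : ae_halfline (fun t => f t != 0) := resolvent_f_neq0 hR.
Let c0 : 0 < c := scale_gt0 f2 fn0 lambda_gt0 cS.
Let h0 t : 0 < h t := hfun_gt0 f2 fn0 lambda_gt0 cS t.
Let ch : continuous h := continuous_hfun f2.

Lemma stationary_profile :
  stationary_variance P X v0 <-> forall t, 0 <= t -> psi t = h t.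
Proof.
have sn : sbar != 0 by rewrite gt_eqF.
have v0E : v0 = c * sbar ^+ 2 by rewrite /c divfK// expf_neq0.
have E t : 0 <= t -> psi t ^+ 2 * v0 + sbar ^+ 2 / lambda ^+ 2 * J t = v0 <->
    psi t ^+ 2 = h t ^+ 2.
  move=> t0; rewrite (hfun_sqr f2 fn0 lambda_gt0 cS t0) {1 2}v0E.
  have cn : c != 0 by rewrite gt_eqF.
  move: (J t) (psi t ^+ 2) => a b; split => [H|->]; last first.
    by field; rewrite lambda0.
  have -> : b = (b * (c * sbar ^+ 2)) / (c * sbar ^+ 2) by rewrite mulfK// mulf_neq0// expf_neq0.
  have -> : b * (c * sbar ^+ 2) = c * sbar ^+ 2 - sbar ^+ 2 / lambda ^+ 2 * a.
    by rewrite -[in RHS]H addrK.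
  by field; rewrite lambda0 cn.
split => [st|psih t t0].
  apply: (profile_eq_sqr hphi hphi0 if_) => t t0 //.
  by apply/(E t t0); have := st t t0; rewrite variance_profile// => -[].
by rewrite variance_profile//; congr (_%:E); apply/(E t t0); rewrite psih.
Qed.

Lemma profile_phi_stat : (forall t, 0 <= t -> psi t = h t) <->
  (forall t, 0 <= t -> phi t = h t + lambda * convol K h t).
Proof.
apply: profile_inverse.
  apply: causal_ext => T T0; apply: measurable_funTS; exact: continuous_measurable_fun.
move=> T; exists 1 => t _; rewrite /ext; case: ifP => _; last by rewrite normr0.
by rewrite ger0_norm ?(ltW (h0 t))//; exact: (hfun_le1 f2 fn0 lambda_gt0 cS).
Qed.

(** With [m0 = 0] the right-hand side would be zero and force [mu = 0] a.e. This justifies dividing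
    by [lambda m0] below. *)
Lemma nonzero_mean : ~ ae_zero mu -> first_kind_volterra_solution f rhs mu -> m0 != 0.
Proof.
move=> mun0 sol; apply/eqP => m00; apply: mun0; apply: drift_ae_zero => t t0.
by have [_ ->] := sol t t0; rewrite /rhs m00 mulr0 mul0r.
Qed.

(** In the case of a nonzero drift, [f * mu] equals [lambda m0 (1 - psi)] by constancy of the mean
    and [lambda m0 (1 - h)] by the first-kind equation; cancelling [lambda m0] gives [psi = h]. *)
Lemma stationary_iff : stationary_variance P X v0 <->
  (ae_zero mu /\ forall t : R, 0 <= t -> phi t = h t + lambda * convol K h t) \/
  (~ ae_zero mu /\ first_kind_volterra_solution f rhs mu).
Proof.
rewrite stationary_profile -profile_phi_stat; split => [psih|[[]//|[mun0 sol]]].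
  have [mu0|mun0] := pselect (ae_zero mu); first by left.
  right; split => // t t0; have [i E] := drift_convolution t0; split => //.
  by rewrite E psih.
move=> t t0; have [_ E] := drift_convolution t0; have [_ E'] := sol t t0.
have m0n := nonzero_mean mun0 sol.
have := etrans (esym E) E'; rewrite /rhs => /(mulfI _) H.
have : 1 - psi t = 1 - h t by apply: H; rewrite mulf_neq0.
by move: (psi t) (h t) => a b; lra.
Qed.

Lemma zero_mean : ae_zero mu ->
  (forall t : R, 0 <= t -> phi t = h t + lambda * convol K h t) -> m0 = 0.
Proof.
move=> mu0 /profile_phi_stat psih.
(* Time 1 is an arbitrary positive time, at which [psi = h < 1]. *)
have := ae_zero_drift mu0 ler01; rewrite psih// => /eqP; rewrite mulf_eq0.
case/orP => [/eqP//|]; rewrite subr_eq0 eq_sym lt_eqF//.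
exact: (hfun_lt1 f2 fn0 lambda_gt0 cS ltr01).
Qed.

(** The normalized drift [mu / (lambda m0)] has convolution [1 - h] with [f], so [r] applied to
    [1 - h] is its primitive; Lebesgue differentiation then yields both the derivative and its value
    almost everywhere. *)
Lemma drift_from_resolvent (r : @locfin_signed_measure R) :
  ~ ae_zero mu -> first_kind_volterra_solution f rhs mu -> first_kind_resolvent f r ->
  ae_halfline (fun t => derivable (mconv r (fun s => 1 - h s)) t 1 /\
    mu t = lambda * m0 * derive1 (mconv r (fun s => 1 - h s)) t).
Proof.
move=> mun0 sol hr; have m0n := nonzero_mean mun0 sol.
(* At negative times the integral in [h] is over an empty interval, so [h = 1] there and [D] is
   causal and continuous without any extension. *)
pose D t := 1 - h t.
have D0 t : t < 0 -> D t = 0.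
  by move=> t0; rewrite /D /h (hfun_npos f lambda c (ltW t0)) subrr.
have cD : continuous D by move=> t; apply: cvgB; [exact: cvg_cst|exact: ch].
have lm0 : lambda * m0 != 0 by rewrite mulf_neq0.
pose m' t := (lambda * m0)^-1 * m t.
have cm' : causal m'.
  split; first by apply: measurable_funM => //; case: cm.
  by move=> t t0; rewrite /m' (proj2 cm)// mulr0.
have im' : L1loc m' by move=> T T0; apply: integrable_EFinZ => //; exact: (L1loc_ext imu T0).
have fmD t : conv fe m' t = D t.
  have [t0|t0] := ltP t 0; first by rewrite conv_lt0// D0.
  have [/convol_integrableE i E] := sol t t0.
  transitivity ((lambda * m0)^-1 * conv fe m t).
    by rewrite -(RintegralTZ _ i); apply: eq_Rintegral => s _; rewrite /m' mulrCA.
  by rewrite -convolE E mulKf.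
have rf t : 0 < t -> mconv r fe t = 1.
  move=> t0; have [_ <-] := hr t t0.
  by congr (_ - _); apply: eq_Rintegral => s; rewrite inE/= in_itv/= => /andP[s0 st];
    rewrite extE// subr_ge0.
have G := first_kind_inversion cfe (L1loc_ext if_) cm' im' cD D0 fmD rf.
rewrite (funext G).
apply: aeS2 (ae_derivable_integral cm' im') (ae_not_in_set1 0) => t Ht tn0 t0.
have [|dG ->] := Ht; first by rewrite lt_neqAle eq_sym tn0.
by split => //; rewrite /m' mulVKf// extE.
Qed.

End NondegenerateNoise.

End StationarySolutions.

Theorem theorem3p4 (R : realType) (d : measure_display)
    (Omega : measurableType d) (P : probability Omega R)
    (F : R -> set (set Omega)) (hF : usual_filtration P F)
    (W : R -> Omega -> R) (hW : brownian_motion P F W)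
    (phi : R -> R) (hphi : {within `[0, +oo[, continuous phi})
    (hphi_hoelder : loc_hoelder phi) (hphi0 : phi 0 = 1)
    (K : R -> R) (hK : kernel_assumption K)
    (lambda : R) (hlambda : 0 < lambda)
    (Rl f : R -> R) (hR : resolvent_assumption K lambda Rl f)
    (sigma : R -> R) (hsigma : lipschitz sigma)
    (mu : R -> R) (hmu : admissible_drift mu)
    (X : R -> Omega -> R)
    (hX0 : X 0 \in Lfun P 2%:E) (hX0W : independent_of_process P (X 0) W)
    (hX : volterra_sde_solution P F W phi K mu lambda sigma X)
    (m0 v0 sbar0 : R) (hv0 : 0 <= v0) (hsbar0 : 0 <= sbar0)
    (hmean : forall t : R, 0 <= t -> ('E_P[X t] = m0%:E)%E)
    (hvar0 : variance P (X 0) = v0%:E)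
    (hsig : forall t : R, 0 <= t ->
       ('E_P[fun w => (sigma (X t w) ^+ 2)%R] = (sbar0 ^+ 2)%:E)%E) :
  let phi_crit := fun t => 1 + lambda * \int[lebesgue_measure]_(s in `[0, t]) K s in
  let c := v0 / sbar0 ^+ 2 in
  let h := hfun f lambda c in
  let phi_stat := fun t => h t + lambda * convol K h t in
  let drift_rhs := fun t => lambda * m0 * (1 - h t) in
  (sbar0 = 0 -> stationary_variance P X v0 ->
     ((~ ae_zero mu \/
       (ae_zero mu /\ ~ ae_halfline (fun t => phi t = phi_crit t))) ->
      sigma m0 = 0 /\
      forall t : R, 0 <= t -> {ae P, forall w, X t w = m0}) /\
     (ae_zero mu -> ae_halfline (fun t => phi t = phi_crit t) ->
      {ae P, forall w, sigma (X 0 w) = 0} /\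
      forall t : R, 0 <= t -> {ae P, forall w, X t w = X 0 w})) /\
  (0 < sbar0 ->
   (lambda ^+ 2)^-1 * \int[lebesgue_measure]_(s in `[0, +oo[) (f s ^+ 2) <= c ->
     (stationary_variance P X v0 <->
       (ae_zero mu /\ forall t : R, 0 <= t -> phi t = phi_stat t) \/
       (~ ae_zero mu /\ first_kind_volterra_solution f drift_rhs mu)) /\
     (ae_zero mu -> (forall t : R, 0 <= t -> phi t = phi_stat t) -> m0 = 0) /\
     (~ ae_zero mu -> first_kind_volterra_solution f drift_rhs mu ->
       (forall nu1 nu2 : R -> R, admissible_drift nu1 -> admissible_drift nu2 ->
          first_kind_volterra_solution f drift_rhs nu1 ->
          first_kind_volterra_solution f drift_rhs nu2 ->
          ae_halfline (fun t => nu1 t = nu2 t)) /\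
       (forall r : locfin_signed_measure, first_kind_resolvent f r ->
          let G := mconv r (fun s => 1 - h s) in
          ae_halfline (fun t =>
            derivable G t 1 /\ mu t = lambda * m0 * derive1 G t)))).
Proof.
move=> phi_crit c h phi_stat drift_rhs; split.
  move=> s0 hstat; split.
    exact: (degenerate_constant hF hW hphi hphi0 hK hlambda hR hsigma hmu hX0 hX
      hmean hvar0 hsig s0 hstat).
  move=> mu0 _.
  exact: (degenerate_frozen hF hW hphi hphi0 hK hlambda hR hsigma hmu hX0 hX
    hmean hvar0 hsig s0 hstat mu0).
move=> s0 cS; split; last split.
- exact: (stationary_iff hF hW hphi hphi0 hK hlambda hR hsigma hmu hX0 hX
    hmean hvar0 hsig s0 cS).
- exact: (zero_mean hF hW hphi hK hlambda hR hsigma hmu hX0 hX hmean hsig cS).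
move=> mun0 sol; split.
  by move=> nu1 nu2; exact: (first_kind_solution_unique hK hlambda hR).
move=> r hr.
exact: (drift_from_resolvent hF hW hphi hK hlambda hR hsigma hmu hX0 hX hmean hsig
  mun0 sol hr).
Qed.
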